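(* Let $K$ be a real valued field and $f\in\mathfrak{m}^2\subseteq K\{x\}=K\{x_1,\dots,x_n\}$. 1. Let $\operatorname{char}(K)\neq 2$ and $\operatorname{rank}H(f)=k$. Then $f$ is right equivalent to $$a_1x_1^2+\ldots+a_kx_k^2+g(x_{k+1},\dots,x_n)$$ with $a_i\in K$, $a_i\neq 0$, and $g\in\langle x_{k+1},\dots,x_n\rangle^3\subseteq K\{x_{k+1},\dots,x_n\}$. The series $g$ (the residual part of $f$) is uniquely determined up to right equivalence in $K\{x_{k+1},\dots,x_n\}$. 2. Let $\operatorname{char}(K)=2$ and $\operatorname{rank}H(f)=2l$. Then $f$ is right equivalent to $$\sum_{i\text{ odd},\,i=1}^{2l-1}\bigl(a_ix_i^2+x_ix_{i+1}+a_{i+1}x_{i+1}^2\bigr)+\sum_{i=2l+1}^{n}d_ix_i^2+h(x_{2l+1},\dots,x_n)$$ with $a_i,d_i\in K$ and $h\in\langle x_{2l+1},\dots,x_n\rangle^3\subseteq K\{x_{2l+1},\dots,x_n\}$. The series $g:=\sum_{i=2l+1}^{n}d_ix_i^2+h(x_{2l+1},\dots,x_n)$ (the residual part of $f$) is uniquely determined up to right equivalence in $K\{x_{2l+1},\dots,x_n\}$. Here ''uniquely determined up to right equivalence'' means: if $f$ is right equivalent to two power series of the displayed form, with the same coefficients $a_i$ (and, in case 2, the same coefficients $d_i$) and with residual parts $g_0$ and $g_1$ respectively, then $g_0$ and $g_1$ are right equivalent in $K\{x_{k+1},\dots,x_n\}$ (respectively in $K\{x_{2l+1},\dots,x_n\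}$).
   Context: A real valued field is a field $K$ with a map $|\ |:K\to\mathbb{R}_{\ge 0}$ satisfying $|a|=0\Leftrightarrow a=0$, $|ab|=|a||b|$, $|a+b|\le|a|+|b|$ (the trivial valuation is allowed; $K$ need not be complete). For $x=(x_1,\dots,x_n)$, $K\{x\}\subseteq K[[x]]$ is the ring of convergent power series: those $f=\sum_\alpha c_\alpha x^\alpha$ for which $\sum_\alpha|c_\alpha|\varepsilon^\alpha<\infty$ for some $\varepsilon\in(\mathbb{R}_{>0})^n$. $\mathfrak{m}=\langle x_1,\dots,x_n\rangle$ is its maximal ideal. $f,g\in K\{x\}$ are right equivalent if $f=\varphi(g)$ for some automorphism $\varphi$ of the local $K$-algebra $K\{x\}$ (and analogously in fewer variables). $H(f)=\bigl(\frac{\partial^2f}{\partial x_i\partial x_j}(0)\bigr)_{i,j=1,\dots,n}$ is the Hessian matrix of $f$ at $0$; in characteristic $2$ its rank is always even. *)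

(* Defs.v *)
From HB Require Import structures.
From mathcomp Require Import all_boot all_order all_algebra.
From mathcomp Require Import finmap.
From mathcomp Require Import mathcomp_extra boolp classical_sets functions.
From mathcomp Require Import cardinality fsbigop reals constructive_ereal ereal.
From mathcomp Require Import esum.

Set Implicit Arguments.
Unset Strict Implicit.
Unset Printing Implicit Defensive.

Import Order.TTheory GRing.Theory Num.Theory.

Local Open Scope classical_set_scope.
Local Open Scope ring_scope.

(* The trivial absolute value is allowed and K need not be complete. *)
Record real_valuation (R : realType) (K : fieldType) := RealValuation {
  absv :> K -> R;
  absv_ge0 : forall a, 0 <= absv a;
  absv_eq0 : forall a, absv a = 0 <-> a = 0;
  absvM : forall a b, absv (a * b) = absv a * absv b;
  absvD_le : forall a b, absv (a + b) <= absv a + absv b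
}.

Section Exponents.
Variable I : finType.

Definition expo := {ffun I -> nat}.

HB.instance Definition _ := GRing.Nmodule.on expo.
HB.instance Definition _ := Choice.on expo.

Definition expo1 (i : I) : expo := [ffun j => (j == i : nat)].

(* The exponents all of whose entries are at most N, used in proofs to turn
   sums over exponents into sums over a finite type. *)
Definition box (N : nat) := {ffun I -> 'I_N.+1}.
HB.instance Definition _ N := Finite.on (box N).

Definition bx N (a : box N) : expo := [ffun i => (a i : nat)].

Lemma bx_inj N : injective (@bx N).
Proof.
move=> a b /ffunP ab; apply/ffunP => i; apply/val_inj.
by have := ab i; rewrite !ffunE.
Qed.

Lemma bx_le N (a : box N) i : (bx a i <= N)%N.
Proof. by rewrite ffunE -ltnS. Qed.

Definition tobox N (e : expo) : box N := [ffun i => inord (e i)].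

Lemma bxK N (e : expo) : (forall i, (e i <= N)%N) -> bx (tobox N e) = e.
Proof. by move=> eN; apply/ffunP => i; rewrite !ffunE inordK ?ltnS. Qed.

Lemma expo_addE (a b : expo) i : (a + b) i = (a i + b i)%N.
Proof. by rewrite ffunE. Qed.

Lemma big_box1 (V : nmodType) N (e : expo) (X : box N -> V) :
  (forall i, (e i <= N)%N) -> \sum_(d : box N | bx d == e) X d = X (tobox N e).
Proof.
move=> eN; rewrite (big_pred1 (tobox N e))// => d /=.
by rewrite -(inj_eq (@bx_inj N)) bxK.
Qed.

Definition mdeg (e : expo) : nat := \max_i e i.

Lemma mdeg_le (e : expo) i : (e i <= mdeg e)%N.
Proof. exact: leq_bigmax. Qed.

End Exponents.

Section PowerSeries.
Variables (K : fieldType) (I : finType).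

(* K[[x_i : i in I]], a series being given by its coefficients. *)
Definition fps := expo I -> K.

HB.instance Definition _ := Choice.copy fps (expo I -> K).
HB.instance Definition _ := GRing.Lmodule.copy fps (expo I -> K^o).

Definition fps_one : fps := fun c => (c == 0)%:R.

Definition fps_mul (f g : fps) : fps := fun c =>
  \sum_(p \in [set p : expo I * expo I | p.1 + p.2 = c]) f p.1 * g p.2.

Lemma fps_mulE N (f g : fps) (c : expo I) : (forall i, (c i <= N)%N) ->
  fps_mul f g c = \sum_(a : box I N) \sum_(b : box I N | bx a + bx b == c)
                     f (bx a) * g (bx b).
Proof.
move=> cN; rewrite /fps_mul.
pose r := [seq (bx p.1, bx p.2) |
  p <- [seq p <- enum {: box I N * box I N} | bx p.1 + bx p.2 == c]].
rewrite (fsbigE r).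
- rewrite big_map big_filter_cond big_enum_cond/= pair_big_dep/=.
  apply: eq_bigl => -[a b] /=.
  by apply/andP/eqP => [[_]|ab]; rewrite in_setE ?ab.
- rewrite map_inj_uniq ?filter_uniq -?enumT ?enum_uniq//.
  by move=> [a b] [a' b'] /= [] /bx_inj -> /bx_inj ->.
- move=> p /= /mapP[q]; rewrite mem_filter => /andP[/eqP qc _] ->.
  by rewrite /= qc.
- move=> [a b] /= abc /negP[].
  have le i : (a i + b i <= N)%N by rewrite -expo_addE abc cN.
  have aN i : (a i <= N)%N by rewrite (leq_trans _ (le i))// leq_addr.
  have bN i : (b i <= N)%N by rewrite (leq_trans _ (le i))// leq_addl.
  apply/mapP; exists (tobox N a, tobox N b); last by rewrite /= !bxK.
  by rewrite mem_filter /= !bxK// abc eqxx mem_enum.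
Qed.

Let mulC : commutative fps_mul.
Proof.
move=> f g; apply/funext => c; rewrite !(fps_mulE _ _ (@mdeg_le _ c)).
rewrite (exchange_big_dep xpredT)//=.
apply: eq_bigr => a _; apply: eq_big => [b|b _]; first by rewrite addrC.
by rewrite mulrC.
Qed.

Let mul3E N (f g h : fps) (c : expo I) : (forall i, (c i <= N)%N) ->
  fps_mul f (fps_mul g h) c =
  \sum_(a : box I N) \sum_(b : box I N) \sum_(d : box I N |
     bx a + (bx b + bx d) == c) f (bx a) * (g (bx b) * h (bx d)).
Proof.
move=> cN; rewrite (fps_mulE _ _ cN); apply: eq_bigr => a _.
under eq_bigr => e _ do
  rewrite (@fps_mulE N _ _ (bx e) (@bx_le _ _ e)) mulr_sumr.
rewrite exchange_big/=; apply: eq_bigr => b _.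
under eq_bigr do rewrite mulr_sumr.
rewrite (exchange_big_dep xpredT)//= [RHS]big_mkcond/=.
apply: eq_bigr => d _.
under eq_bigl => e do rewrite eq_sym [X in _ && X]eq_sym.
case: ifP => [/eqP ec|/negP ec].
  have eN i : (((bx b + bx d)%R : expo I) i <= N)%N.
    by rewrite (leq_trans _ (cN i))// -ec [leqRHS]expo_addE leq_addl.
  rewrite -[RHS](big_box1 (fun=> f (bx a) * (g (bx b) * h (bx d))) eN).
  by apply: eq_bigl => e; case: (bx e =P bx b + bx d) => [->|]; rewrite ?andbF ?ec ?eqxx.
rewrite big_pred0// => e; apply/negP => /andP[/eqP ce /eqP be].
by apply: ec; rewrite -be ce.
Qed.

Let mulA : associative fps_mul.
Proof.
move=> f g h; apply/funext => c.
rewrite [fps_mul (fps_mul f g) h]mulC !(mul3E _ _ _ (@mdeg_le _ c)).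
rewrite [RHS]exchange_big/=; apply: eq_bigr => a _.
under [RHS]eq_bigr do rewrite big_mkcond/=.
rewrite [RHS]exchange_big/=; apply: eq_bigr => b _.
rewrite [LHS]big_mkcond/=; apply: eq_bigr => d _.
have -> : bx d + (bx a + bx b) = bx a + (bx b + bx d) by rewrite [LHS]addrC -addrA.
by case: ifP => // _; rewrite mulrA [RHS]mulrC.
Qed.

Let mul1f : left_id fps_one fps_mul.
Proof.
move=> f; apply/funext => c; rewrite (fps_mulE _ _ (@mdeg_le _ c)).
rewrite (bigD1 (tobox _ 0)) //= [X in _ + X]big1 ?addr0; last first.
  move=> a a0; rewrite big1// => b _; rewrite /fps_one.
  case: eqP => [/= e|]; last by rewrite mul0r.
  case/eqP: a0; apply/bx_inj; rewrite bxK// => i; by rewrite ffunE.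
have z : bx (tobox (mdeg c) (0 : expo I)) = 0 :> expo I.
  by apply: bxK => i; rewrite ffunE.
rewrite z; under eq_bigl do rewrite add0r.
by rewrite (big_box1 _ (@mdeg_le _ c)) (bxK (@mdeg_le _ c)) /fps_one eqxx mul1r.
Qed.

Let mulDl : left_distributive fps_mul +%R.
Proof.
move=> f g h; apply/funext => c.
rewrite [RHS]/GRing.add/= !(fps_mulE _ _ (@mdeg_le _ c)) -big_split/=.
apply: eq_bigr => a _; rewrite -big_split/=.
by apply: eq_bigr => b _; rewrite -mulrDl.
Qed.

Let one_neq0 : fps_one != 0.
Proof.
apply/eqP => /(congr1 (fun f : fps => f 0)); rewrite /fps_one eqxx.
by apply/eqP; rewrite oner_eq0.
Qed.

HB.instance Definition _ := GRing.Zmodule_isComNzRing.Build fps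
  mulA mulC mul1f mulDl one_neq0.

Let scaleAl (k : K) (f g : fps) : k *: (f * g) = k *: f * g.
Proof.
apply/funext => c; rewrite [LHS]/GRing.scale/=.
rewrite [f * g]/GRing.mul [RHS]/GRing.mul/= !(fps_mulE _ _ (@mdeg_le _ c)).
rewrite [LHS]mulr_sumr; apply: eq_bigr => a _; rewrite mulr_sumr.
by apply: eq_bigr => b _; rewrite mulrA.
Qed.

HB.instance Definition _ := GRing.Lmodule_isLalgebra.Build K fps scaleAl.
HB.instance Definition _ := GRing.Lalgebra_isComAlgebra.Build K fps.

Definition fps_var (i : I) : fps := fun c => (c == expo1 i)%:R.

Definition pderiv (i : I) (f : fps) : fps :=
  fun c => f (c + expo1 i) *+ (c i).+1.

End PowerSeries.

Section Convergent.
Variables (R : realType) (K : fieldType) (v : real_valuation R K).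

Section Theory.
Variable I : finType.
Implicit Types (f g : fps K I) (eps : I -> R).

Definition monomial_value eps (a : expo I) : R := \prod_i eps i ^+ a i.

Definition convergent f : Prop := exists eps : I -> R,
  (forall i, 0 < eps i) /\
  (\esum_(a in [set: expo I]) (v (f a) * monomial_value eps a)%:E < +oo)%E.

Lemma absv0 : v 0 = 0.
Proof. exact/absv_eq0. Qed.

Lemma absv1 : v 1 = 1.
Proof.
have v1 : v 1 != 0 by apply/eqP => /absv_eq0/eqP; rewrite oner_eq0.
by apply: (mulIf v1); rewrite -absvM !mul1r.
Qed.

Lemma absv_sum (T : Type) (r : seq T) (P : pred T) (F : T -> K) :
  v (\sum_(i <- r | P i) F i) <= \sum_(i <- r | P i) v (F i).
Proof.
elim/big_ind2: _ => [|x y z t xy zt|//]; first by rewrite absv0.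
exact: le_trans (absvD_le _ _ _) (lerD _ _).
Qed.

Lemma monv_ge0 eps a : (forall i, 0 < eps i) -> 0 <= monomial_value eps a.
Proof. by move=> e0; apply: prodr_ge0 => i _; rewrite exprn_ge0// ltW. Qed.

Lemma monvD eps a b :
  monomial_value eps (a + b) = monomial_value eps a * monomial_value eps b.
Proof.
by rewrite -big_split; apply: eq_bigr => i _; rewrite expo_addE exprD.
Qed.

Lemma monv_le eps eps' a : (forall i, 0 < eps i) ->
  (forall i, eps i <= eps' i) -> monomial_value eps a <= monomial_value eps' a.
Proof.
move=> e0 ee'; apply: ler_prod => i _.
rewrite exprn_ge0 ?(ltW (e0 i))//=; apply: lerXn2r; rewrite ?nnegrE ?ee'//.
  exact: ltW.
exact: le_trans (ltW (e0 i)) (ee' i).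
Qed.

Definition box_sum eps f N : R :=
  \sum_(a : box I N) v (f (bx a)) * monomial_value eps (bx a).

Definition box_bounded eps f := exists M, forall N, box_sum eps f N <= M.

Lemma convergentP f : convergent f <->
  exists eps, (forall i, 0 < eps i) /\ box_bounded eps f.
Proof.
have t0 eps a : (forall i, 0 < eps i) -> 0 <= v (f a) * monomial_value eps a.
  by move=> e0; rewrite mulr_ge0 ?absv_ge0 ?monv_ge0.
split=> -[eps [e0 H]]; exists eps; split=> //.
  set S := esum _ _ in H.
  have S0 : (0 <= S)%E by apply: esum_ge0 => a _; rewrite lee_fin t0.
  exists (fine S) => N; rewrite -lee_fin fineK ?ge0_fin_numE//.
  apply: esum_ge; pose r := map (@bx I N) (enum {: box I N}); exists [set` r]; first by split=> //; exact: finite_seq.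
  rewrite -fsbig_seq; last by rewrite /r map_inj_uniq ?enum_uniq//; apply: bx_inj.
  by rewrite /r big_map big_enum/= /box_sum -sumEFin.
case: H => M H; apply: le_lt_trans (ltry M); apply: ge_ereal_sup => _ /= [X [finX _] <-].
rewrite fsbig_finite//=.
pose N := \max_(a <- fset_set X) mdeg a.
apply: (@le_trans _ _ (box_sum eps f N)%:E); last by rewrite lee_fin.
rewrite sumEFin lee_fin /box_sum.
have -> : \sum_(i <- fset_set X) v (f i) * monomial_value eps i =
  \sum_(a : box I N | bx a \in fset_set X) v (f (bx a)) * monomial_value eps (bx a).
  rewrite -[RHS]big_filter.
  rewrite -[RHS](big_map (@bx I N) xpredT
     (fun i => v (f i) * monomial_value eps i)).
  apply: perm_big; apply: uniq_perm.
  - exact: fset_uniq.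
  - by rewrite map_inj_uniq ?filter_uniq ?index_enum_uniq//; apply: bx_inj.
  move=> a; apply/idP/mapP => [aX|[b]]; last first.
    by rewrite mem_filter => /andP[bX _] ->.
  have aN i : (a i <= N)%N.
    rewrite (leq_trans (mdeg_le _ _))// /N (big_rem a)//= leq_max leqnn//.
  exists (tobox N a); last by rewrite bxK.
  by rewrite mem_filter bxK// aX mem_index_enum.
rewrite [leRHS](bigID (fun a : box I N => bx a \in fset_set X))/= lerDl.
by apply: sumr_ge0 => a _; exact: t0.
Qed.

Lemma box_bounded_le eps eps' f : (forall i, 0 < eps i) ->
  (forall i, eps i <= eps' i) -> box_bounded eps' f -> box_bounded eps f.
Proof.
move=> e0 ee' [M H]; exists M => N; apply: le_trans (H N).
by apply: ler_sum => a _; rewrite ler_wpM2l ?absv_ge0// monv_le.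
Qed.

Lemma convergent2 f g : convergent f -> convergent g -> exists eps,
  [/\ forall i, 0 < eps i, box_bounded eps f & box_bounded eps g].
Proof.
move=> /convergentP[e [e0 fe]] /convergentP[e' [e'0 ge']].
exists (fun i => Num.min (e i) (e' i)).
have m0 i : 0 < Num.min (e i) (e' i) by rewrite lt_min e0 e'0.
split=> //.
- by apply: box_bounded_le fe => // i; rewrite ge_min lexx.
- by apply: box_bounded_le ge' => // i; rewrite ge_min lexx orbT.
Qed.

Lemma convergent_fin f N :
  (forall a : expo I, ~ (forall i, (a i <= N)%N) -> f a = 0) -> convergent f.
Proof.
move=> fN; apply/convergentP; exists (fun=> 1); split=> //.
have E a : monomial_value (fun=> 1) a = 1.
  by rewrite /monomial_value big1// => i _; rewrite expr1n.
exists (\sum_(a : box I N) v (f (bx a))) => M; rewrite /box_sum.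
under eq_bigr do rewrite E mulr1.
rewrite (bigID (fun a : box I M => [forall i, a i <= N]%N))/=.
rewrite [X in _ + X]big1 ?addr0; last first.
  move=> a /negP aN; rewrite fN ?absv0// => H; apply: aN.
  by apply/forallP => i; have := H i; rewrite ffunE.
pose h (a : box I M) := tobox N (bx a).
have hK (a : box I M) : [forall i, a i <= N]%N -> bx (h a) = bx a.
  by move=> /forallP aN; rewrite bxK// => i; rewrite ffunE.
rewrite (eq_bigr (fun a : box I M => v (f (bx (h a))))); last first.
  by move=> a aN; rewrite hK.
rewrite -big_filter -(big_map h xpredT (fun b => v (f (bx b)))).
rewrite big_uniq/=; last first.
  rewrite map_inj_in_uniq ?filter_uniq ?index_enum_uniq// => a b.
  rewrite !mem_filter => /andP[aN _] /andP[bN _] ab.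
  by apply: bx_inj; rewrite -hK// -[RHS]hK// ab.
rewrite [leRHS](bigID (fun b : box I N => b \in map h [seq a : box I M <- index_enum (box I M) |
  [forall i, a i <= N]%N]))/=.
by rewrite lerDl; apply: sumr_ge0 => a _; exact: absv_ge0.
Qed.

Lemma convergent1 : convergent 1.
Proof.
apply: (@convergent_fin _ 0) => a aN; rewrite /GRing.one/= /fps_one.
case: eqP => // a0; case: aN => i; by rewrite a0 ffunE.
Qed.

Lemma convergent_var i : convergent (fps_var K i).
Proof.
apply: (@convergent_fin _ 1) => a aN; rewrite /fps_var.
case: eqP => // a0; case: aN => j; rewrite a0 ffunE; by case: eqP.
Qed.

Lemma convergentD f g : convergent f -> convergent g -> convergent (f + g).
Proof.
move=> cf cg; have [eps [e0 [M fM] [M' gM']]] := convergent2 cf cg.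
apply/convergentP; exists eps; split=> //; exists (M + M') => N.
apply: le_trans (lerD (fM N) (gM' N)); rewrite -big_split/=.
apply: ler_sum => a _; rewrite -mulrDl ler_wpM2r ?monv_ge0//.
exact: absvD_le.
Qed.

Lemma convergentZ (k : K) f : convergent f -> convergent (k *: f).
Proof.
move=> /convergentP[eps [e0 [M fM]]]; apply/convergentP; exists eps.
split=> //; exists (v k * M) => N.
apply: le_trans (ler_wpM2l (absv_ge0 v k) (fM N)).
rewrite mulr_sumr; apply: ler_sum => a _.
by rewrite [in leLHS]/GRing.scale/= [in leLHS]/GRing.scale/= absvM mulrA.
Qed.

Lemma convergentM f g : convergent f -> convergent g -> convergent (f * g).
Proof.
move=> cf cg; have [eps [e0 [M fM] [M' gM']]] := convergent2 cf cg.
have s0 h N : 0 <= box_sum eps h N.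
  by apply: sumr_ge0 => a _; rewrite mulr_ge0 ?absv_ge0 ?monv_ge0.
apply/convergentP; exists eps; split=> //; exists (M * M') => N.
apply: le_trans (ler_pM (s0 f N) (s0 g N) (fM N) (gM' N)).
pose T (a b : box I N) := v (f (bx a)) * monomial_value eps (bx a) *
  (v (g (bx b)) * monomial_value eps (bx b)).
have T0 a b : 0 <= T a b by rewrite !mulr_ge0 ?absv_ge0 ?monv_ge0.
have -> : box_sum eps f N * box_sum eps g N = \sum_a \sum_b T a b.
  by rewrite mulr_suml; apply: eq_bigr => a _; rewrite mulr_sumr.
apply: (@le_trans _ _ (\sum_(c : box I N) \sum_(a : box I N)
    \sum_(b : box I N | bx a + bx b == bx c) T a b)).
  apply: ler_sum => c _; rewrite [f * g]/GRing.mul/=.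
  rewrite (fps_mulE f g (@bx_le _ _ c)).
  rewrite -[leRHS]/(\sum_(a : box I N) _).
  apply: (@le_trans _ _ ((\sum_(a : box I N)
     \sum_(b : box I N | bx a + bx b == bx c) v (f (bx a) * g (bx b))) *
      monomial_value eps (bx c))).
    rewrite ler_wpM2r ?monv_ge0//; apply: le_trans (absv_sum _ _ _) _.
    by apply: ler_sum => a _; exact: absv_sum.
  rewrite mulr_suml; apply: ler_sum => a _; rewrite mulr_suml.
  apply: ler_sum => b /eqP <-; rewrite monvD absvM /T.
  by rewrite mulrACA.
rewrite exchange_big/=; apply: ler_sum => a _.
rewrite (exchange_big_dep xpredT)//=; apply: ler_sum => b _.
have [H|H] := boolP [forall i, bx a i + bx b i <= N]%N.
  under eq_bigl do rewrite eq_sym.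
  rewrite big_box1// => i; rewrite expo_addE; exact: (forallP H).
rewrite big_pred0// => c; apply/negP => /eqP abc; case/negP: H.
by apply/forallP => i; rewrite -expo_addE abc bx_le.
Qed.

(* The convergent power series K{x_i : i in I}. *)
Record cps := Cps { cps_val : fps K I; cps_convergent : `[< convergent cps_val >] }.

HB.instance Definition _ := [isSub for cps_val].
HB.instance Definition _ := [Choice of cps by <:].

Lemma cps_closed : GRing.subsemialg_closed [pred f : fps K I | `[< convergent f >]].
Proof.
apply: GRing.subalg_closed_semi; split.
- exact/asboolP/convergent1.
- move=> k f g /asboolP cf /asboolP cg; apply/asboolP.
  exact: convergentD (convergentZ k cf) cg.
- move=> f g /asboolP cf /asboolP cg; apply/asboolP; exact: convergentM.
Qed.

HB.instance Definition _ := GRing.SubChoice_isSubAlgebra.Build K (fps K I)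
  (fun f => `[< convergent f >]) cps cps_closed.
HB.instance Definition _ :=
  GRing.SubPzRing_isSubComPzRing.Build (fps K I) (fun f => `[< convergent f >]) cps.

Definition cps_var (i : I) : cps := Cps (introT (asboolP _) (convergent_var i)).

End Theory.

Section Embedding.
Variables (I : finType) (P : pred I).

(* K{x_i : P i} as a subring of K{x_i : i in I}: a series in the variables
   satisfying P is a series in all variables in which the other ones do not
   occur. *)
Definition fps_emb (f : fps K {i | P i}) : fps K I := fun c =>
  if [forall i, (c i != 0%N) ==> P i] then f [ffun j => c (val j)] else 0.

Lemma convergent_emb f : convergent f -> convergent (fps_emb f).
Proof.
move=> /convergentP[eps [e0 [M fM]]]; apply/convergentP.
pose ext i := if insub i is Some j then eps j else 1.
have ext0 i : 0 < ext i by rewrite /ext; case: insubP.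
exists ext; split=> //; exists M => N; apply: le_trans (fM N); rewrite /box_sum.
pose Q (a : box I N) := [forall i, (bx a i != 0%N) ==> P i].
pose h (a : box I N) : box {i | P i} N := [ffun j => a (val j)].
rewrite (bigID Q)/= [X in _ + X]big1 ?addr0; last first.
  by move=> a /negbTE Qa; rewrite /fps_emb -/(Q a) Qa absv0 mul0r.
have hE (a : box I N) : bx (h a) = [ffun j => bx a (val j)].
  by apply/ffunP => j; rewrite !ffunE.
have QE a : Q a -> v (fps_emb f (bx a)) * monomial_value ext (bx a) =
    v (f (bx (h a))) * monomial_value eps (bx (h a)).
  move=> Qa; rewrite /fps_emb -/(Q a) Qa hE; congr (_ * _).
  rewrite /monomial_value (bigID P)/= [X in _ * X]big1 ?mulr1; last first.
    move=> i Pi; have := forallP Qa i; case: eqP => [->|] /=; first by [].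
    by rewrite (negbTE Pi).
  rewrite (reindex_omap (op := *%R) (val : {i | P i} -> I) insub)/=; last first.
    by move=> i Pi; rewrite insubT.
  apply: eq_big => [j|j _]; first by rewrite (valP j) valK eqxx.
  by rewrite [in RHS]ffunE /ext (valK j : insub (sval j) = Some j).
rewrite (eq_bigr _ QE) -big_filter.
rewrite -(big_map h xpredT (fun b => v (f (bx b)) * monomial_value eps (bx b))).
rewrite big_uniq/=; last first.
  rewrite map_inj_in_uniq ?filter_uniq ?index_enum_uniq// => a b.
  rewrite !mem_filter => /andP[Qa _] /andP[Qb _] /ffunP ab.
  apply/ffunP => i; have [Pi|Pi] := boolP (P i).
    by have := ab (Sub i Pi); rewrite !ffunE.
  have z (d : box I N) : Q d -> d i = ord0.
    move=> /forallP/(_ i); rewrite ffunE (negbTE Pi) implybF negbK => /eqP d0.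
    exact/val_inj.
  by rewrite !z.
rewrite [leRHS](bigID (fun b : box _ N => b \in map h
  [seq a : box I N <- index_enum (box I N) | Q a]))/=.
rewrite lerDl; apply: sumr_ge0 => a _.
by rewrite mulr_ge0 ?absv_ge0 ?monv_ge0.
Qed.

Definition cps_emb (f : cps {i | P i}) : cps I :=
  Cps (introT (asboolP _) (convergent_emb (elimT (asboolP _) (cps_convergent f)))).

End Embedding.

Definition right_equivalent (I : finType) (f g : cps I) : Prop :=
  exists phi : {lrmorphism cps I -> cps I}, bijective phi /\ f = phi g.

Definition hessian n (f : cps 'I_n) : 'M[K]_n :=
  \matrix_(i, j) pderiv i (pderiv j (cps_val f)) 0.

End Convergent.

Arguments cps_var {R K} v {I} i.
Arguments right_equivalent {R K v I} f g.
Arguments hessian {R K v n} f.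
Arguments cps_emb {R K v I P} f.

Section Ideals.
Variable A : comNzRingType.

Definition ideal_gen (S : set A) : set A := [set a |
  exists (k : nat) (c s : 'I_k -> A),
    (forall i, S (s i)) /\ a = \sum_(i < k) c i * s i].

Definition ideal_mul (J J' : set A) : set A :=
  ideal_gen [set a * b | a in J & b in J'].

Fixpoint ideal_exp (J : set A) (k : nat) : set A :=
  if k is k'.+1 then ideal_mul J (ideal_exp J k') else setT.

End Ideals.

Section NormalForms.
Variables (R : realType) (K : fieldType) (v : real_valuation R K).

(* The ideal generated by all the variables. *)
Definition maxideal (I : finType) : set (cps v I) :=
  ideal_gen (range (cps_var v)).

Variable n : nat.

(* The variables x_1, ..., x_n are indexed from 0 by 'I_n: the first k of them
   are the i with i < k, and the others are indexed by {i : 'I_n | k <= i}. *)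
Definition diag_form (k : nat) (a : 'I_n -> K) : cps v 'I_n :=
  \sum_(i < n | (i < k)%N) a i *: cps_var v i ^+ 2.

(* An odd index between 1 and 2l-1 becomes an even i < 2l; when 2l <= n, its
   cyclic successor [ordS i] is i + 1. *)
Definition char2_form (l : nat) (a : 'I_n -> K) : cps v 'I_n :=
  \sum_(i < n | ~~ odd i && (i < l.*2)%N)
    (a i *: cps_var v i ^+ 2 + cps_var v i * cps_var v (ordS i)
     + a (ordS i) *: cps_var v (ordS i) ^+ 2).

Definition char2_residual (k : nat) (d : {i : 'I_n | (k <= i)%N} -> K)
    (h : cps v {i : 'I_n | (k <= i)%N}) : cps v {i : 'I_n | (k <= i)%N} :=
  \sum_i d i *: cps_var v i ^+ 2 + h.

End NormalForms.

Arguments maxideal {R K} v I.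
Arguments diag_form {R K} v {n} k a.
Arguments char2_form {R K} v {n} l a.
Arguments char2_residual {R K} v {n k} d h.

(* Main.v *)
(** A quadratic form is handled through a matrix T with polar form B = T + T^T,
    uniformly in the characteristic.

    Existence: after a linear change of variables the Hessian matrix is in
    normal form, with an invertible block B in the variables x_1, ..., x_k. The
    inverse function theorem yields psi with df/dx_i (psi(y), y) = 0, and the
    translation by psi gives f = g(y) + sum_ij x_i x_j H_ij(x, y). With
    T = H(0), solving C + C^T R C = H - T for a matrix C of power series, where
    R = D^T T D and B D = 1, makes the substitution x -> x + D C x transform
    the quadratic form T into H.

    Uniqueness: this is Witt cancellation. If phi transforms q + g0 into
    q + g1, the linear part J of phi in x is an isometry of the polar form of q.
    Put u = phi_x - x and w = B x + T u, so that q(phi_x) - q(x) = sum_i u_i w_i.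
    If S indexes a row basis of J - 1, the equations u_i = 0 (i in S) and
    w_i = 0 (i not in S) have a unique solution x = z(y), again by the inverse
    function theorem, and y -> phi_y(z(y), y) transforms g0 into g1.

    The inverse function theorem holds over a field that is not complete: the
    iterates of c = x + h(c), with h of order at least 2, stabilize coefficient
    by coefficient and remain bounded for a weighted l^1 norm. *)

Require Import Defs.
From HB Require Import structures.
From mathcomp Require Import all_boot all_order all_algebra.
From mathcomp Require Import all_fingroup zify.
From mathcomp Require Import boolp classical_sets reals.

Set Implicit Arguments.
Unset Strict Implicit.
Unset Printing Implicit Defensive.

Import Order.TTheory GRing.Theory Num.Theory.

Local Open Scope ring_scope.

(** * Formal power series *)

(** Two obstacles shape the proof. In characteristic 2 the Hessian matrix forgets the squares x_i^2,
    so a quadratic form is carried by a matrix T that need not be symmetric, and the splitting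
    itself never divides by 2. Correspondingly a residual part is only required to have order at
    least 2 and zero Hessian, which in characteristic 2 leaves room for the terms d_i x_i^2.

    For uniqueness, merely putting x = 0 in phi leaves the term q(phi_x(0, y)); one needs a graph x
    = z(y) along which q(phi_x) and q(x) agree. Neither u = 0 nor w = 0 defines such a graph in
    general: u has no linear part in x when J = 1, and w has none when J = -1 and T is symmetric.
    This is why the two systems are mixed through S.

    The index sets of variables are arbitrary finite types because auxiliary problems are solved
    universally: the entries of an unknown matrix, for instance, become the variables of another
    ring, the inverse function theorem is applied there, and the actual data are then
    substituted. *)

Section Degree.
Variable I : finType.
Implicit Types (a b c : expo I) (i : I).

Definition deg a : nat := \sum_i a i.

Lemma degD a b : deg (a + b) = (deg a + deg b)%N.
Proof. by rewrite -big_split; apply: eq_bigr => i _; rewrite expo_addE. Qed.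

Lemma deg0 : deg 0 = 0%N.
Proof. by rewrite /deg big1// => i _; rewrite ffunE. Qed.

Lemma deg_expo1 i : deg (expo1 i) = 1%N.
Proof.
rewrite /deg (bigD1 i)//= big1 ?ffunE ?eqxx// => j /negbTE ji.
by rewrite ffunE ji.
Qed.

Lemma deg_ge a i : (a i <= deg a)%N.
Proof. by rewrite /deg (bigD1 i)//= leq_addr. Qed.

Lemma expo_gt0P a i : a i != 0%N -> exists b, a = b + expo1 i.
Proof.
move=> ai; exists [ffun j => (a j - (j == i))%N]; apply/ffunP => j.
rewrite expo_addE !ffunE; case: eqP => [->|_]; last by rewrite subn0 addn0.
by rewrite subnK// lt0n.
Qed.

Lemma expo_addIr a b c : a + c = b + c -> a = b.
Proof.
move=> /ffunP abc; apply/ffunP => i; have := abc i.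
by rewrite !expo_addE => /addIn.
Qed.

Lemma expo_add_expo1 a i : (a + expo1 i) i = (a i).+1.
Proof. by rewrite expo_addE ffunE eqxx addn1. Qed.

Lemma expo_add_expo1N a i j : j != i -> (a + expo1 i) j = a j.
Proof. by rewrite expo_addE ffunE => /negbTE ->; rewrite addn0. Qed.

Lemma deg_gt0P a : (0 < deg a)%N -> exists b i, a = b + expo1 i.
Proof.
move=> da; have [/existsP[i /expo_gt0P[b ->]]|] := boolP [exists i, a i != 0%N].
  by exists b, i.
rewrite negb_exists => /forallP a0; move: da; rewrite /deg big1// => i _.
by have := a0 i; rewrite negbK => /eqP.
Qed.

Lemma deg_eq0 a : deg a = 0%N -> a = 0.
Proof.
move=> da; apply/ffunP => i; rewrite ffunE; apply/eqP.
by rewrite -leqn0 -da deg_ge.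
Qed.

(** Boxes contain more exponents than needed; once all terms of degree above d vanish, the size of
    the box is immaterial. *)
Lemma big_box_le (V : nmodType) (F : expo I -> V) d N : (d <= N)%N ->
  (forall a, (d < deg a)%N -> F a = 0) ->
  \sum_(a : box I N) F (bx a) = \sum_(a : box I d) F (bx a).
Proof.
move=> dN F0; rewrite (bigID (fun a : box I N => [forall i, bx a i <= d]%N))/=.
rewrite [X in _ + X]big1 ?addr0; last first.
  move=> a; rewrite negb_forall => /existsP[i]; rewrite -ltnNge => di.
  by apply: F0; apply: leq_trans di (deg_ge _ _).
rewrite (reindex_onto (fun b : box I d => tobox N (bx b)) (fun a : box I N => tobox d (bx a)))/=.
  have bE (b : box I d) : bx (tobox N (bx b)) = bx b.
    by rewrite bxK// => i; rewrite (leq_trans (bx_le _ _)).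
  apply: eq_big => [b|b _]; last by rewrite bE.
  rewrite bE; have -> : [forall i, bx b i <= d]%N by apply/forallP => i; apply: bx_le.
  by rewrite -(inj_eq (@bx_inj _ _)) bxK ?eqxx// => i; apply: bx_le.
move=> a /forallP ad; apply: bx_inj; rewrite !bxK// => i; rewrite ?bxK//.
exact: bx_le.
Qed.

End Degree.

Section Order.
Variables (K : fieldType) (I : finType).
Implicit Types (f g h : fps K I) (c : expo I).

Lemma fpsDE f g c : (f + g) c = f c + g c. Proof. by []. Qed.
Lemma fpsNE f c : (- f) c = - f c. Proof. by []. Qed.
Lemma fpsBE f g c : (f - g) c = f c - g c. Proof. by []. Qed.
Lemma fpsZE k f c : (k *: f) c = k * f c. Proof. by []. Qed.
Lemma fps0E c : (0 : fps K I) c = 0. Proof. by []. Qed.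
Lemma fps1E c : (1 : fps K I) c = (c == 0)%:R. Proof. by []. Qed.

Lemma fps_sumE (T : Type) (r : seq T) (P : pred T) (F : T -> fps K I) c :
  (\sum_(t <- r | P t) F t) c = \sum_(t <- r | P t) F t c.
Proof. by elim/big_rec2: _ => // t x y _ <-. Qed.

Lemma fpsME N f g c : (deg c <= N)%N ->
  (f * g) c = \sum_(a : box I N) \sum_(b : box I N | bx a + bx b == c)
                f (bx a) * g (bx b).
Proof.
by move=> cN; apply: fps_mulE => i; apply: leq_trans (deg_ge _ _) cN.
Qed.

Definition ord_ge d f := forall c, (deg c < d)%N -> f c = 0.

Lemma ord_geD d f g : ord_ge d f -> ord_ge d g -> ord_ge d (f + g).
Proof. by move=> f0 g0 c cd; rewrite fpsDE f0// g0// addr0. Qed.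

Lemma ord_geN d f : ord_ge d f -> ord_ge d (- f).
Proof. by move=> f0 c cd; rewrite fpsNE f0// oppr0. Qed.

Lemma ord_geB d f g : ord_ge d f -> ord_ge d g -> ord_ge d (f - g).
Proof. by move=> f0 g0; apply: ord_geD => //; apply: ord_geN. Qed.

Lemma ord_geZ d k f : ord_ge d f -> ord_ge d (k *: f).
Proof. by move=> f0 c cd; rewrite fpsZE f0// mulr0. Qed.

Lemma ord_geW d e f : (e <= d)%N -> ord_ge d f -> ord_ge e f.
Proof. by move=> ed f0 c ce; apply: f0; apply: leq_trans ce ed. Qed.

Lemma ord_ge_all f : (forall d, ord_ge d f) -> f = 0.
Proof. by move=> f0; apply/funext => c; apply: (f0 (deg c).+1). Qed.

Lemma ord_geM d e f g : ord_ge d f -> ord_ge e g -> ord_ge (d + e) (f * g).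
Proof.
move=> f0 g0 c cde; rewrite (fpsME _ _ (leqnn _)) big1// => a _.
rewrite big1// => b /eqP abc; have := degD (bx a) (bx b); rewrite abc => cE.
have [ad|ad] := ltnP (deg (bx a)) d; first by rewrite f0// mul0r.
rewrite g0 ?mulr0//; rewrite -(ltn_add2l (deg (bx a))) -cE.
by apply: leq_trans cde _; rewrite leq_add2r.
Qed.

Lemma ord_geMl d f g : ord_ge d f -> ord_ge d (f * g).
Proof. by move=> f0; rewrite -[d]addn0; apply: ord_geM. Qed.

Lemma ord_geMr d f g : ord_ge d g -> ord_ge d (f * g).
Proof. by rewrite mulrC; apply: ord_geMl. Qed.

Lemma ord_geX f d : ord_ge 1 f -> ord_ge d (f ^+ d).
Proof.
move=> f0; elim: d => [//|d IH]; rewrite exprS -add1n; exact: ord_geM.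
Qed.

Lemma ord_ge_prod (T : Type) (r : seq T) (F : T -> fps K I) (e : T -> nat) :
  (forall t, ord_ge (e t) (F t)) ->
  ord_ge (\sum_(t <- r) e t) (\prod_(t <- r) F t).
Proof.
by move=> H; elim/big_rec2: _ => // t x y _; apply: ord_geM.
Qed.

(** [ord_ge d (f - g)] serves as congruence modulo the d-th power of the maximal ideal; the [eqm]
    lemmas are its calculus. *)
Lemma eqm_mul d f f' g g' : ord_ge d (f - f') -> ord_ge d (g - g') ->
  ord_ge d (f * g - f' * g').
Proof.
move=> ff gg; have -> : f * g - f' * g' = (f - f') * g + f' * (g - g').
  by rewrite mulrBl mulrBr addrA subrK.
by apply: ord_geD; [apply: ord_geMl|apply: ord_geMr].
Qed.

Lemma eqm_exp d f f' n : ord_ge d (f - f') -> ord_ge d (f ^+ n - f' ^+ n).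
Proof.
move=> ff; elim: n => [|n IH]; first by rewrite subrr.
by rewrite !exprS; apply: eqm_mul.
Qed.

Lemma eqm_prod d (T : Type) (r : seq T) (F G : T -> fps K I) :
  (forall t, ord_ge d (F t - G t)) ->
  ord_ge d (\prod_(t <- r) F t - \prod_(t <- r) G t).
Proof.
move=> H; elim/big_rec2: _ => [|t x y _ xy]; first by rewrite subrr.
exact: eqm_mul.
Qed.

Lemma eqm_trans d g f h : ord_ge d (f - g) -> ord_ge d (g - h) -> ord_ge d (f - h).
Proof. by move=> fg gh; rewrite -(subrK g f) -addrA; apply: ord_geD. Qed.

Lemma eqm_sym d f g : ord_ge d (f - g) -> ord_ge d (g - f).
Proof. by move=> fg; rewrite -opprB; apply: ord_geN. Qed.

Lemma eqmE d f g c : ord_ge d (f - g) -> (deg c < d)%N -> f c = g c.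
Proof. by move=> fg cd; have /eqP := fg _ cd; rewrite fpsBE subr_eq0 => /eqP. Qed.

Lemma fps_varE i c : (fps_var K i) c = (c == expo1 i)%:R.
Proof. by []. Qed.

Lemma ord_ge_var i : ord_ge 1 (fps_var K i).
Proof.
move=> c c0; rewrite fps_varE; case: eqP => // ci.
by rewrite ci deg_expo1 in c0.
Qed.

Lemma fps_varM i f c : (fps_var K i * f) (c + expo1 i) = f c.
Proof.
rewrite (fpsME _ _ (leqnn _)); set N := deg _.
have eN j : (expo1 i j <= N)%N.
  by rewrite (leq_trans (deg_ge _ _))// /N degD leq_addl.
have cN j : (c j <= N)%N by rewrite (leq_trans (deg_ge _ _))// /N degD leq_addr.
rewrite (bigD1 (tobox N (expo1 i)))//= [X in _ + X]big1 ?addr0; last first.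
  move=> a /eqP ai; rewrite big1// => b _; rewrite fps_varE.
  case: eqP => [E|]; last by rewrite mul0r.
  by case: ai; apply: bx_inj; rewrite bxK.
rewrite (bxK eN); under eq_bigl => b.
  have -> : (expo1 i + bx b == c + expo1 i) = (bx b == c).
    by apply/eqP/eqP => [|->]; rewrite addrC// => /expo_addIr.
  over.
by rewrite big_box1// fps_varE eqxx mul1r bxK.
Qed.

Lemma fps_varM0 i f c : c i = 0%N -> (fps_var K i * f) c = 0.
Proof.
move=> c0; rewrite (fpsME _ _ (leqnn _)) big1// => a _.
rewrite big1// => b /eqP abc; rewrite fps_varE.
case: eqP => [E|]; last by rewrite mul0r.
by move/ffunP/(_ i): abc; rewrite E addrC expo_add_expo1 c0.
Qed.

Lemma fps_varI i f : fps_var K i * f = 0 -> f = 0.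
Proof. by move=> f0; apply/funext => c; rewrite -(fps_varM i) f0. Qed.

Lemma fps_const_ord f : ord_ge 1 (f - (f 0)%:A).
Proof.
move=> c; rewrite ltnS leqn0 => /eqP /deg_eq0 ->.
by rewrite fpsBE fpsZE fps1E eqxx mulr1 subrr.
Qed.

Lemma ord_ge1 f : f 0 = 0 -> ord_ge 1 f.
Proof. by move=> f0 c; rewrite ltnS leqn0 => /eqP /deg_eq0 ->. Qed.

Lemma fpsM0 f g : (f * g) 0 = f 0 * g 0.
Proof.
have : ((f - (f 0)%:A) * g) 0 = 0.
  by apply: (ord_geMl g (fps_const_ord f)); rewrite deg0.
rewrite mulrBl fpsBE -scalerAl mul1r fpsZE => /eqP.
by rewrite subr_eq0 => /eqP.
Qed.

End Order.

(** * Substitution of series of positive order *)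

Section Composition.
Variables (K : fieldType) (I J : finType) (phi : J -> fps K I).
Implicit Types (f g : fps K J) (a b : expo J).

Definition mon a : fps K I := \prod_j phi j ^+ a j.

Lemma monD a b : mon (a + b) = mon a * mon b.
Proof.
by rewrite -big_split; apply: eq_bigr => j _; rewrite expo_addE exprD.
Qed.

Lemma mon0 : mon 0 = 1.
Proof. by rewrite /mon big1// => j _; rewrite ffunE expr0. Qed.

Lemma mon_expo1 j : mon (expo1 j) = phi j.
Proof.
rewrite /mon (bigD1 j)//= big1 ?mulr1 ?ffunE ?eqxx ?expr1// => i /negbTE ij.
by rewrite ffunE ij expr0.
Qed.

(** A monomial in series of order at least 1 has order at least its degree, so only exponents of
    degree at most [deg c] reach the coefficient at c, and the box of that size contains them. *)
Definition fps_comp f : fps K I := fun c =>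
  \sum_(a : box J (deg c)) f (bx a) * mon (bx a) c.

Hypothesis phi_ord : forall j, ord_ge 1 (phi j).

Lemma ord_ge_mon a : ord_ge (deg a) (mon a).
Proof. by apply: ord_ge_prod => j; apply: ord_geX. Qed.

Lemma compE N f c : (deg c <= N)%N ->
  fps_comp f c = \sum_(a : box J N) f (bx a) * mon (bx a) c.
Proof.
move=> cN; rewrite (@big_box_le _ _ (fun a => f a * mon a c) _ _ cN)// => a ca.
by rewrite ord_ge_mon ?mulr0.
Qed.

Lemma comp_is_zmod : zmod_morphism fps_comp.
Proof.
move=> f g; apply/funext => c; rewrite fpsBE /fps_comp -sumrB.
by apply: eq_bigr => a _; rewrite -mulrBl.
Qed.

Lemma comp_scalable k f : fps_comp (k *: f) = k *: fps_comp f.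
Proof.
apply/funext => c; rewrite fpsZE /fps_comp mulr_sumr.
by apply: eq_bigr => a _; rewrite fpsZE mulrA.
Qed.

Lemma comp1 : fps_comp 1 = 1.
Proof.
apply/funext => c; rewrite /fps_comp (bigD1 (tobox _ 0))//=.
rewrite bxK; last by move=> i; rewrite ffunE.
rewrite fps1E eqxx mul1r mon0 big1 ?addr0// => a a0.
rewrite fps1E; case: eqP => [E|]; last by rewrite mul0r.
by case/eqP: a0; apply: bx_inj; rewrite E bxK// => i; rewrite ffunE.
Qed.

Lemma compM f g : fps_comp (f * g) = fps_comp f * fps_comp g.
Proof.
apply/funext => c; pose N := deg c.
(* [ev h] is a polynomial truncation of h evaluated at [phi]; it agrees with the composite up to
   degree N, which reduces the claim to a finite rearrangement. *)
pose ev f : fps K I := \sum_(a : box J N) f (bx a) *: mon (bx a).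
have evE h : ord_ge N.+1 (fps_comp h - ev h).
  move=> e eN; rewrite fpsBE (@compE N)// /ev fps_sumE.
  by apply/eqP; rewrite subr_eq0; apply/eqP/eq_bigr => a _.
rewrite (eqmE (eqm_mul (evE f) (evE g)) (ltnSn _)).
rewrite /ev mulr_suml fps_sumE /fps_comp -/N.
have -> : \sum_(e : box J N) (f * g) (bx e) * mon (bx e) c =
  \sum_(e : box J N) \sum_(a : box J N) \sum_(b : box J N | bx a + bx b == bx e)
     f (bx a) * g (bx b) * mon (bx a + bx b) c.
  apply: eq_bigr => e _; rewrite [f * g]/GRing.mul/=.
  rewrite (@fps_mulE _ _ N); last by move=> i; apply: bx_le.
  rewrite mulr_suml; apply: eq_bigr => a _; rewrite mulr_suml.
  by apply: eq_bigr => b /eqP ->.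
rewrite exchange_big/=; apply: eq_bigr => a _.
rewrite mulr_sumr fps_sumE (exchange_big_dep xpredT)//=; apply: eq_bigr => b _.
rewrite -scalerAl -scalerAr scalerA fpsZE -monD.
have [abN|abN] := boolP [forall i, bx a i + bx b i <= N]%N.
  by under eq_bigl do rewrite eq_sym; rewrite big_box1// => i; rewrite expo_addE (forallP abN).
rewrite big_pred0 => [|e]; last first.
  apply/negP => /eqP abe; case/negP: abN; apply/forallP => i.
  by rewrite -expo_addE abe bx_le.
rewrite ord_ge_mon ?mulr0//; move: abN; rewrite negb_forall => /existsP[i].
by rewrite -ltnNge -expo_addE => /leq_trans; apply; apply: deg_ge.
Qed.

Lemma comp_var j : fps_comp (fps_var K j) = phi j.
Proof.
apply/funext => c; rewrite (@compE (deg c).+1)//.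
have eN i : (expo1 j i <= (deg c).+1)%N by rewrite ffunE; case: eqP.
rewrite (bigD1 (tobox _ (expo1 j)))//= bxK// fps_varE eqxx mul1r mon_expo1.
rewrite big1 ?addr0// => a aj; rewrite fps_varE.
case: eqP => [E|]; last by rewrite mul0r.
by case/eqP: aj; apply: bx_inj; rewrite E bxK.
Qed.

End Composition.

(** * Weighted norms and convergence *)

Section Norm.
Variables (R : realType) (K : fieldType) (v : real_valuation R K).

Section OneRing.
Variable I : finType.
Implicit Types (f g h : fps K I) (r M : R).

(** A bound on the weighted l^1 norm, with one radius for all variables. It speaks of finite partial
    sums only, so it passes to limits attained coefficient by coefficient. *)
Definition norm_le r M f := forall s : seq (expo I), uniq s ->
  \sum_(a <- s) v (f a) * r ^+ deg a <= M.

Let t0 f r a : 0 <= r -> 0 <= v (f a) * r ^+ deg a.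
Proof. by move=> r0; rewrite mulr_ge0 ?absv_ge0 ?exprn_ge0. Qed.

Lemma monv_deg r (a : expo I) : monomial_value (fun=> r) a = r ^+ deg a.
Proof. by rewrite /monomial_value prodrXr. Qed.

Lemma sum_uniq_le (T : choiceType) (s s' : seq T) (F : T -> R) :
  uniq s -> uniq s' -> {subset s <= s'} -> (forall a, 0 <= F a) ->
  \sum_(a <- s) F a <= \sum_(a <- s') F a.
Proof.
move=> us us' ss F0; rewrite [leRHS](bigID (mem s))/=.
have -> : \sum_(a <- s) F a = \sum_(a <- s' | a \in s) F a.
  rewrite -[RHS]big_filter; apply: perm_big; apply: uniq_perm => //.
    exact: filter_uniq.
  by move=> a; rewrite mem_filter; case: (boolP (a \in s)) => //= /ss ->.
by rewrite lerDl sumr_ge0.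
Qed.

Lemma sum_box_le (s : seq (expo I)) N (F : expo I -> R) : uniq s ->
  (forall a, a \in s -> (deg a <= N)%N) -> (forall a, 0 <= F a) ->
  \sum_(a <- s) F a <= \sum_(a : box I N) F (bx a).
Proof.
move=> us sN F0; rewrite -big_enum/= -(big_map (@bx I N) xpredT F).
apply: sum_uniq_le => //; first by rewrite map_inj_uniq ?enum_uniq//; apply: bx_inj.
move=> a /sN aN; apply/mapP; exists (tobox N a); first by rewrite mem_enum.
by rewrite bxK// => i; apply: leq_trans (deg_ge _ _) aN.
Qed.

Lemma seq_deg_le (s : seq (expo I)) : exists N, forall a, a \in s -> (deg a <= N)%N.
Proof.
exists (\max_(a <- s) deg a) => a as_; exact: (leq_bigmax_seq _ as_).
Qed.

Lemma norm_le_box r M f : 0 <= r -> norm_le r M f <->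
  forall N, \sum_(a : box I N) v (f (bx a)) * r ^+ deg (bx a) <= M.
Proof.
move=> r0; split=> H => [N|s us].
  rewrite -big_enum/= -(big_map (@bx I N) xpredT (fun a => v (f a) * r ^+ deg a)).
  by apply: H; rewrite map_inj_uniq ?enum_uniq//; apply: bx_inj.
have [N sN] := seq_deg_le s; apply: le_trans (H N).
by apply: sum_box_le => // a; apply: t0.
Qed.

Lemma norm_leW r r' M M' f : 0 <= r' -> r' <= r -> M <= M' ->
  norm_le r M f -> norm_le r' M' f.
Proof.
move=> r0 rr MM H s us; apply: le_trans MM; apply: le_trans (H s us).
apply: ler_sum => a _; rewrite ler_wpM2l ?absv_ge0//.
by apply: lerXn2r; rewrite ?nnegrE//; apply: le_trans rr.
Qed.

Lemma norm_le_ge0 r M f : norm_le r M f -> 0 <= M.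
Proof. by move=> /(_ [::] isT); rewrite big_nil. Qed.

Lemma convergent_norm f : convergent v f <-> exists r M, 0 < r /\ norm_le r M f.
Proof.
split=> [/convergentP[eps [e0 [M fM]]]|[r [M [r0 H]]]]; last first.
  apply/convergentP; exists (fun=> r); split=> //; exists M => N.
  rewrite /box_sum; under eq_bigr do rewrite monv_deg.
  by move/(norm_le_box _ _ (ltW r0)): H; apply.
pose r := \big[Num.min/1]_i eps i.
have r0 : 0 < r by elim/big_ind: r => // x y x0 y0; rewrite lt_min x0.
have re i : r <= eps i by rewrite /r (bigD1 i)//= ge_min lexx.
exists r, M; split=> //; apply/(norm_le_box _ _ (ltW r0)) => N.
apply: le_trans (fM N); rewrite /box_sum; apply: ler_sum => a _.
by rewrite ler_wpM2l ?absv_ge0// -monv_deg; apply: monv_le.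
Qed.

Lemma norm_leD r M M' f g : 0 <= r ->
  norm_le r M f -> norm_le r M' g -> norm_le r (M + M') (f + g).
Proof.
move=> r0 fM gM s us; apply: le_trans (lerD (fM s us) (gM s us)).
rewrite -big_split/=; apply: ler_sum => a _.
by rewrite -mulrDl ler_wpM2r ?exprn_ge0// absvD_le.
Qed.

Lemma norm_le1 r : 0 <= r -> norm_le r 1 1.
Proof.
move=> r0 s us.
apply: (@le_trans _ _ (\sum_(a <- [:: 0 : expo I]) v ((1 : fps K I) a) * r ^+ deg a));
  last first.
  by rewrite big_seq1 fps1E eqxx deg0 expr0 mulr1 absv1.
rewrite (bigID (fun a : expo I => a == 0))/= [X in _ + X]big1 ?addr0; last first.
  by move=> a /negbTE a0; rewrite fps1E a0 absv0 mul0r.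
rewrite -big_filter; apply: sum_uniq_le => //; first exact: filter_uniq.
- by move=> a; rewrite mem_filter inE => /andP[].
- by move=> a; apply: t0.
Qed.

Lemma norm_le_var r i : 0 <= r -> norm_le r r (fps_var K i).
Proof.
move=> r0 s us.
apply: (@le_trans _ _ (\sum_(a <- [:: expo1 i]) v (fps_var K i a) * r ^+ deg a));
  last first.
  by rewrite big_seq1 fps_varE eqxx deg_expo1 expr1 absv1 mul1r.
rewrite (bigID (fun a : expo I => a == expo1 i))/= [X in _ + X]big1 ?addr0; last first.
  by move=> a /negbTE a0; rewrite fps_varE a0 absv0 mul0r.
rewrite -big_filter; apply: sum_uniq_le => //; first exact: filter_uniq.
- by move=> a; rewrite mem_filter inE => /andP[].
- by move=> a; apply: t0.
Qed.

Lemma norm_le0 r : norm_le r 0 0.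
Proof. by move=> s us; rewrite big1// => a _; rewrite fps0E absv0 mul0r. Qed.

Lemma norm_leM r M M' f g : 0 <= r ->
  norm_le r M f -> norm_le r M' g -> norm_le r (M * M') (f * g).
Proof.
move=> r0 fM gM s us; have [N sN] := seq_deg_le s.
pose T (a b : box I N) := v (f (bx a)) * r ^+ deg (bx a) *
  (v (g (bx b)) * r ^+ deg (bx b)).
have T0 a b : 0 <= T a b by rewrite mulr_ge0// t0.
apply: (@le_trans _ _ (\sum_(a : box I N) \sum_(b : box I N) T a b)); last first.
  move/(norm_le_box _ _ r0): (fM) => /(_ N) fN.
  move/(norm_le_box _ _ r0): (gM) => /(_ N) gN.
  apply: le_trans (ler_pM _ _ fN gN); try by apply: sumr_ge0 => a _; apply: t0.
  by rewrite mulr_suml; apply: ler_sum => a _; rewrite mulr_sumr.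
apply: (@le_trans _ _ (\sum_(c <- s) \sum_(a : box I N)
    \sum_(b : box I N | bx a + bx b == c) T a b)).
  rewrite big_seq [leRHS]big_seq; apply: ler_sum => c cs.
  rewrite (fpsME _ _ (sN _ cs)).
  apply: (@le_trans _ _ ((\sum_(a : box I N)
     \sum_(b : box I N | bx a + bx b == c) v (f (bx a) * g (bx b))) * r ^+ deg c)).
    rewrite ler_wpM2r ?exprn_ge0//; apply: le_trans (absv_sum _ _ _ _) _.
    by apply: ler_sum => a _; exact: absv_sum.
  rewrite mulr_suml; apply: ler_sum => a _; rewrite mulr_suml.
  apply: ler_sum => b /eqP <-; rewrite degD exprD absvM /T.
  by rewrite mulrACA.
rewrite exchange_big/=; apply: ler_sum => a _.
rewrite (exchange_big_dep xpredT)//=; apply: ler_sum => b _.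
rewrite -big_filter; apply: (@le_trans _ _ (\sum_(c <- [:: bx a + bx b]) T a b)).
  apply: sum_uniq_le => //; first exact: filter_uniq.
  by move=> c; rewrite mem_filter inE eq_sym => /andP[].
by rewrite big_seq1.
Qed.

Lemma norm_leX r M f n : 0 <= r -> norm_le r M f -> norm_le r (M ^+ n) (f ^+ n).
Proof.
move=> r0 fM; elim: n => [|n IH]; first exact: norm_le1.
by rewrite !exprS; apply: norm_leM.
Qed.

(** Every surviving monomial has degree at least d, so shrinking the radius by t gains t^d. For d =
    1 this makes norms arbitrarily small; for d = 2 the gain beats the shrinking of the radius
    itself, which drives [fixed_point]. *)
Lemma norm_le_scale r t M d f : 0 <= r -> 0 <= t <= 1 -> ord_ge d f ->
  norm_le r M f -> norm_le (t * r) (t ^+ d * M) f.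
Proof.
move=> r0 /andP[t0' t1] fd fM s us.
apply: (@le_trans _ _ (t ^+ d * \sum_(a <- s) v (f a) * r ^+ deg a)); last first.
  by apply: ler_wpM2l; [exact: exprn_ge0|exact: fM].
rewrite mulr_sumr; apply: ler_sum => a _.
have [ad|da] := ltnP (deg a) d; first by rewrite fd// absv0 !(mul0r, mulr0).
rewrite mulrCA ler_wpM2l ?absv_ge0// exprMn ler_wpM2r ?exprn_ge0//.
exact: ler_wiXn2l.
Qed.

End OneRing.

Lemma norm_le_mon (I J : finType) (phi : J -> fps K I) r M a : 0 <= r ->
  (forall j, norm_le r M (phi j)) -> norm_le r (M ^+ deg a) (mon phi a).
Proof.
move=> r0 pM; rewrite /mon /deg; elim/big_rec2: _ => [|j n f _ fM].
  exact: norm_le1.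
by rewrite exprD; apply: norm_leM => //; apply: norm_leX.
Qed.

(** By submultiplicativity a monomial of exponent a in the [phi j] has norm at most s^(deg a), so f
    at radius s dominates the composite term by term. *)
Lemma norm_le_comp (I J : finType) (phi : J -> fps K I) r s M f : 0 <= r -> 0 <= s ->
  (forall j, ord_ge 1 (phi j)) -> (forall j, norm_le r s (phi j)) ->
  norm_le s M f -> norm_le r M (fps_comp phi f).
Proof.
move=> r0 s0 p1 ps fM S uS; have [N SN] := seq_deg_le S.
move/(norm_le_box _ _ s0): fM => /(_ N); apply: le_trans.
apply: (@le_trans _ _ (\sum_(c <- S) \sum_(a : box J N)
   v (f (bx a)) * (v (mon phi (bx a) c) * r ^+ deg c))).
  rewrite big_seq [leRHS]big_seq; apply: ler_sum => c cS.
  rewrite (compE p1 _ (SN _ cS)).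
  apply: le_trans (ler_wpM2r _ (absv_sum _ _ _ _)) _; first by rewrite exprn_ge0.
  by rewrite mulr_suml; apply: ler_sum => a _; rewrite absvM mulrA.
rewrite exchange_big/=; apply: ler_sum => a _; rewrite -mulr_sumr.
rewrite ler_wpM2l ?absv_ge0//; exact: norm_le_mon.
Qed.

Lemma norm_le_small (I : finType) (f : fps K I) (d : R) : 0 < d ->
  ord_ge 1 f -> convergent v f -> exists2 r, 0 < r & norm_le r d f.
Proof.
move=> d0 f1 /convergent_norm[r [M [r0 fM]]].
have M0 := norm_le_ge0 fM; have M1 : 0 < M + d by rewrite ltr_wpDl.
(* The ratio t = d / (M + d) satisfies t <= 1 and t M <= d, also for M = 0. *)
exists (d / (M + d) * r); first by rewrite mulr_gt0 ?divr_gt0.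
have := @norm_le_scale I r (d / (M + d)) M 1 f (ltW r0) _ f1 fM.
rewrite expr1 => H; apply: norm_leW (H _); rewrite ?lexx//.
- by rewrite mulr_ge0 ?divr_ge0 ?ltW.
- by rewrite mulrAC ler_pdivrMr// ler_wpM2l ?lerDl ?ltW//.
- by apply/andP; split; [rewrite divr_ge0 ?ltW|rewrite ler_pdivrMr// mul1r lerDr].
Qed.

Lemma convergent_comp (I J : finType) (phi : J -> fps K I) f :
  (forall j, ord_ge 1 (phi j)) -> (forall j, convergent v (phi j)) ->
  convergent v f -> convergent v (fps_comp phi f).
Proof.
move=> p1 pc /convergent_norm[s [M [s0 fM]]].
have /choice[rr rrP] : forall j, exists r, 0 < r /\ norm_le r s (phi j).
  by move=> j; have [r r0 H] := norm_le_small s0 (p1 j) (pc j); exists r.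
pose r := \big[Num.min/1]_j rr j.
have r0 : 0 < r.
  by rewrite /r; elim/big_ind: _ => // [x y x0 y0|j _]; [rewrite lt_min x0|case: (rrP j)].
have re j : r <= rr j by rewrite /r (bigD1 j)//= ge_min lexx.
apply/convergent_norm; exists r, M; split=> //.
apply: (norm_le_comp (ltW r0) (ltW s0) p1 _ fM) => j.
by case: (rrP j) => _; apply: norm_leW (ltW r0) (re j) (lexx s).
Qed.

Lemma convergent_sub_shift (I : finType) (i : I) (f g : fps K I) :
  (forall c, v (g c) <= v (f (c + expo1 i))) -> convergent v f -> convergent v g.
Proof.
move=> gf /convergent_norm[r [M [r0 fM]]]; apply/convergent_norm.
exists r, (M / r); split=> // s us; rewrite ler_pdivlMr//.
have us' : uniq (map (fun c => c + expo1 i) s).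
  by rewrite map_inj_uniq// => a b; apply: expo_addIr.
apply: le_trans (fM _ us'); rewrite big_map mulr_suml; apply: ler_sum => a _.
by rewrite degD deg_expo1 addn1 exprSr mulrA ler_wpM2r ?(ltW r0)//
   ler_wpM2r ?gf ?exprn_ge0 ?(ltW r0).
Qed.

Lemma convergent_le (I : finType) (f g : fps K I) :
  (forall c, v (g c) <= v (f c)) -> convergent v f -> convergent v g.
Proof.
move=> gf /convergent_norm[r [M [r0 fM]]]; apply/convergent_norm.
exists r, M; split=> // s us; apply: le_trans (fM _ us); apply: ler_sum => a _.
by rewrite ler_wpM2r ?gf ?exprn_ge0 ?(ltW r0).
Qed.

Lemma absv_muln k n : v (k *+ n) <= v k *+ n.
Proof.
elim: n => [|n IH]; first by rewrite absv0.
by rewrite !mulrS; apply: le_trans (absvD_le _ _ _) _; rewrite lerD2l.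
Qed.

Lemma convergent_pderiv (I : finType) (i : I) (f : fps K I) :
  convergent v f -> convergent v (pderiv i f).
Proof.
move=> /convergent_norm[r [M [r0 fM]]]; apply/convergent_norm.
(* The integer factor produced by differentiation is at most 2^(deg a), which halving the radius
   absorbs. *)
exists (r / 2), (M / r); split=> [|s us]; first by rewrite divr_gt0.
have us' : uniq (map (fun c => c + expo1 i) s).
  by rewrite map_inj_uniq// => a b; apply: expo_addIr.
rewrite ler_pdivlMr//; apply: le_trans (fM _ us').
rewrite big_map mulr_suml; apply: ler_sum => a _.
rewrite degD deg_expo1 addn1 exprSr mulrA ler_wpM2r ?(ltW r0)//.
apply: (@le_trans _ _ (v (f (a + expo1 i)) *+ (a i).+1 * (r / 2) ^+ deg a)).
  by rewrite ler_wpM2r ?exprn_ge0 ?divr_ge0 ?(ltW r0)// absv_muln.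
rewrite -[v _ *+ _]mulr_natr -mulrA ler_wpM2l ?absv_ge0// expr_div_n mulrCA.
rewrite ler_piMr ?exprn_ge0 ?(ltW r0)// ler_pdivrMr ?exprn_gt0// mul1r -natrX ler_nat.
by apply: leq_trans (ltn_expl _ _); rewrite // ltnS deg_ge.
Qed.

End Norm.

(** * Convergent power series and substitution *)

Section Cps.
Variables (R : realType) (K : fieldType) (v : real_valuation R K).

Section OneRing.
Variable I : finType.
Implicit Types (f g h : cps v I) (c : expo I) (d : nat) (i : I).

Definition scoef f c : K := cps_val f c.
Definition cord d f := ord_ge d (cps_val f).
Arguments scoef : simpl never.

Lemma cpsP f g : (forall c, scoef f c = scoef g c) -> f = g.
Proof. by move=> fg; apply/val_inj/funext. Qed.

Lemma scoefD f g c : scoef (f + g) c = scoef f c + scoef g c. Proof. by []. Qed.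
Lemma scoefB f g c : scoef (f - g) c = scoef f c - scoef g c. Proof. by []. Qed.
Lemma scoefZ k f c : scoef (k *: f) c = k * scoef f c. Proof. by []. Qed.
Lemma scoef0 c : scoef 0 c = 0. Proof. by []. Qed.
Lemma scoef1 c : scoef 1 c = (c == 0)%:R. Proof. by []. Qed.
Lemma scoef_var i c : scoef (cps_var v i) c = (c == expo1 i)%:R. Proof. by []. Qed.
Lemma cps_valM f g : cps_val (f * g) = cps_val f * cps_val g.
Proof. by rewrite -[LHS]/(val (f * g)) rmorphM. Qed.
Lemma cps_valZ k f : cps_val (k *: f) = k *: cps_val f.
Proof. by apply/funext => c; apply: scoefZ. Qed.
Lemma scoefM0 f g : scoef (f * g) 0 = scoef f 0 * scoef g 0.
Proof. by rewrite /scoef cps_valM fpsM0. Qed.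
Lemma scoef_var0 i : scoef (cps_var v i) 0 = 0.
Proof. by rewrite /scoef /= ord_ge_var// deg0. Qed.

Lemma scoef_sum (T : Type) (r : seq T) (P : pred T) (F : T -> cps v I) c :
  scoef (\sum_(t <- r | P t) F t) c = \sum_(t <- r | P t) scoef (F t) c.
Proof. by elim/big_rec2: _ => // t x y _ <-. Qed.

Lemma scoef_varM i f c : scoef (cps_var v i * f) (c + expo1 i) = scoef f c.
Proof. by rewrite /scoef cps_valM fps_varM. Qed.

Lemma scoef_varM0 i f c : c i = 0%N -> scoef (cps_var v i * f) c = 0.
Proof. by move=> ci; rewrite /scoef cps_valM fps_varM0. Qed.

Lemma cordD d f g : cord d f -> cord d g -> cord d (f + g).
Proof. exact: ord_geD. Qed.
Lemma cordB d f g : cord d f -> cord d g -> cord d (f - g).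
Proof. exact: ord_geB. Qed.
Lemma cordZ d k f : cord d f -> cord d (k *: f).
Proof. exact: ord_geZ. Qed.
Lemma cordM d e f g : cord d f -> cord e g -> cord (d + e) (f * g).
Proof. by rewrite /cord cps_valM; apply: ord_geM. Qed.
Lemma cordMr d f g : cord d g -> cord d (f * g).
Proof. by rewrite /cord cps_valM; apply: ord_geMr. Qed.
Lemma cordW d e f : (e <= d)%N -> cord d f -> cord e f.
Proof. exact: ord_geW. Qed.
Lemma cord_sum (T : Type) (r : seq T) (P : pred T) (F : T -> cps v I) d :
  (forall t, P t -> cord d (F t)) -> cord d (\sum_(t <- r | P t) F t).
Proof. by move=> H; elim/big_ind: _ => // f g; apply: cordD. Qed.
Lemma cord_var i : cord 1 (cps_var v i).
Proof. exact: ord_ge_var. Qed.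
Lemma cord1 f : scoef f 0 = 0 <-> cord 1 f.
Proof. by split=> [|H]; [exact: ord_ge1|apply: H; rewrite deg0]. Qed.

Lemma cord_all f : (forall d, cord d f) -> f = 0.
Proof. by move=> f0; apply/val_inj; apply: ord_ge_all. Qed.

Lemma cps_conv f : convergent v (cps_val f).
Proof. exact/asboolP/cps_convergent. Qed.

Definition mk_cps (f : fps K I) (H : convergent v f) : cps v I :=
  Cps (introT (asboolP _) H).

(** Defined on coefficients so that convergence is immediate; [kill_subst] identifies it with
    setting the variables of Q to 0. *)
Definition kill (Q : pred I) f : cps v I.
Proof.
pose g : fps K I := fun c => if [exists i, Q i && (c i != 0%N)] then 0 else scoef f c.
apply: (@mk_cps g); apply: convergent_le (cps_conv f) => c.
by rewrite /g; case: ifP; rewrite ?absv0 ?absv_ge0.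
Defined.

Lemma scoef_kill Q f c :
  scoef (kill Q f) c = if [exists i, Q i && (c i != 0%N)] then 0 else scoef f c.
Proof. by []. Qed.

Definition quo (Q : pred I) i f : cps v I.
Proof.
pose g : fps K I := fun c => if [pick j | Q j && ((c + expo1 i) j != 0%N)] == Some i
  then scoef f (c + expo1 i) else 0.
apply: (@mk_cps g); apply: (@convergent_sub_shift _ _ _ _ i) (cps_conv f) => c.
by rewrite /g; case: ifP; rewrite ?absv0 ?absv_ge0.
Defined.

Lemma scoef_quo Q i f c : scoef (quo Q i f) c =
  if [pick j | Q j && ((c + expo1 i) j != 0%N)] == Some i
  then scoef f (c + expo1 i) else 0.
Proof. by []. Qed.

(* Every monomial containing a variable of Q is charged to the first one. *)
Lemma split_quo (Q : pred I) f :
  f = kill Q f + \sum_(i | Q i) cps_var v i * quo Q i f.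
Proof.
apply: cpsP => c; rewrite scoefD scoef_sum scoef_kill.
have [o oE] : exists o, o = [pick j | Q j && (c j != 0%N)] by eexists.
case: pickP (oE) => [i /andP[Qi ci]|Q0] oi; last first.
  rewrite ifF; last by apply/existsP => -[i]; rewrite Q0.
  rewrite big1 ?addr0// => i Qi; rewrite scoef_varM0//; apply/eqP.
  by have := Q0 i; rewrite Qi/= => /negbFE.
move: oE; rewrite {o}oi => /esym cE.
rewrite ifT; last by apply/existsP; exists i; rewrite Qi.
have [b bE] := expo_gt0P ci.
rewrite add0r (bigD1 i)//= big1 ?addr0 => [|j /andP[Qj ji]]; last first.
  have [cj|cj] := eqVneq (c j) 0%N; first by rewrite scoef_varM0.
  have [e eE] := expo_gt0P cj; rewrite eE scoef_varM scoef_quo -eE cE.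
  by case: eqP => // -[] ij; rewrite ij eqxx in ji.
by rewrite bE scoef_varM scoef_quo -bE cE eqxx.
Qed.

Lemma cord_quo Q i d f : cord d.+1 f -> cord d (quo Q i f).
Proof.
move=> fd c cd; rewrite -[cps_val _ _]/(scoef _ _) scoef_quo; case: ifP => // _.
by apply: fd; rewrite degD deg_expo1 addn1 ltnS.
Qed.

Lemma kill_const f : kill predT f = (scoef f 0)%:A.
Proof.
apply: cpsP => c; rewrite scoef_kill scoefZ scoef1; case: eqP => [->|c0].
  rewrite ifF ?mulr1//; apply/existsP => -[i]; by rewrite ffunE.
rewrite ifT ?mulr0//; apply/existsP.
have : (0 < deg c)%N by rewrite lt0n; apply/eqP => /deg_eq0.
move=> /deg_gt0P[b [i ->]]; exists i; by rewrite expo_add_expo1.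
Qed.

Lemma split_const f : f = (scoef f 0)%:A + \sum_i cps_var v i * quo predT i f.
Proof. by rewrite -kill_const; apply: split_quo. Qed.

Lemma kill_is_zmod Q : zmod_morphism (kill Q).
Proof.
move=> f g; apply: cpsP => c; rewrite scoefB !scoef_kill scoefB.
by case: ifP; rewrite ?subrr.
Qed.
HB.instance Definition _ Q := GRing.isZmodMorphism.Build _ _ (kill Q) (kill_is_zmod Q).

Lemma kill_constE Q k : kill Q (k%:A) = k%:A.
Proof.
apply: cpsP => c; rewrite scoef_kill scoefZ scoef1; case: ifP => // /existsP[i ci].
by case: (c =P 0) ci => [->|_ _]; rewrite ?ffunE ?andbF ?mulr0.
Qed.

Lemma kill_varM Q i f :
  kill Q (cps_var v i * f) = (if Q i then 0 else cps_var v i) * kill Q f.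
Proof.
apply: cpsP => c; have [ci|ci] := eqVneq (c i) 0%N.
  rewrite scoef_kill scoef_varM0// if_same.
  by case: (Q i); rewrite ?mul0r ?scoef_varM0.
have [b ->] := expo_gt0P ci; rewrite scoef_kill scoef_varM.
case Qi: (Q i).
  by rewrite mul0r scoef0 ifT//; apply/existsP; exists i; rewrite Qi expo_add_expo1.
rewrite scoef_varM scoef_kill; congr (if _ then _ else _).
apply/existsP/existsP => -[j /andP[Qj bj]]; exists j; rewrite Qj/=.
  by rewrite expo_add_expo1N// in bj; apply: contraFneq Qi => <-.
by rewrite expo_addE addn_eq0 (negbTE bj).
Qed.

End OneRing.

Arguments scoef : simpl never.
Arguments quo : simpl never.
Arguments kill : simpl never.

(* By induction on the order d: [split_const] writes f as a constant plus a
   combination of the variables, so D f is in the ideal generated by the u j. *)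
Lemma operator_ext (I J : finType) (D : {additive cps v J -> cps v I})
    (u : J -> cps v I) : (forall j, cord 1 (u j)) ->
  (forall k : K, D (k%:A) = 0) -> (forall j f, D (cps_var v j * f) = u j * D f) ->
  forall f, D f = 0.
Proof.
move=> u1 D0 DM; suff H d : forall f, cord d (D f).
  by move=> f; apply: cord_all => d; apply: H.
elim: d => [//|d IH] f; rewrite (split_const f) raddfD/= D0 add0r raddf_sum.
by apply: cord_sum => j _; rewrite DM -add1n; apply: cordM.
Qed.

Lemma operator_ext2 (I J : finType) (D D' : {additive cps v J -> cps v I})
    (u : J -> cps v I) : (forall j, cord 1 (u j)) ->
  (forall k : K, D (k%:A) = D' (k%:A)) ->
  (forall j f, D (cps_var v j * f) = u j * D f) ->
  (forall j f, D' (cps_var v j * f) = u j * D' f) ->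
  D =1 D'.
Proof.
move=> u1 DD DM DM' f; apply/eqP; rewrite -subr_eq0; apply/eqP.
rewrite -[LHS]/((D \- D') f); apply: (operator_ext u1) => [k|j g] /=.
  by rewrite DD subrr.
by rewrite DM DM' mulrBr.
Qed.

Section Subst.
Variables (I J : finType) (phi : J -> cps v I).

(* Only the part of [phi] without constant term is substituted, so that [subst]
   is a morphism of algebras for every [phi]. *)
Definition centered j : fps K I := cps_val (phi j - (scoef (phi j) 0)%:A).

Lemma centered_ord j : ord_ge 1 (centered j).
Proof. exact: fps_const_ord. Qed.

Definition subst (f : cps v J) : cps v I :=
  mk_cps (convergent_comp centered_ord (fun j => cps_conv _) (cps_conv f)).

Lemma subst_is_zmod : zmod_morphism subst.
Proof. by move=> f g; apply/val_inj/comp_is_zmod. Qed.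

Lemma subst_is_scalable : scalable subst.
Proof.
move=> k f; apply/val_inj; rewrite -[RHS]/(cps_val _).
by rewrite -[LHS]/(fps_comp _ (cps_val _)) !cps_valZ comp_scalable.
Qed.

Lemma subst_is_monoid : monoid_morphism subst.
Proof.
split=> [|f g]; apply/val_inj; first exact: comp1.
rewrite -[RHS]/(cps_val _) -[LHS]/(fps_comp _ (cps_val _)) !cps_valM.
by rewrite compM//; apply: centered_ord.
Qed.

HB.instance Definition _ := GRing.isZmodMorphism.Build _ _ subst subst_is_zmod.
HB.instance Definition _ :=
  GRing.isScalable.Build K (cps v J) (cps v I) *:%R subst subst_is_scalable.
HB.instance Definition _ := GRing.isMonoidMorphism.Build _ _ subst subst_is_monoid.

Lemma subst_var j : scoef (phi j) 0 = 0 -> subst (cps_var v j) = phi j.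
Proof.
move=> p0; apply/val_inj; rewrite /= comp_var; last exact: centered_ord.
by rewrite /centered p0 scale0r subr0.
Qed.

Lemma subst_const k : subst (k%:A) = k%:A.
Proof. by rewrite linearZ rmorph1. Qed.

Lemma scoef_subst0 f : scoef (subst f) 0 = scoef f 0.
Proof.
rewrite [in LHS](split_const f) raddfD/= subst_const scoefD scoefZ scoef1 eqxx mulr1.
rewrite raddf_sum/= scoef_sum big1 ?addr0// => j _.
rewrite rmorphM scoefM0 [X in X * _](_ : _ = 0) ?mul0r//.
apply/cord1; rewrite /cord/= comp_var; exact: centered_ord.
Qed.

Lemma cord_subst d f : (forall j, scoef (phi j) 0 = 0) -> cord d f -> cord d (subst f).
Proof.
move=> p0; elim: d f => [//|d IH] f fd.
have f0 : scoef f 0 = 0 by apply: fd; rewrite deg0.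
rewrite (split_const f) f0 scale0r add0r raddf_sum/=; apply: cord_sum => j _.
rewrite rmorphM/= subst_var// -add1n; apply: cordM; first exact/cord1.
by apply/IH/cord_quo.
Qed.

End Subst.

(** Continuity is automatic: both maps agree on constants and turn multiplication by x_j into
    multiplication by [phi j], which has positive order, so [operator_ext2] applies. *)
Lemma lrmorphism_subst (I J : finType) (F : {lrmorphism cps v J -> cps v I})
  (phi : J -> cps v I) : (forall j, scoef (phi j) 0 = 0) ->
  (forall j, F (cps_var v j) = phi j) -> F =1 subst phi.
Proof.
move=> p0 Fp; apply: (@operator_ext2 _ _ F (subst phi) phi).
- by move=> j; apply/cord1.
- by move=> k /=; rewrite !linearZ/= !rmorph1.
- by move=> j f /=; rewrite rmorphM/= Fp.
- by move=> j f /=; rewrite rmorphM/= subst_var.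
Qed.

Lemma subst_eq (I J : finType) (phi psi : J -> cps v I) : phi =1 psi ->
  subst phi =1 subst psi.
Proof. by move=> pp f; have -> : phi = psi by apply/funext. Qed.

Lemma subst_comp (I J L : finType) (phi : J -> cps v I) (psi : L -> cps v J) f :
  (forall j, scoef (phi j) 0 = 0) -> (forall j, scoef (psi j) 0 = 0) ->
  subst phi (subst psi f) = subst (fun l => subst phi (psi l)) f.
Proof.
move=> p0 q0; rewrite -[LHS]/((subst phi \o subst psi) f).
apply: lrmorphism_subst => l /=; first by rewrite scoef_subst0.
by rewrite subst_var.
Qed.

Lemma subst_id (I : finType) (f : cps v I) : subst (fun i => cps_var v i) f = f.
Proof.
by rewrite -[RHS]/(idfun f); symmetry; apply: lrmorphism_subst => // i; apply: scoef_var0.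
Qed.

Lemma kill_subst (I : finType) (Q : pred I) (f : cps v I) :
  kill Q f = subst (fun i => if Q i then 0 else cps_var v i) f.
Proof.
have c0 i : scoef (if Q i then 0 else cps_var v i) 0 = 0.
  by case: ifP; rewrite ?scoef_var0.
apply: (@operator_ext2 _ _ (kill Q) (subst _)
  (fun i => if Q i then 0 else cps_var v i)) => [i|k|i g|i g].
- exact/cord1.
- by rewrite /= subst_const kill_constE.
- exact: kill_varM.
- by rewrite /= rmorphM/= subst_var.
Qed.

Section Emb.
Variables (I : finType) (P : pred I).

Lemma scoef_emb (f : cps v {i | P i}) c : scoef (cps_emb f) c =
  if [forall i, (c i != 0%N) ==> P i] then scoef f [ffun j => c (val j)] else 0.
Proof. by []. Qed.

Lemma emb_is_zmod : zmod_morphism (@cps_emb R K v I P).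
Proof.
move=> f g; apply: cpsP => c; rewrite scoefB !scoef_emb.
by case: ifP; rewrite ?subrr.
Qed.
HB.instance Definition _ := GRing.isZmodMorphism.Build _ _ (@cps_emb R K v I P) emb_is_zmod.

Lemma emb_subst (f : cps v {i | P i}) : cps_emb f = subst (fun j => cps_var v (val j)) f.
Proof.
have c0 (j : {i | P i}) : scoef (cps_var v (val j)) 0 = 0 by apply: scoef_var0.
apply: (@operator_ext2 _ _ (@cps_emb R K v I P) (subst _)
  (fun j => cps_var v (val j))) => [j|k|j g|j g].
- exact/cord1.
- rewrite /= subst_const; apply: cpsP => c; rewrite scoef_emb !scoefZ !scoef1.
  case: ifP => [/forallP cP|cP].
    congr (_ * _%:R); congr nat_of_bool; apply/eqP/eqP => [/ffunP c0'|->]; last first.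
      by apply/ffunP => j; rewrite !ffunE.
    apply/ffunP => i; rewrite ffunE; have := cP i; have [//|ci Pi] := eqVneq (c i) 0%N.
    by have := c0' (Sub i Pi); rewrite !ffunE.
  case: eqP => [E|]; last by rewrite mulr0.
  by case/negP: (negbT cP); apply/forallP => i; rewrite E ffunE.
- apply: cpsP => c; have [ci|ci] := eqVneq (c (val j)) 0%N.
    rewrite scoef_emb !scoef_varM0//; last by rewrite ffunE.
    by rewrite if_same.
  have [b ->] := expo_gt0P ci; rewrite scoef_varM !scoef_emb.
  have -> : [ffun j0 => (b + expo1 (val j)) (val j0)] =
      [ffun j0 : {i | P i} => b (val j0)] + expo1 j :> expo {i | P i}.
    by apply/ffunP => i; rewrite !(expo_addE, ffunE).
  rewrite scoef_varM; congr (if _ then _ else _).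
  apply/forallP/forallP => H i; have := H i.
    by apply: contraTT; rewrite !negb_imply => /andP[bi ->]; rewrite expo_addE addn_eq0 negb_and bi.
  have [->|ij] := eqVneq i (val j); first by rewrite (valP j) !implybT.
  by rewrite expo_add_expo1N.
- by rewrite /= rmorphM/= subst_var ?scoef_var0.
Qed.

End Emb.

End Cps.

Arguments scoef : simpl never.
Arguments quo : simpl never.
Arguments kill : simpl never.
Arguments subst : simpl never.

(** * Fixed points in the ring of convergent power series *)

Section FixedPoint.
Variables (R : realType) (K : fieldType) (v : real_valuation R K) (I : finType).

Lemma ord_ge_comp (J : finType) (phi : J -> fps K I) d f :
  (forall j, ord_ge 1 (phi j)) -> ord_ge d f -> ord_ge d (fps_comp phi f).
Proof.
move=> p1 fd c cd; rewrite /fps_comp big1// => a _.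
have [ad|da] := ltnP (deg (bx a)) d; first by rewrite fd// mul0r.
by rewrite (ord_ge_mon p1) ?mulr0//; apply: leq_trans cd da.
Qed.

(** A contraction estimate: every monomial of f has at least two factors, so exchanging one of them
    gains d from the difference and at least 1 more from the others. *)
Lemma eqm_comp2 (J : finType) d (phi psi : J -> fps K I) (f : fps K J) :
  (forall j, ord_ge 1 (phi j)) -> (forall j, ord_ge 1 (psi j)) -> ord_ge 2 f ->
  (forall j, ord_ge d (phi j - psi j)) ->
  ord_ge d.+1 (fps_comp phi f - fps_comp psi f).
Proof.
move=> p1 q1 f2 pq c cd; rewrite fpsBE /fps_comp -sumrB big1// => a _.
rewrite -mulrBr; have [ad|da] := ltnP (deg (bx a)) 2; first by rewrite f2// mul0r.
suff -> : mon phi (bx a) c = mon psi (bx a) c by rewrite subrr mulr0.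
apply: (@eqmE _ _ d.+1) => //.
have /deg_gt0P[b [j abj]] : (0 < deg (bx a))%N by apply: leq_trans da.
have b1 : (1 <= deg b)%N by move: da; rewrite abj degD deg_expo1 addn1.
rewrite abj !monD !mon_expo1.
set A := mon phi b; set B := mon psi b.
have -> : A * phi j - B * psi j = (A - B) * phi j + B * (phi j - psi j).
  by rewrite mulrBl mulrBr addrA subrK.
apply: ord_geD; first rewrite -addn1; last rewrite -add1n; apply: ord_geM => //.
 by apply: eqm_prod => l; apply: eqm_exp.
exact: ord_geW b1 (@ord_ge_mon _ _ _ _ q1 b).
Qed.

Lemma fixed_point (h : I -> cps v I) : (forall i, cord 2 (h i)) ->
  exists c : I -> cps v I, forall i,
    scoef (c i) 0 = 0 /\ c i = cps_var v i + subst c (h i).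
Proof.
move=> h2; pose hh i := cps_val (h i).
pose step (u : I -> fps K I) i := fps_var K i + fps_comp u (hh i).
pose cn n := iter n step (fun=> 0).
have cnS n i : cn n.+1 i = fps_var K i + fps_comp (cn n) (hh i) by [].
have cn1 n i : ord_ge 1 (cn n i).
  elim: n i => [//|n IH] i; rewrite cnS; apply: ord_geD; first exact: ord_ge_var.
  by apply: ord_ge_comp => //; apply: ord_geW (h2 i).
have cauchy1 n i : ord_ge n.+1 (cn n.+1 i - cn n i).
  elim: n i => [|n IH] i; first by rewrite subr0; apply: cn1.
  rewrite [cn n.+2 i]cnS [cn n.+1 i]cnS opprD addrACA subrr add0r.
  by apply: eqm_comp2 => //; apply: h2.
have cauchy n m i : (n <= m)%N -> ord_ge n.+1 (cn m i - cn n i).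
  move=> /subnK <-; elim: (m - n)%N => [|k IH]; first by rewrite subrr.
  apply: eqm_trans IH; rewrite addSn; apply: ord_geW (cauchy1 _ _).
  by rewrite ltnS leq_addl.
have /choice[rr rrP] : forall i, exists p : R * R,
    0 < p.1 /\ norm_le v p.1 p.2 (hh i).
  move=> i; have /convergent_norm[r [M H]] := cps_conv (h i).
  by exists (r, M).
pose r0 := \big[Num.min/1]_i (rr i).1.
have r0_gt0 : 0 < r0.
  by rewrite /r0; elim/big_ind: _ => // [x y x0 y0|j _]; [rewrite lt_min x0|case: (rrP j)].
have M0 i : 0 <= (rr i).2 by case: (rrP i) => _ /norm_le_ge0.
(* The summand r0 keeps M positive and at least r0, whence t <= 1 below. *)
pose M := r0 + \sum_i (rr i).2.
have hM i : norm_le v r0 M (hh i).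
  case: (rrP i) => _; apply: norm_leW; first exact: ltW.
    by rewrite /r0 (bigD1 i)//= ge_min lexx.
  rewrite /M (bigD1 i)//= addrCA lerDl addr_ge0 ?sumr_ge0//; exact: ltW.
have r0M : r0 <= M by rewrite /M lerDl sumr_ge0.
have Mgt0 : 0 < M by apply: lt_le_trans r0M.
(* Since h has order 2, its norm at radius rho = t r0 is at most t^2 M = t r0 / 2 = rho / 2. At
   radius rho / 2 a variable also costs rho / 2, so the iterates stay within rho. *)
pose t := r0 / (2 * M); have tgt0 : 0 < t by rewrite divr_gt0// mulr_gt0.
have t1 : t <= 1.
  rewrite ler_pdivrMr ?mulr_gt0// mul1r mulr_natl mulr2n.
  by apply: le_trans r0M _; rewrite lerDl ltW.
pose rho := t * r0; have rho_gt0 : 0 < rho by rewrite mulr_gt0.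
have hrho i : norm_le v rho (rho / 2) (hh i).
  have -> : rho / 2 = t ^+ 2 * M.
    have tM : t * M = r0 / 2 by rewrite /t invfM mulrA -mulrA mulVf ?mulr1// gt_eqF.
    by rewrite expr2 -[RHS](mulrA t t M) tM mulrA.
  by apply: norm_le_scale => //; [exact: ltW|rewrite t1 ltW|exact: h2].
pose eps := rho / 2; have eps_gt0 : 0 < eps by rewrite divr_gt0.
have cn_norm n i : norm_le v eps rho (cn n i).
  elim: n i => [|n IH] i.
    by apply: norm_leW (norm_le0 v eps); rewrite ?lexx ?ltW.
  rewrite [rho](splitr rho); apply: norm_leD; first exact: ltW.
    by apply: norm_le_var; apply: ltW.
  exact: norm_le_comp (ltW eps_gt0) (ltW rho_gt0) (cn1 n) IH (hrho i).
(* The coefficient at e no longer changes from the iterate of index [deg e] on. *)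
pose c i : fps K I := fun e => cn (deg e).+1 i e.
have cE n i : ord_ge n.+1 (c i - cn n i).
  move=> e en; rewrite fpsBE; apply/eqP; rewrite subr_eq0; apply/eqP.
  have [ne|ne] := leqP n (deg e).+1; first by apply: (eqmE (cauchy _ _ _ ne)).
  by symmetry; apply: (eqmE (cauchy _ _ _ (ltnW ne))); apply: ltnW.
have cc i : convergent v (c i).
  (* A finite partial sum for c involves boundedly many degrees, hence coincides with that of a
     single iterate. *)
  apply/convergent_norm; exists eps, rho; split=> // s us.
  have [N sN] := seq_deg_le s.
  apply: le_trans (cn_norm N i _ us); rewrite big_seq [leRHS]big_seq.
  apply: ler_sum => a /sN aN; rewrite (eqmE (cE N i))// ltnS.
have c1 i : ord_ge 1 (c i).
  by rewrite -(subrK (cn 0%N i) (c i)); apply: ord_geD => //; apply: cE.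
exists (fun i => mk_cps (cc i)) => i; have c0 j : c j 0 = 0 by apply: c1; rewrite deg0.
split; first exact: c0.
apply/val_inj => /=.
have -> : centered (fun i => mk_cps (cc i)) = c.
  by apply/funext => j; rewrite /centered /scoef /= c0 scale0r subr0.
apply/eqP; rewrite -subr_eq0; apply/eqP/ord_ge_all => n.
apply: (@ord_geW _ _ n.+2); first by rewrite !leqW.
apply: eqm_trans (cE n.+1 i) _.
rewrite [cn n.+1 i]cnS opprD addrACA subrr add0r.
apply: eqm_comp2 => //; first exact: h2.
by move=> j; apply: eqm_sym; apply: cE.
Qed.

End FixedPoint.

(** * Derivatives and the inverse function theorem *)

Section Derivatives.
Variables (R : realType) (K : fieldType) (v : real_valuation R K).

Section OneRing.
Variable I : finType.
Implicit Types (f g : cps v I) (i j : I) (c : expo I).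

Definition deriv i f : cps v I := mk_cps (convergent_pderiv i (cps_conv f)).
Arguments deriv : simpl never.

Lemma scoef_deriv i f c : scoef (deriv i f) c = scoef f (c + expo1 i) *+ (c i).+1.
Proof. by []. Qed.

Lemma deriv_is_zmod i : zmod_morphism (deriv i).
Proof.
by move=> f g; apply: cpsP => c; rewrite scoefB !scoef_deriv scoefB mulrnBl.
Qed.
HB.instance Definition _ i := GRing.isZmodMorphism.Build _ _ (deriv i) (deriv_is_zmod i).

Lemma derivZ i k f : deriv i (k *: f) = k *: deriv i f.
Proof.
by apply: cpsP => c; rewrite scoefZ !scoef_deriv scoefZ mulrnAr.
Qed.

Lemma scoef_varM_deriv i f c : scoef (cps_var v i * deriv i f) c = scoef f c *+ c i.
Proof.
have [ci|ci] := eqVneq (c i) 0%N; first by rewrite scoef_varM0 ?ci.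
by have [b ->] := expo_gt0P ci; rewrite scoef_varM scoef_deriv expo_add_expo1.
Qed.

(* The Euler operator x_i d/dx_i multiplies the coefficient of x^c by c_i, hence
   is a derivation. *)
Lemma derivM i f g : deriv i (f * g) = deriv i f * g + f * deriv i g.
Proof.
apply/eqP; rewrite -subr_eq0; apply/eqP; set D := _ - _.
suff E : cps_var v i * D = 0.
  by apply/val_inj; apply: (@fps_varI K I i (val D) (congr1 val E)).
rewrite {}/D mulrBr mulrDr mulrA mulrCA.
apply: cpsP => c; rewrite scoefB scoef_varM_deriv scoefD.
rewrite /scoef /= !(fpsME _ _ (leqnn _)) -sumrMnl.
apply/eqP; rewrite subr_eq0 -big_split/=; apply/eqP/eq_bigr => a _.
rewrite -sumrMnl -big_split/=; apply: eq_bigr => b /eqP abc.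
have := scoef_varM_deriv i f (bx a); rewrite /scoef /= => ->.
have := scoef_varM_deriv i g (bx b); rewrite /scoef /= => ->.
by rewrite mulrnAl mulrnAr -mulrnDr -expo_addE abc.
Qed.

Lemma deriv_const i k : deriv i (k%:A) = 0.
Proof.
apply: cpsP => c; rewrite scoef_deriv scoefZ scoef1 scoef0; case: eqP => [/ffunP/(_ i)|].
  by rewrite expo_add_expo1 ffunE.
by rewrite mulr0 mul0rn.
Qed.

Lemma deriv_var i j : deriv i (cps_var v j) = (i == j)%:R.
Proof.
apply: cpsP => c; rewrite scoef_deriv scoef_var.
have -> : scoef ((i == j)%:R : cps v I) c = (i == j)%:R * (c == 0)%:R.
  by case: eqP; rewrite ?mul1r ?mul0r.
have [<-|ij] := eqVneq i j; last first.
  case: eqP => [/ffunP/(_ i)|]; last by rewrite mul0rn mul0r.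
  by rewrite expo_add_expo1 ffunE (negbTE ij).
rewrite mul1r; have -> : (c + expo1 i == expo1 i) = (c == 0).
  by apply/eqP/eqP => [cE|->]; rewrite ?add0r//;
     apply: (@expo_addIr _ _ _ (expo1 i)); rewrite add0r.
by case: eqP => [->|]; rewrite ?ffunE ?mul0rn.
Qed.

Lemma scoef_deriv0 i f : scoef (deriv i f) 0 = scoef f (expo1 i).
Proof. by rewrite scoef_deriv add0r ffunE. Qed.

Lemma scoef_var_expo1 i j : scoef (cps_var v i) (expo1 j) = (i == j)%:R.
Proof.
by rewrite -scoef_deriv0 deriv_var eq_sym; case: eqP => _; rewrite ?scoef1 ?eqxx.
Qed.

Lemma scoefM_expo1 i f g :
  scoef (f * g) (expo1 i) = scoef f (expo1 i) * scoef g 0 + scoef f 0 * scoef g (expo1 i).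
Proof. by rewrite -!scoef_deriv0 derivM scoefD !scoefM0. Qed.

Lemma cord2P f : cord 2 f <-> scoef f 0 = 0 /\ forall i, scoef f (expo1 i) = 0.
Proof.
split=> [f2|[f0 f1] c].
  by split=> [|i]; apply: f2; rewrite ?deg0 ?deg_expo1.
rewrite ltnS leq_eqVlt => /orP[/eqP c1|]; last first.
  by rewrite ltnS leqn0 => /eqP/deg_eq0 ->.
have /deg_gt0P[b [i bE]] : (0 < deg c)%N by rewrite c1.
move: c1; rewrite bE degD deg_expo1 addn1 => -[] /deg_eq0 ->; rewrite add0r.
exact: f1.
Qed.

End OneRing.

Section ChainRule.
Variables (I J : finType) (phi : J -> cps v I) (i : I).
Hypothesis phi0 : forall j, scoef (phi j) 0 = 0.

Definition chain_defect (f : cps v J) : cps v I :=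
  deriv i (subst phi f) - \sum_j subst phi (deriv j f) * deriv i (phi j).

Let chain_defect_is_zmod : zmod_morphism chain_defect.
Proof.
move=> f g; rewrite /chain_defect.
rewrite (eq_bigr (fun j => subst phi (deriv j f) * deriv i (phi j) -
    subst phi (deriv j g) * deriv i (phi j))); last first.
  by move=> j _; rewrite !raddfB/= mulrBl.
rewrite sumrB [subst phi (f - g)]raddfB [deriv i _]raddfB/= !opprB addrACA [RHS]addrACA.
by congr (_ + _); apply: addrC.
Qed.
HB.instance Definition _ := GRing.isZmodMorphism.Build _ _ chain_defect chain_defect_is_zmod.

(** The difference of the two sides is additive, vanishes on constants and, by the Leibniz rule,
    satisfies D(x_j f) = phi_j D f, so [operator_ext] annihilates it. *)
Lemma deriv_subst (f : cps v J) :
  deriv i (subst phi f) = \sum_j subst phi (deriv j f) * deriv i (phi j).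
Proof.
apply/eqP; rewrite -subr_eq0; apply/eqP; move: f.
apply: (@operator_ext _ _ _ _ _ chain_defect phi) => [j|k|j f] /=.
- exact/cord1.
- rewrite /chain_defect subst_const deriv_const big1 ?subrr// => j _.
  by rewrite deriv_const raddf0 mul0r.
rewrite /chain_defect rmorphM/= subst_var// derivM mulrBr mulr_sumr.
rewrite [_ * subst phi f + _]addrC -addrA; congr (_ + _).
rewrite (bigD1 j)//= [X in _ - (_ + X)](eq_bigr (fun l =>
    phi j * (subst phi (deriv l f) * deriv i (phi l)))); last first.
  move=> l /negbTE lj; rewrite derivM deriv_var lj mul0r add0r.
  by rewrite rmorphM/= subst_var// mulrA.
rewrite derivM deriv_var eqxx mul1r [subst phi (_ + _)]raddfD/= rmorphM/= subst_var//.
rewrite mulrDl [RHS](_ : _ = - (\sum_j0 phi j * (subst phi (deriv j0 f) * deriv i (phi j0))))//.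
rewrite [in RHS](bigD1 j)//= mulrA -addrA opprD addrA [deriv i (phi j) * _]mulrC.
by rewrite subrr add0r.
Qed.

End ChainRule.

Lemma scoef_subst_expo1 (I J : finType) (phi : J -> cps v I) (f : cps v J) i :
  (forall j, scoef (phi j) 0 = 0) ->
  scoef (subst phi f) (expo1 i) =
  \sum_j scoef f (expo1 j) * scoef (phi j) (expo1 i).
Proof.
move=> p0; rewrite -scoef_deriv0 deriv_subst// scoef_sum; apply: eq_bigr => j _.
by rewrite scoefM0 scoef_subst0 !scoef_deriv0.
Qed.

End Derivatives.

Arguments deriv : simpl never.

Lemma fin_mulC1 (K : fieldType) (I : finType) (L M : I -> I -> K) :
  (forall i k, \sum_j L i j * M j k = (i == k)%:R) ->
  forall i k, \sum_j M i j * L j k = (i == k)%:R.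
Proof.
move=> LM i k; pose mx (A : I -> I -> K) : 'M[K]_#|I| :=
  \matrix_(a, b) A (enum_val a) (enum_val b).
have mxM A B : mx A *m mx B = mx (fun i k => \sum_j A i j * B j k).
  apply/matrixP => a b; rewrite !mxE (reindex (@enum_val I I)); last first.
    exact/onW_bij/enum_val_bij.
  by apply: eq_bigr => c _; rewrite !mxE.
have : mx L *m mx M = 1%:M.
  by apply/matrixP => a b; rewrite mxM !mxE LM (inj_eq enum_val_inj).
move/mulmx1C; rewrite mxM => /matrixP/(_ (enum_rank i) (enum_rank k)).
by rewrite !mxE !enum_rankK (inj_eq enum_rank_inj).
Qed.

Section Inverse.
Variables (R : realType) (K : fieldType) (v : real_valuation R K).

Definition jac_inv (I : finType) (phi : I -> cps v I) : Prop :=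
  exists L : I -> I -> K, forall i k,
    \sum_j L i j * scoef (phi j) (expo1 k) = (i == k)%:R.

(** After multiplication by L the map has identity linear part, so x - psi has order 2 and a
    solution of c = x + (x - psi)(c) satisfies psi(c) = x. Then phi(c) is linear with the Jacobian
    as matrix, and the linear substitution [xi] undoes it. *)
Lemma inverse_function (I : finType) (phi : I -> cps v I) :
  (forall i, scoef (phi i) 0 = 0) -> jac_inv phi ->
  exists chi : I -> cps v I, (forall i, scoef (chi i) 0 = 0) /\
    forall i, subst chi (phi i) = cps_var v i.
Proof.
move=> p0 [L LM]; have ML := fin_mulC1 LM.
pose psi i := \sum_j L i j *: phi j.
have [i|c cE] := @fixed_point _ _ v I (fun i => cps_var v i - psi i).
  apply/cord2P; split=> [|k]; rewrite scoefB.
    by rewrite scoef_var0 scoef_sum big1 ?subrr// => j _; rewrite scoefZ p0 mulr0.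
  rewrite scoef_var_expo1 scoef_sum -LM -sumrB big1// => j _.
  by rewrite scoefZ subrr.
have c0 i : scoef (c i) 0 = 0 by case: (cE i).
have cpsi i : \sum_j L i j *: subst c (phi j) = cps_var v i.
  have [_] := cE i; rewrite raddfB/= subst_var// raddf_sum/= addrCA => /esym/eqP.
  rewrite -subr_eq0 addrAC subrr add0r subr_eq0 => /eqP ->.
  by apply: eq_bigr => j _; rewrite linearZ.
have cphi j : subst c (phi j) = \sum_i scoef (phi j) (expo1 i) *: cps_var v i.
  under eq_bigr => i _ do rewrite -cpsi scaler_sumr.
  rewrite exchange_big/= (bigD1 j)//= [X in X + _](_ : _ = subst c (phi j)); last first.
    under eq_bigr => i _ do rewrite scalerA.
    by rewrite -scaler_suml ML eqxx scale1r.
  rewrite big1 ?addr0// => k /negbTE kj.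
  under eq_bigr => i _ do rewrite scalerA.
  by rewrite -scaler_suml ML eq_sym kj scale0r.
pose xi i := \sum_k L i k *: cps_var v k.
have xi0 i : scoef (xi i) 0 = 0.
  by rewrite scoef_sum big1// => k _; rewrite scoefZ scoef_var0 mulr0.
exists (fun i => subst xi (c i)); split=> i; first by rewrite scoef_subst0.
rewrite -subst_comp// cphi raddf_sum/=.
under eq_bigr => j _ do rewrite linearZ/= subst_var// scaler_sumr.
rewrite exchange_big/= (bigD1 i)//= [X in X + _](_ : _ = cps_var v i); last first.
  under eq_bigr => j _ do rewrite scalerA.
  by rewrite -scaler_suml ML eqxx scale1r.
rewrite big1 ?addr0// => k /negbTE ki.
under eq_bigr => j _ do rewrite scalerA.
by rewrite -scaler_suml ML eq_sym ki scale0r.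
Qed.

Lemma jac_inv_left (I : finType) (phi chi : I -> cps v I) :
  (forall i, scoef (chi i) 0 = 0) ->
  (forall i, subst chi (phi i) = cps_var v i) -> jac_inv chi.
Proof.
move=> c0 cp; exists (fun i j => scoef (phi i) (expo1 j)) => i k.
by rewrite -scoef_subst_expo1// cp scoef_var_expo1.
Qed.

(* Two successive one-sided inverses coincide. *)
Lemma inverse_function2 (I : finType) (phi : I -> cps v I) :
  (forall i, scoef (phi i) 0 = 0) -> jac_inv phi ->
  exists chi : I -> cps v I, [/\ forall i, scoef (chi i) 0 = 0, jac_inv chi,
    cancel (subst phi) (subst chi) & cancel (subst chi) (subst phi)].
Proof.
move=> p0 pJ; have [chi [c0 cp]] := inverse_function p0 pJ.
have cJ := jac_inv_left c0 cp; have [w [w0 wc]] := inverse_function c0 cJ.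
have can (a b : I -> cps v I) : (forall i, scoef (a i) 0 = 0) ->
    (forall i, scoef (b i) 0 = 0) -> (forall i, subst b (a i) = cps_var v i) ->
    cancel (subst a) (subst b).
  by move=> a0 b0 ab f; rewrite subst_comp// (subst_eq ab) subst_id.
have pc := can _ _ p0 c0 cp; have cw := can _ _ c0 w0 wc.
exists chi; split=> // f.
have wp g : subst w g = subst phi g by rewrite -[in LHS](pc g) cw.
by rewrite -wp cw.
Qed.

Lemma subst_right_equivalent (I : finType) (phi : I -> cps v I) (f g : cps v I) :
  (forall i, scoef (phi i) 0 = 0) -> jac_inv phi -> f = subst phi g ->
  right_equivalent f g.
Proof.
move=> p0 pJ fE; have [chi [_ _ pc cp]] := inverse_function2 p0 pJ.
by exists (subst phi); split=> //; exists (subst chi).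
Qed.

(** The map (t, s) -> (t, s - t s) is inverted in two variables. Putting t = s = u in the second
    component of the inverse gives w with w - u w = u, so 1 + w inverts 1 - u. *)
Lemma cps_unit (I : finType) (f : cps v I) : scoef f 0 != 0 ->
  exists g, f * g = 1.
Proof.
move=> f0; pose phi (b : bool) : cps v bool :=
  if b then cps_var v true else cps_var v false - cps_var v true * cps_var v false.
have p0 b : scoef (phi b) 0 = 0.
  by case: b; rewrite /phi ?scoefB ?scoefM0 !scoef_var0 ?mulr0 ?subrr.
have pJ : jac_inv phi.
  exists (fun b c => (b == c)%:R) => i k; rewrite (bigD1 i)//= eqxx mul1r.
  rewrite big1 ?addr0 => [|j /negbTE ji]; last by rewrite eq_sym ji mul0r.
  by case: i; rewrite /phi ?scoefB ?scoefM_expo1 ?scoef_var0 ?scoef_var_expo1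
     ?mulr0 ?mul0r ?addr0 ?subr0.
have [chi [c0 cp]] := inverse_function p0 pJ.
pose u : cps v I := 1 - (scoef f 0)^-1 *: f.
have u0 : scoef u 0 = 0 by rewrite scoefB scoefZ scoef1 eqxx mulVf// subrr.
pose w := subst (fun _ : bool => u) (chi false).
have uw : w - u * w = u.
  have := congr1 (subst (fun _ : bool => u)) (cp false).
  rewrite subst_var// /phi raddfB/= rmorphM/= !subst_var// raddfB/= rmorphM/=.
  have -> : chi true = cps_var v true by rewrite -[RHS](cp true) /phi subst_var.
  by rewrite subst_var.
exists ((scoef f 0)^-1 *: (1 + w)); rewrite -scalerAr scalerAl.
have -> : (scoef f 0)^-1 *: f = 1 - u by rewrite opprB addrC subrK.
by rewrite mulrDr mulr1 mulrBl mul1r uw subrK.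
Qed.

Lemma right_equivalentP (I : finType) (f g : cps v I) :
  right_equivalent f g <-> exists phi : I -> cps v I,
    [/\ forall i, scoef (phi i) 0 = 0, jac_inv phi & f = subst phi g].
Proof.
split=> [[F [[G GF FG] fE]]|[phi [p0 pJ fE]]]; last first.
  exact: subst_right_equivalent p0 pJ fE.
pose phi i := F (cps_var v i).
have p0 i : scoef (phi i) 0 = 0.
  (* If the image of x_i had constant term u != 0, the unit x_i - u would be sent to a series
     without constant term. *)
  apply/eqP/negPn/negP => u0; set u := scoef (phi i) 0 in u0.
  have [|h hE] := @cps_unit _ (cps_var v i - u%:A).
    by rewrite scoefB scoef_var0 scoefZ scoef1 eqxx mulr1 sub0r oppr_eq0.
  have := congr1 (fun x => scoef (F x) 0) hE.
  rewrite rmorphM rmorph1 scoef1 eqxx scoefM0 raddfB/= linearZ/= rmorph1.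
  rewrite scoefB scoefZ scoef1 eqxx mulr1 subrr mul0r => /eqP.
  by rewrite eq_sym oner_eq0.
have FE : F =1 subst phi by apply: lrmorphism_subst.
exists phi; split=> //; last by rewrite fE FE.
exists (fun i j => scoef (G (cps_var v i)) (expo1 j)) => i k.
by rewrite -scoef_subst_expo1// -FE FG scoef_var_expo1.
Qed.

Lemma right_equivalent_sym (I : finType) (f g : cps v I) :
  right_equivalent f g -> right_equivalent g f.
Proof.
move=> /right_equivalentP[phi [p0 pJ ->]].
have [chi [c0 cJ pc cp]] := inverse_function2 p0 pJ.
by apply/right_equivalentP; exists chi; split.
Qed.

Lemma right_equivalent_trans (I : finType) (f g h : cps v I) :
  right_equivalent f g -> right_equivalent g h -> right_equivalent f h.
Proof.
move=> [F [Fb ->]] [G [Gb ->]]; exists (F \o G); split=> //.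
exact: bij_comp.
Qed.

End Inverse.

(** * Hessians and quadratic forms *)

Section Hessian.
Variables (R : realType) (K : fieldType) (v : real_valuation R K).

Definition hess (I : finType) (f : cps v I) i j : K := scoef (deriv i (deriv j f)) 0.

Lemma hessianE n (f : cps v 'I_n) i j : hessian f i j = hess f i j.
Proof. by rewrite mxE. Qed.

Lemma hessD (I : finType) (f g : cps v I) i j : hess (f + g) i j = hess f i j + hess g i j.
Proof. by rewrite /hess !raddfD. Qed.

Lemma hessZ (I : finType) k (f : cps v I) i j : hess (k *: f) i j = k * hess f i j.
Proof. by rewrite /hess !derivZ scoefZ. Qed.

Lemma hess_sum (I : finType) (T : Type) (r : seq T) (P : pred T) (F : T -> cps v I) i j :
  hess (\sum_(t <- r | P t) F t) i j = \sum_(t <- r | P t) hess (F t) i j.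
Proof. by rewrite /hess !raddf_sum/= scoef_sum. Qed.

Lemma hessM (I : finType) (f g : cps v I) i j : scoef f 0 = 0 -> scoef g 0 = 0 ->
  hess (f * g) i j = scoef f (expo1 i) * scoef g (expo1 j)
                   + scoef f (expo1 j) * scoef g (expo1 i).
Proof.
move=> f0 g0; rewrite /hess derivM raddfD/= !derivM !scoefD !scoefM0 !scoef_deriv0.
by rewrite f0 g0 mulr0 mul0r addr0 add0r addrC.
Qed.

Lemma hess_subst (I J : finType) (phi : J -> cps v I) (f : cps v J) i k :
  (forall j, scoef (phi j) 0 = 0) -> cord 2 f ->
  hess (subst phi f) i k = \sum_j \sum_l
     hess f j l * (scoef (phi j) (expo1 i) * scoef (phi l) (expo1 k)).
Proof.
move=> p0 f2; rewrite /hess deriv_subst// raddf_sum/= scoef_sum exchange_big/=.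
apply: eq_bigr => l _; rewrite derivM scoefD !scoefM0 scoef_subst0 !scoef_deriv0.
have [_ f1] := (cord2P f).1 f2; rewrite f1 mul0r addr0 scoef_subst_expo1//.
rewrite mulr_suml; apply: eq_bigr => j _; by rewrite -scoef_deriv0 mulrA.
Qed.

Lemma hess_emb0 (I : finType) (P : pred I) (g : cps v {i | P i}) i j :
  cord 2 g -> (forall a b, hess g a b = 0) -> hess (cps_emb g) i j = 0.
Proof.
move=> g2 gh; rewrite emb_subst hess_subst//; last by move=> l; apply: scoef_var0.
by rewrite big1// => a _; rewrite big1// => b _; rewrite gh mul0r.
Qed.

(** For the converse, [split_const] writes a series of order d + 1 as a combination of the variables
    with coefficients of order d. *)
Lemma ideal_exp_cord (I : finType) d (f : cps v I) :
  ideal_exp (maxideal v I) d f <-> cord d f.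
Proof.
have m1 (g : cps v I) : maxideal v I g -> cord 1 g.
  move=> [k [c [s [sv ->]]]]; apply: cord_sum => i _; apply: cordMr.
  by have [j _ <-] := sv i; apply: cord_var.
elim: d f => [//|d IH] f; split=> [[k [c [s [sab ->]]]]|fd].
  apply: cord_sum => i _; apply: cordMr; have [a am [b bd <-]] := sab i.
  by rewrite -add1n; apply: cordM; [apply: m1|apply/IH].
exists #|I|, (fun=> 1), (fun k => cps_var v (enum_val k) * quo predT (enum_val k) f).
split=> [k|].
  exists (cps_var v (enum_val k)).
    exists 1%N, (fun=> 1), (fun=> cps_var v (enum_val k)); split=> [_|].
      by exists (enum_val k).
    by rewrite big_ord1 mul1r.
  by exists (quo predT (enum_val k) f) => //; apply/IH/cord_quo.
rewrite [LHS](split_const f) (_ : scoef f 0 = 0); last by apply: fd; rewrite deg0.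
rewrite scale0r add0r (reindex (@enum_val I I)); last exact/onW_bij/enum_val_bij.
by apply: eq_bigr => k _; rewrite mul1r.
Qed.

Definition quad n (T : 'M[K]_n) (I : finType) (x : 'I_n -> cps v I) : cps v I :=
  \sum_i \sum_j T i j *: (x i * x j).

Lemma quadD n (T : 'M[K]_n) (I : finType) (x u : 'I_n -> cps v I) :
  quad T (fun i => x i + u i) = quad T x +
  \sum_i u i * (\sum_j (T + T^T) i j *: x j + \sum_j T i j *: u j).
Proof.
have E : \sum_i \sum_j T i j *: (x i * u j) = \sum_i \sum_j T j i *: (u i * x j).
  by rewrite exchange_big/=; apply: eq_bigr => i _; apply: eq_bigr => j _; rewrite mulrC.
transitivity (quad T x + (\sum_i \sum_j T i j *: (x i * u j) +
  \sum_i \sum_j (T i j *: (u i * x j) + T i j *: (u i * u j)))).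
  rewrite /quad -!big_split/=; apply: eq_bigr => i _.
  rewrite -!big_split/=; apply: eq_bigr => j _.
  by rewrite -!scalerDr mulrDl !mulrDr !addrA.
congr (_ + _); rewrite E -big_split/=; apply: eq_bigr => i _.
rewrite -!big_split/= mulr_sumr; apply: eq_bigr => j _.
rewrite [(T + _) i j]mxE [T^T i j]mxE mulrDr -!scalerAr scalerDl addrA.
by rewrite [X in X + _ = _]addrC.
Qed.

Lemma subst_quad n (T : 'M[K]_n) (I J : finType) (phi : J -> cps v I) (x : 'I_n -> cps v J) :
  subst phi (quad T x) = quad T (fun i => subst phi (x i)).
Proof.
rewrite raddf_sum; apply: eq_bigr => i _; rewrite raddf_sum; apply: eq_bigr => j _.
by rewrite /= linearZ/= rmorphM.
Qed.

Lemma cord_quad n (T : 'M[K]_n) : cord 2 (quad T (cps_var v)).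
Proof.
apply: cord_sum => i _; apply: cord_sum => j _; apply: cordZ.
by rewrite -[2%N]/(1 + 1)%N; apply: cordM; apply: cord_var.
Qed.

Lemma hess_quad n (T : 'M[K]_n) i j : hess (quad T (cps_var v)) i j = T i j + T j i.
Proof.
rewrite hess_sum (eq_bigr (fun a => (i == a)%:R * T a j + (j == a)%:R * T a i)).
  rewrite big_split/=; congr (_ + _).
    by rewrite (bigD1 i)//= eqxx mul1r big1 ?addr0// => a /negbTE ai; rewrite eq_sym ai mul0r.
  by rewrite (bigD1 j)//= eqxx mul1r big1 ?addr0// => a /negbTE ai; rewrite eq_sym ai mul0r.
move=> a _; rewrite hess_sum.
rewrite (eq_bigr (fun b => (i == a)%:R * ((j == b)%:R * T a b) +
    (j == a)%:R * ((i == b)%:R * T a b))).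
  rewrite big_split/= -!mulr_sumr; congr (_ * _ + _ * _).
    by rewrite (bigD1 j)//= eqxx mul1r big1 ?addr0// => b /negbTE bj; rewrite eq_sym bj mul0r.
  by rewrite (bigD1 i)//= eqxx mul1r big1 ?addr0// => b /negbTE bj; rewrite eq_sym bj mul0r.
move=> b _; rewrite hessZ hessM ?scoef_var0// !scoef_var_expo1 mulrDr.
rewrite ![_ == i]eq_sym ![_ == j]eq_sym; congr (_ + _); by rewrite mulrC mulrA.
Qed.

Lemma jac_inv_inj n (phi : 'I_n -> cps v 'I_n) :
  (forall x : 'I_n -> K, (forall i, \sum_j scoef (phi i) (expo1 j) * x j = 0) ->
     forall i, x i = 0) -> jac_inv phi.
Proof.
move=> inj; pose M : 'M[K]_n := \matrix_(i, j) scoef (phi i) (expo1 j).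
have uM : M^T \in unitmx.
  rewrite -row_free_unit -kermx_eq0; apply/eqP/matrixP => r i; rewrite [RHS]mxE.
  move: i; apply: (inj (fun i => kermx M^T r i)) => i.
  have /matrixP/(_ r i) := mulmx_ker M^T; rewrite [LHS]mxE [RHS]mxE => E.
  by apply: etrans E; apply: eq_bigr => j _; rewrite [M^T _ _]mxE [M _ _]mxE mulrC.
rewrite unitmx_tr in uM.
exists (fun i j => invmx M i j) => i k.
have /matrixP/(_ i k) := mulVmx uM; rewrite [LHS]mxE [RHS]mxE => E.
by apply: etrans E; apply: eq_bigr => j _; rewrite [M _ _]mxE.
Qed.

End Hessian.

(** S picks a maximal independent set of rows of W. The first clause says that these rows span the
    row space, the second that they are independent, both as tests on vectors. *)
Lemma row_basis_set (K : fieldType) n (W : 'M[K]_n) : exists S : {set 'I_n},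
  (forall x : 'cV_n, (forall i, i \in S -> (W *m x) i 0 = 0) -> W *m x = 0) /\
  (forall c : 'rV_n, (forall i, i \notin S -> c 0 i = 0) -> c *m W = 0 -> c = 0).
Proof.
pose f := maxrankfun W.
have rf : row_free (rowsub f W) by apply: maxrowsub_free.
have f_inj : injective f by apply: maxrankfun_inj.
exists [set f r | r in 'I_(\rank W)]; split=> [x x0|c cS cW].
  have /submxP[D DE] : (W <= rowsub f W)%MS by rewrite eq_maxrowsub.
  rewrite DE -mulmxA [X in _ *m X](_ : _ = 0) ?mulmx0//.
  apply/matrixP => r j; rewrite ord1 [RHS]mxE -[RHS](x0 (f r)) ?imset_f//.
  by rewrite !mxE; apply: eq_bigr => l _; rewrite !mxE.
pose c' := colsub f c.
have cE : c *m W = c' *m rowsub f W.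
  apply/matrixP => a j; rewrite !mxE (bigID (mem [set f r | r in 'I_(\rank W)]))/=.
  rewrite [X in _ + X]big1 ?addr0 => [|i iS]; last by rewrite [a]ord1 cS ?mul0r.
  rewrite big_imset/=; last by move=> r s _ _; apply: f_inj.
  apply: eq_big => [r|r _] //.
  by rewrite /c' !mxE.
have c'0 : c' = 0.
  by apply: (row_free_inj rf); rewrite mul0mx -cE cW.
apply/matrixP => a i; rewrite [a]ord1 [RHS]mxE.
have [/imsetP[r _ ->]|/cS//] := boolP (i \in [set f r | r in 'I_(\rank W)]).
by have /matrixP/(_ 0 r) := c'0; rewrite !mxE.
Qed.

(** * Isometries of a quadratic form supported on a block of variables *)

Section BlockProjection.
Variables (K : fieldType) (n : nat) (P : pred 'I_n).

(** [P] marks the residual variables y, so this projects onto the variables x of the quadratic part;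
    the hypothesis [BD] below makes D an inverse of the polar form on that block. *)
Definition proj_mx : 'M[K]_n := \matrix_(i, j) ((i == j) && ~~ P i)%:R.

Lemma proj_mxl m (A : 'M[K]_(n, m)) i j : (proj_mx *m A) i j = (~~ P i)%:R * A i j.
Proof.
rewrite mxE (bigD1 i)//= mxE eqxx big1 ?addr0// => k /negbTE ki.
by rewrite mxE eq_sym ki mul0r.
Qed.

Lemma proj_mxr m (A : 'M[K]_(m, n)) i j : (A *m proj_mx) i j = A i j * (~~ P j)%:R.
Proof.
rewrite mxE (bigD1 j)//= mxE eqxx big1 ?addr0// => k /negbTE kj.
by rewrite mxE kj mulr0.
Qed.

Lemma tr_proj_mx : proj_mx^T = proj_mx.
Proof.
apply/matrixP => i j; rewrite !mxE eq_sym; case: (i =P j) => [->|] //.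
Qed.

Variables (T D J : 'M[K]_n).
Hypothesis T0 : forall i j, P i || P j -> T i j = 0.
Hypothesis BD : (T + T^T) *m D = proj_mx.

Lemma proj_T : proj_mx *m T = T.
Proof.
apply/matrixP => i j; rewrite proj_mxl; case Pi: (P i); rewrite ?mul1r//.
by rewrite mul0r T0 ?Pi.
Qed.

Lemma T_proj : T *m proj_mx = T.
Proof.
apply/matrixP => i j; rewrite proj_mxr; case Pj: (P j); rewrite ?mulr1//.
by rewrite mulr0 T0 ?Pj ?orbT.
Qed.

Lemma B_proj : (T + T^T) *m proj_mx = T + T^T.
Proof.
by rewrite mulmxDl T_proj -[in X in _ + X]tr_proj_mx -trmx_mul proj_T.
Qed.

Lemma DB : D^T *m (T + T^T) = proj_mx.
Proof.
by rewrite -[RHS]tr_proj_mx -BD trmx_mul; congr (_ *m _); rewrite linearD/= trmxK addrC.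
Qed.

Hypothesis JBJ : J^T *m (T + T^T) *m J = T + T^T.

(** As V inverts J, B J = V^T B, whose columns indexed by y vanish. Since B is invertible on the
    x-block, the corresponding entries of J vanish. *)
Lemma isometry_block V i j : J *m V = 1%:M -> ~~ P i -> P j -> J i j = 0.
Proof.
move=> JV Pi Pj; have BJ : (T + T^T) *m J = V^T *m (T + T^T).
  by rewrite -[in RHS]JBJ !mulmxA -trmx_mul JV trmx1 mul1mx.
have /matrixP/(_ i j) : proj_mx *m J = D^T *m V^T *m (T + T^T) *m proj_mx.
  by rewrite -[RHS]mulmxA B_proj -[RHS]mulmxA -BJ mulmxA DB.
by rewrite proj_mxl proj_mxr Pi Pj mul1r mulr0.
Qed.

(* On the space K^n + K^n with the quadratic form q (+) -q, where q is given by
   T, the graph of the isometry J is totally isotropic. In the hyperbolic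
   coordinates u = J x - x, w = B x + T u it is therefore transversal to the
   coordinate subspace {u_i = 0 for i in S, w_i = 0 for i not in S} as soon as S
   indexes a row basis of J - 1. *)
Lemma isometry_transversal : exists S : {set 'I_n},
  (forall i, i \in S -> ~~ P i) /\
  forall x : 'cV_n, (forall i, P i -> x i 0 = 0) ->
    (forall i, i \in S -> ((J - 1%:M) *m x) i 0 = 0) ->
    (forall i, ~~ P i -> i \notin S ->
       ((T + T^T + T *m (J - 1%:M)) *m x) i 0 = 0) -> x = 0.
Proof.
have := JBJ; set W := J - 1%:M; set B := T + T^T => JBJ'.
(* W is compressed to the x-block: its rows indexed by y become zero, hence cannot belong to S. *)
have [S [S1 S2]] := row_basis_set (proj_mx *m W *m proj_mx).
have SP i : i \in S -> ~~ P i.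
  move=> iS; apply/negP => Pi; have /matrixP/(_ 0 i)/eqP : delta_mx 0 i = 0 :> 'rV[K]_n.
    apply: S2 => [j jS|].
      by rewrite mxE; case: (j =P i) => [ji|]; rewrite ?andbF//; rewrite ji iS in jS.
    by apply/matrixP => a j; rewrite -rowE mxE proj_mxr proj_mxl Pi !mul0r mxE.
  by rewrite !mxE !eqxx oner_eq0.
exists S; split=> // x xP xS xN.
have Qx : proj_mx *m x = x.
  apply/matrixP => i j; rewrite [j]ord1 proj_mxl.
  by case Pi: (P i); rewrite /= ?mul1r// mul0r xP.
(* The product with x vanishes on the rows in S, and these span all rows of the compressed W. *)
have Wx : proj_mx *m W *m x = 0.
  rewrite -[X in _ *m X]Qx mulmxA; apply: S1 => i iS.
  by rewrite -mulmxA Qx -mulmxA proj_mxl (SP _ iS) mul1r xS.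
have TWx : T *m W *m x = 0 by rewrite -T_proj -!mulmxA [proj_mx *m _]mulmxA Wx mulmx0.
have BQ : B *m proj_mx = B := B_proj.
have BWx : B *m W *m x = 0 by rewrite -BQ -!mulmxA [proj_mx *m _]mulmxA Wx mulmx0.
have BxN i : i \notin S -> (B *m x) i 0 = 0.
  move=> iS; case Pi: (P i); last first.
    by have := xN i (negbT Pi) iS; rewrite mulmxDl TWx addr0.
  rewrite mxE big1// => j _; rewrite [B i j](_ : _ = 0) ?mul0r//.
  by rewrite /B !mxE !T0 ?addr0// Pi ?orbT.
(* The isometry relation for J = W + 1 expands to W^T B W + W^T B + B W = 0; since B W x = 0,
   applying it to x leaves W^T B x = 0. *)
have WBx : W^T *m B *m x = 0.
  have : (W^T *m B *m W + W^T *m B + B *m W) *m x = 0.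
    have -> : W^T *m B *m W + W^T *m B + B *m W = 0; last by rewrite mul0mx.
    apply: (addIr B); rewrite add0r -[RHS]JBJ' -[in RHS](subrK 1%:M J) -/W.
    rewrite [(W + _)^T]linearD/= trmx1 [(W^T + _) *m _]mulmxDl mul1mx.
    rewrite [_ *m (W + _)]mulmxDr mulmx1 [(_ + B) *m W]mulmxDl [RHS]addrA.
    by congr (_ + _); apply: addrAC.
  rewrite [(_ + _ + _) *m x]mulmxDl [(_ + _) *m x]mulmxDl BWx addr0.
  by rewrite -[W^T *m B *m W]mulmxA -mulmxA BWx mulmx0 add0r.
(* The entries of B x are supported on S and form a linear relation among the rows of the compressed
   W, so independence forces them to vanish. *)
have Bx : B *m x = 0.
  apply: trmx_inj; rewrite trmx0; apply: S2 => [i iS|]; first by rewrite mxE BxN.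
  have -> : (B *m x)^T *m (proj_mx *m W *m proj_mx) = (W^T *m (proj_mx *m B) *m x)^T *m proj_mx.
    by rewrite !trmx_mul !trmxK tr_proj_mx !mulmxA.
  suff -> : proj_mx *m B = B by rewrite WBx trmx0 mul0mx.
  by rewrite /B mulmxDr proj_T -{1}tr_proj_mx -trmx_mul T_proj.
by rewrite -Qx -DB -mulmxA Bx mulmx0.
Qed.

End BlockProjection.

(** * Uniqueness of the residual part *)

Section Splitting.
Variables (R : realType) (K : fieldType) (v : real_valuation R K).
Variables (n : nat) (P : pred 'I_n).
Notation Y := {i : 'I_n | P i}.

Definition restr_var (i : 'I_n) : cps v Y := if insub i is Some y then cps_var v y else 0.

Lemma restr_var0 i : scoef (restr_var i) 0 = 0.
Proof. by rewrite /restr_var; case: insubP => [y _ _|_]; rewrite ?scoef_var0. Qed.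

Lemma restr_var_val (y : Y) : restr_var (val y) = cps_var v y.
Proof. by rewrite /restr_var valK. Qed.

Lemma restr_varN i : ~~ P i -> restr_var i = 0.
Proof. by move=> Pi; rewrite /restr_var insubN. Qed.

Lemma restr_var_expo1 i y : scoef (restr_var i) (expo1 y) = (i == val y)%:R.
Proof.
rewrite /restr_var; case: insubP => [z Pz <-|Pi].
  by rewrite scoef_var_expo1 (inj_eq val_inj).
by case: eqP => // iy; rewrite iy (valP y) in Pi.
Qed.

Lemma emb_restr (f : cps v 'I_n) : cps_emb (subst restr_var f) = kill (predC P) f.
Proof.
rewrite emb_subst subst_comp => [|j|j]; rewrite ?scoef_var0 ?restr_var0// kill_subst.
apply: subst_eq => i; rewrite /restr_var/=; case: insubP => [y -> <-|Pi].
  by rewrite subst_var ?scoef_var0.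
by rewrite raddf0 Pi.
Qed.

Lemma emb_cord d (g : cps v Y) : cord d g -> cord d (cps_emb g).
Proof. by move=> gd; rewrite emb_subst; apply: cord_subst => // j; apply: scoef_var0. Qed.

Theorem splitting_unique (T D : 'M[K]_n) (g0 g1 : cps v Y) :
  (forall i j, P i || P j -> T i j = 0) ->
  (T + T^T) *m D = proj_mx K P ->
  cord 2 g0 -> (forall a b, hess g0 a b = 0) ->
  (forall a b, hess g1 a b = 0) -> cord 2 g1 ->
  right_equivalent (quad T (cps_var v) + cps_emb g1) (quad T (cps_var v) + cps_emb g0) ->
  right_equivalent g1 g0.
Proof.
move=> T0 BD g02 g0h g1h g12 /right_equivalentP[phi [p0 [V VJ] E]].
pose J : 'M[K]_n := \matrix_(i, j) scoef (phi i) (expo1 j).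
pose Vm : 'M[K]_n := \matrix_(i, j) V i j.
have JE i j : scoef (phi i) (expo1 j) = J i j by rewrite mxE.
have VJm : Vm *m J = 1%:M.
  apply/matrixP => i k; rewrite [RHS]mxE -VJ mxE.
  by apply: eq_bigr => j _; rewrite !mxE.
have JVm := mulmx1C VJm.
have hq (g : cps v Y) i j : cord 2 g -> (forall a b, hess g a b = 0) ->
    hess (quad T (cps_var v) + cps_emb g) i j = (T + T^T) i j.
  by move=> g2 gh; rewrite hessD hess_quad hess_emb0// addr0 !mxE.
(* The residual parts have zero Hessian, so comparing Hessians at 0 in E shows that the linear part
   J is an isometry of the polar form. *)
have JBJ : J^T *m (T + T^T) *m J = T + T^T.
  apply/matrixP => i k; rewrite -[RHS](hq g1)// E hess_subst//; last first.
    by apply: cordD; [apply: cord_quad|apply: emb_cord].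
  rewrite mxE exchange_big/=; apply: eq_bigr => l _.
  rewrite mxE mulr_suml; apply: eq_bigr => j _.
  by rewrite hq// !JE mulrA [X in X * _ * _]mxE [_ * (T + T^T) _ _]mulrC.
have J0 i j : ~~ P i -> P j -> J i j = 0 := isometry_block T0 BD JBJ JVm.
have [S [SP Sinj]] := isometry_transversal T0 BD JBJ.
pose u i := phi i - cps_var v i.
pose w i := \sum_j (T + T^T) i j *: cps_var v j + \sum_j T i j *: u j.
(* The residual variables complete the equations to a square system, as the inverse function theorem
   requires. *)
pose Es i := if P i then cps_var v i else if i \in S then u i else w i.
have u0 i : scoef (u i) 0 = 0 by rewrite scoefB p0 scoef_var0 subrr.
have Es0 i : scoef (Es i) 0 = 0.
  rewrite /Es; case: ifP => _; first exact: scoef_var0.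
  case: ifP => _ //; rewrite scoefD !scoef_sum !big1 ?addr0// => j _.
    by rewrite scoefZ u0 mulr0.
  by rewrite scoefZ scoef_var0 mulr0.
have u1 i j : scoef (u i) (expo1 j) = (J - 1%:M) i j.
  by rewrite scoefB scoef_var_expo1 !mxE.
have w1 i j : scoef (w i) (expo1 j) = (T + T^T + T *m (J - 1%:M)) i j.
  rewrite scoefD !scoef_sum [RHS]mxE; congr (_ + _).
    rewrite (bigD1 j)//= scoefZ scoef_var_expo1 eqxx mulr1 big1 ?addr0//.
    by move=> l /negbTE lj; rewrite scoefZ scoef_var_expo1 lj mulr0.
  by rewrite [RHS]mxE; apply: eq_bigr => l _; rewrite scoefZ u1.
have Einj (x : 'I_n -> K) :
    (forall i, \sum_j scoef (Es i) (expo1 j) * x j = 0) -> forall i, x i = 0.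
  move=> H; suff x0 : (\col_i x i) = 0.
    by move=> i; have /matrixP/(_ i 0) := x0; rewrite !mxE.
  apply: Sinj => [i Pi|i iS|i Pi iS]; have := H i; rewrite /Es.
  - rewrite Pi (bigD1 i)//= scoef_var_expo1 eqxx mul1r big1 ?addr0 ?mxE//.
    by move=> j /negbTE ji; rewrite scoef_var_expo1 eq_sym ji mul0r.
  - rewrite (negbTE (SP _ iS)) iS => <-; rewrite mxE.
    by apply: eq_bigr => j _; rewrite u1 [X in _ * X]mxE.
  - rewrite (negbTE Pi) (negbTE iS) => <-; rewrite mxE.
    by apply: eq_bigr => j _; rewrite w1 [X in _ * X]mxE.
have [chi [chi0 chiE]] := inverse_function Es0 (jac_inv_inj Einj).
(* Putting x = 0 in the inverse of [Es] solves the equations over the residual variables: [Es] takes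
   the value (0, y) at z. *)
pose z i := subst restr_var (chi i).
have z0 i : scoef (z i) 0 = 0 by rewrite scoef_subst0.
have zE i : subst z (Es i) = restr_var i.
  rewrite -[LHS]subst_comp//; last exact: restr_var0.
  by rewrite chiE subst_var// restr_var0.
have zP (y : Y) : z (val y) = cps_var v y.
  rewrite -restr_var_val -zE /Es (valP y) subst_var//.
(* J has no entries in x-rows and y-columns, so the equations have no linear term in y, and the
   x-components of z have order at least 2. *)
have EJ i (y : Y) : scoef (Es i) (expo1 (val y)) = (i == val y)%:R.
  rewrite /Es; case: ifP => Pi; first by rewrite scoef_var_expo1.
  have iy : (i == val y) = false.
    by apply/eqP => iy; rewrite iy (valP y) in Pi.
  have uy j : ~~ P j -> (J - 1%:M) j (val y) = 0.
    move=> Pj; rewrite -u1 scoefB JE J0 ?(valP y)// scoef_var_expo1 sub0r.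
    by case: (j =P val y) Pj => [->|]; rewrite ?oppr0// (valP y).
  rewrite iy; case: ifP => iS; first by rewrite u1 uy ?Pi.
  rewrite w1 !mxE !T0 ?(valP y) ?orbT// !add0r big1// => j _.
  case Pj: (P j); first by rewrite T0 ?Pj ?orbT// mul0r.
  by rewrite uy ?Pj// mulr0.
have z1 i (y : Y) : scoef (z i) (expo1 y) = (i == val y)%:R.
  apply/eqP; rewrite -subr_eq0; apply/eqP; move: i; apply: Einj => i.
  under eq_bigr do rewrite mulrBr.
  rewrite sumrB -[X in X - _]scoef_subst_expo1// ?zE ?restr_var_expo1.
  rewrite (bigD1 (val y))//= eqxx mulr1 big1 ?addr0 => [|j /negbTE ->]; last by rewrite mulr0.
  by rewrite EJ subrr.
pose theta (y : Y) := subst z (phi (val y)).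
have th0 y : scoef (theta y) 0 = 0 by rewrite scoef_subst0.
apply/right_equivalentP; exists theta; split=> //.
  (* J is block triangular, so the y-block of its inverse V inverts its y-block, which is the
     Jacobian of [theta]. *)
  exists (fun y y' => V (val y) (val y')) => y y'.
  rewrite -(inj_eq val_inj) -VJ [RHS](bigID P)/= [X in _ = _ + X]big1 ?addr0; last first.
    by move=> j Pj; rewrite JE J0 ?mulr0// (valP y').
  rewrite [RHS](reindex_omap (op := +%R) (val : Y -> 'I_n) insub)/=; last first.
    by move=> i Pi; rewrite insubT.
  apply: eq_big => [a|a _]; first by rewrite (valP a) valK eqxx.
  congr (_ * _); rewrite scoef_subst_expo1// (bigD1 (val y'))//= z1 eqxx mulr1.
  by rewrite big1 ?addr0// => j /negbTE jy; rewrite z1 jy mulr0.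
have embz (g : cps v Y) : subst z (cps_emb g) = g.
  rewrite emb_subst subst_comp//; last by move=> j; apply: scoef_var0.
  rewrite -[RHS]subst_id; apply: subst_eq => y.
  by rewrite subst_var.
(* Along z one factor of every product u_i w_i vanishes; for an index i of y, w_i is already zero
   because T ignores it. *)
have qz : subst z (subst phi (quad T (cps_var v))) = subst z (quad T (cps_var v)).
  rewrite [subst phi _]subst_quad.
  have -> : quad T (fun i => subst phi (cps_var v i)) = quad T (fun i => cps_var v i + u i).
    by congr quad; apply/funext => i; rewrite subst_var// addrC subrK.
  rewrite quadD raddfD/= [X in _ + X]raddf_sum [X in _ + X]big1 ?addr0// => i _ /=.
  rewrite rmorphM/= -/(w i).
  have := zE i; rewrite /Es; case: ifP => Pi.
    rewrite [w i](_ : _ = 0) ?raddf0 ?mulr0//.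
    rewrite /w !big1 ?addr0// => j _; rewrite ?mxE ?T0 ?Pi ?orbT// ?addr0 scale0r//.
  by case: ifP => iS; rewrite restr_varN ?Pi// => ->; rewrite ?mul0r ?mulr0.
have /(congr1 (subst z)) := E; rewrite !raddfD/= qz embz => /addrI ->.
have v0 (y : Y) : scoef (cps_var v (val y)) 0 = 0 by apply: scoef_var0.
rewrite emb_subst (subst_comp _ p0 v0) subst_comp => [|//|y]; last by rewrite scoef_subst0.
by apply: subst_eq => y; rewrite subst_var.
Qed.

End Splitting.

(** * Existence of the splitting *)

(** With y = D C x, the cross terms of (x + y)^T T (x + y) merge by transposing a one-by-one matrix
    and give x^T (T + T^T) D C x = x^T C x. Neither T nor C has to be symmetric. *)
Lemma complete_square (A : comNzRingType) n (x : 'cV[A]_n) (T C D H Q : 'M[A]_n) :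
  (T + T^T) *m D = Q -> x^T *m Q = x^T -> T + (C + C^T *m (D^T *m T *m D) *m C) = H ->
  (x + D *m C *m x)^T *m T *m (x + D *m C *m x) = x^T *m H *m x.
Proof.
move=> BD xQ <-; set y := D *m C *m x.
have yTx : y^T *m T *m x = x^T *m T^T *m y.
  move: y => y.
  have tr11 (M : 'M[A]_1) : M^T = M by apply/matrixP => i j; rewrite !ord1 mxE.
  by rewrite -[LHS]tr11 !trmx_mul trmxK mulmxA.
have xTy : x^T *m T *m y + x^T *m T^T *m y = x^T *m C *m x.
  by rewrite -mulmxDl -mulmxDr /y !mulmxA -[_ *m _ *m D]mulmxA BD xQ.
have yTy : y^T *m T *m y = x^T *m (C^T *m (D^T *m T *m D) *m C) *m x.
  by rewrite /y !trmx_mul !mulmxA.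
rewrite [(x + y)^T]linearD/= [(_ + _) *m T]mulmxDl [(_ + _) *m (x + y)]mulmxDl !mulmxDr.
rewrite yTx yTy addrA -[X in X + _]addrA xTy.
by rewrite !mulmxDl !addrA.
Qed.

Section Existence.
Variables (R : realType) (K : fieldType) (v : real_valuation R K).
Variables (n : nat) (P : pred 'I_n).
Notation Y := {i : 'I_n | P i}.
Notation A := (cps v 'I_n).

(** Substituting [rho] puts x = 0 without leaving the ring. *)
Let rho i : A := if predC P i then 0 else cps_var v i.

Let rho0 i : scoef (rho i) 0 = 0.
Proof. by rewrite /rho; case: ifP; rewrite ?scoef_var0. Qed.

Let rhoP i : P i -> rho i = cps_var v i.
Proof. by rewrite /rho/= => ->. Qed.

Let rhoN i : ~~ P i -> rho i = 0.
Proof. by rewrite /rho/= => ->. Qed.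

Let rho_expo1 i k : scoef (rho i) (expo1 k) = ((i == k) && P k)%:R.
Proof.
rewrite /rho/=; case: (boolP (P i)) => Pi /=.
  by rewrite scoef_var_expo1; case: eqP => [<-|]; rewrite ?Pi.
by case: eqP => [<-|]//; rewrite (negbTE Pi).
Qed.

Let deriv_rho i j : ~~ P i -> deriv i (rho j) = 0.
Proof.
rewrite /rho/=; case: (boolP (P j)) => Pj Pi /=; last by rewrite raddf0.
by rewrite deriv_var; case: eqP => // ij; rewrite ij Pj in Pi.
Qed.

Let deriv_subst_rho i (f : A) : ~~ P i -> deriv i (subst rho f) = 0.
Proof.
by move=> Pi; rewrite deriv_subst// big1// => j _; rewrite deriv_rho ?mulr0.
Qed.

Let subst_rho_id f : subst rho (subst rho f) = subst rho f.
Proof.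
rewrite subst_comp//; apply: subst_eq => i; case: (boolP (P i)) => Pi.
  by rewrite rhoP// subst_var// rhoP.
by rewrite rhoN// raddf0.
Qed.

Lemma jac_inv_id (s : 'I_n -> A) :
  (forall i k, scoef (s i) (expo1 k) = (i == k)%:R) -> jac_inv s.
Proof.
move=> s1; exists (fun i j => (i == j)%:R) => i k.
rewrite (bigD1 i)//= eqxx mul1r s1 big1 ?addr0// => j /negbTE ji.
by rewrite eq_sym ji mul0r.
Qed.

Lemma hess_subst_id (s : 'I_n -> A) f i k : (forall i, scoef (s i) 0 = 0) ->
  (forall i k, scoef (s i) (expo1 k) = (i == k)%:R) -> cord 2 f ->
  hess (subst s f) i k = hess f i k.
Proof.
move=> s0 s1 f2; rewrite hess_subst// (bigD1 i)//= (bigD1 k)//= !s1 !eqxx !mulr1.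
rewrite !big1 ?addr0// => [j /negbTE ji|l /negbTE lk]; last by rewrite !s1 lk !mulr0.
by rewrite big1// => l _; rewrite s1 ji mul0r mulr0.
Qed.

(* Translating x by a solution psi(y) of df/dx_i (psi(y), y) = 0 removes the
   terms of f that are linear in x. *)
Lemma kill_linear_part (f : A) (B D : 'M[K]_n) : cord 2 f ->
  (forall i j, hess f i j = B i j) -> (forall i j, P j -> B i j = 0) ->
  D *m B = proj_mx K P ->
  exists F : A, [/\ cord 2 F, forall i j, hess F i j = B i j,
    right_equivalent f F & forall i, ~~ P i -> subst rho (deriv i F) = 0].
Proof.
move=> f2 fB B0 DB; have [f0 f1] := (cord2P f).1 f2.
have Bsym i j : B i j = B j i.
  rewrite -!fB /hess !scoef_deriv0 !scoef_deriv.
  rewrite [expo1 i + _]addrC; case: (i =P j) => [->//|/eqP ij].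
  by rewrite !ffunE (negbTE ij) eq_sym (negbTE ij).
pose Es i := if P i then cps_var v i else deriv i f.
have Es0 i : scoef (Es i) 0 = 0.
  by rewrite /Es; case: ifP => _; rewrite ?scoef_var0 ?scoef_deriv0.
have EsJ i k : scoef (Es i) (expo1 k) = if P i then (i == k)%:R else B i k.
  rewrite /Es; case: ifP => _; first by rewrite scoef_var_expo1.
  by rewrite -scoef_deriv0 -/(hess f k i) fB Bsym.
have Einj (x : 'I_n -> K) :
    (forall i, \sum_j scoef (Es i) (expo1 j) * x j = 0) -> forall i, x i = 0.
  move=> H; have xP i : P i -> x i = 0.
    move=> Pi; have := H i; under eq_bigr do rewrite EsJ Pi.
    by rewrite (bigD1 i)//= eqxx mul1r big1 ?addr0// => j /negbTE ji; rewrite eq_sym ji mul0r.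
  have Bx : B *m (\col_i x i) = 0.
    apply/matrixP => i j; rewrite !mxE; case: (boolP (P i)) => Pi.
      by rewrite big1// => l _; rewrite Bsym B0 ?mul0r.
    have := H i => E; rewrite -[RHS]E; apply: eq_bigr => l _.
    by rewrite EsJ (negbTE Pi) mxE.
  move=> i; case: (boolP (P i)) => [/xP//|Pi].
  have /matrixP/(_ i 0) : D *m B *m (\col_i x i) = 0 by rewrite -mulmxA Bx mulmx0.
  by rewrite DB proj_mxl Pi mul1r !mxE.
have [chi [chi0 chiE]] := inverse_function Es0 (jac_inv_inj Einj).
have chiP i : P i -> chi i = cps_var v i.
  by move=> Pi; rewrite -(chiE i) /Es Pi subst_var.
(* The y-columns of B vanish, so psi has no linear part; the translation [s] below is therefore
   tangent to the identity and preserves the Hessian. *)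
have chi1 i k : P k -> scoef (chi i) (expo1 k) = (i == k)%:R.
  move=> Pk; apply/eqP; rewrite -subr_eq0; apply/eqP; move: i; apply: Einj => i.
  under eq_bigr do rewrite mulrBr.
  rewrite sumrB -[X in X - _]scoef_subst_expo1// ?chiE ?scoef_var_expo1.
  rewrite (bigD1 k)//= eqxx mulr1 big1 ?addr0 => [|j /negbTE ->]; last by rewrite mulr0.
  rewrite EsJ; case: ifP => Pi; first by rewrite subrr.
  by rewrite B0// subr0; case: eqP => // ik; rewrite ik Pk in Pi.
pose s i := if P i then cps_var v i else cps_var v i + subst rho (chi i).
have s0 i : scoef (s i) 0 = 0.
  by rewrite /s; case: ifP; rewrite ?scoefD scoef_var0 ?scoef_subst0 ?chi0 ?addr0.
have s1 i k : scoef (s i) (expo1 k) = (i == k)%:R.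
  rewrite /s; case: ifP => Pi; rewrite ?scoefD scoef_var_expo1//.
  rewrite scoef_subst_expo1// big1 ?addr0// => j _; rewrite rho_expo1.
  case: (j =P k) => [->|]; rewrite ?mulr0//; case Pk: (P k); rewrite ?mulr0//.
  rewrite chi1//; case: eqP => [ik|]; rewrite ?mul0r//.
  by rewrite ik Pk in Pi.
have sJ := jac_inv_id s1.
exists (subst s f); split=> [|i j||i Pi].
- exact: cord_subst.
- by rewrite hess_subst_id.
- by apply: right_equivalent_sym; apply/right_equivalentP; exists s.
(* The translation involves y only, so differentiation in x_i commutes with it. *)
have ds j : deriv i (s j) = (i == j)%:R.
  rewrite /s; case: ifP => Pj; first exact: deriv_var.
  by rewrite raddfD/= deriv_var deriv_subst_rho// addr0.
rewrite deriv_subst// (bigD1 i)//= ds eqxx mulr1 big1 ?addr0 => [|j /negbTE ji]; last first.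
  by rewrite ds eq_sym ji mulr0.
rewrite subst_comp//; transitivity (subst (fun j => subst rho (chi j)) (deriv i f)).
  apply: subst_eq => j; rewrite /s; case: ifP => Pj; first by rewrite subst_var// chiP// subst_var.
  by rewrite raddfD/= subst_rho_id subst_var// rhoN ?Pj// add0r.
rewrite -subst_comp// -[deriv i f](_ : Es i = _) ?chiE ?subst_var ?rhoN//.
by rewrite /Es (negbTE Pi).
Qed.

(** The first quotient by x_i restricts at x = 0 to dF/dx_i, which vanishes there, so it can be
    divided once more by the variables x. *)
Lemma quadratic_remainder (F : A) :
  (forall i, ~~ P i -> subst rho (deriv i F) = 0) ->
  exists H : 'M[A]_n, (forall i j, P i || P j -> H i j = 0) /\
    F = subst rho F + \sum_i \sum_j cps_var v i * (cps_var v j * H i j).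
Proof.
move=> dF; pose Q := predC P.
have killE (f : A) : kill Q f = subst rho f by rewrite kill_subst.
have F1 i : Q i -> subst rho (quo Q i F) = 0.
  move=> Qi; rewrite -[RHS](dF i)// [in RHS](split_quo Q F) killE.
  rewrite !raddfD/= deriv_subst_rho// raddf0 add0r !raddf_sum/= (bigD1 i)//=.
  rewrite derivM deriv_var eqxx mul1r raddfD/= rmorphM/= subst_var// rhoN// mul0r addr0.
  rewrite big1 ?addr0// => j /andP[Qj /negbTE ji].
  by rewrite derivM deriv_var eq_sym ji mul0r add0r rmorphM/= subst_var// rhoN// mul0r.
exists (\matrix_(i, j) if Q i && Q j then quo Q j (quo Q i F) else 0); split=> [i j Pij|].
  by rewrite mxE ifF//=; move: Pij; rewrite -negb_or => ->.
rewrite {1}(split_quo Q F) killE; congr (_ + _).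
rewrite big_mkcond; apply: eq_bigr => i _; rewrite -mulr_sumr.
case: ifP => Qi; last first.
  by rewrite big1 ?mulr0// => j _; rewrite mxE Qi mulr0.
rewrite {1}(split_quo Q (quo Q i F)) killE F1// add0r big_mkcond; congr (_ * _).
by apply: eq_bigr => j _; rewrite mxE Qi; case: ifP => // _; rewrite mulr0.
Qed.

(** The entries of an unknown matrix X are taken as independent variables. The map X -> X + X^T r X
    has identity linear part, hence an inverse, into which the entries of e, vanishing at 0, are
    substituted. *)
Lemma solve_matrix_equation (r : 'M[K]_n) (e : 'M[A]_n) :
  (forall i j, scoef (e i j) 0 = 0) ->
  exists C : 'M[A]_n, (forall i j, scoef (C i j) 0 = 0) /\
    C + C^T *m map_mx (in_alg A) r *m C = e.
Proof.
move=> e0; pose IJ : finType := ('I_n * 'I_n)%type.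
pose X i j := cps_var v ((i, j) : IJ).
pose phi (p : IJ) := X p.1 p.2 + \sum_b \sum_a X a p.1 * (r a b)%:A * X b p.2.
have p0 p : scoef (phi p) 0 = 0.
  rewrite scoefD scoef_var0 add0r scoef_sum big1// => b _.
  by rewrite scoef_sum big1// => a _; rewrite scoefM0 scoef_var0 mulr0.
have pJ : jac_inv phi.
  exists (fun p q => (p == q)%:R) => p q.
  rewrite (bigD1 p)//= eqxx mul1r big1 ?addr0 => [|l /negbTE lp]; last first.
    by rewrite eq_sym lp mul0r.
  rewrite scoefD scoef_var_expo1 -surjective_pairing scoef_sum big1 ?addr0// => b _.
  rewrite scoef_sum big1// => a _.
  by rewrite scoefM_expo1 scoefM0 !scoef_var0 mulr0 !mul0r addr0.
have [chi [c0 cE]] := inverse_function p0 pJ.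
pose es (p : IJ) := e p.1 p.2.
have es0 p : scoef (es p) 0 = 0 by apply: e0.
exists (\matrix_(i, j) subst es (chi (i, j))); split=> [i j|].
  by rewrite mxE scoef_subst0.
apply/matrixP => i j; have E := congr1 (subst es) (cE (i, j)).
rewrite [RHS]subst_var// in E; rewrite -[e i j]/(es (i, j)) -E /phi !raddfD/= subst_var//.
rewrite !mxE; congr (_ + _); rewrite !raddf_sum/=; apply: eq_bigr => b _.
rewrite !raddf_sum/= !mxE mulr_suml; apply: eq_bigr => a _.
by rewrite !mxE !rmorphM/= !subst_const !subst_var.
Qed.

Lemma quad_mx (T : 'M[K]_n) (x : 'I_n -> A) : (forall i j, P i || P j -> T i j = 0) ->
  quad T x = ((\col_i (if P i then 0 else x i))^T *m map_mx (in_alg A) T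
              *m (\col_i (if P i then 0 else x i))) 0 0.
Proof.
move=> T0; rewrite mxE /quad exchange_big/=; apply: eq_bigr => j _.
rewrite [(_ *m map_mx _ _) _ _]mxE mulr_suml; apply: eq_bigr => i _; rewrite !mxE.
case Pi: (P i); first by rewrite T0 ?Pi// scale0r !mul0r.
case Pj: (P j); first by rewrite T0 ?Pj ?orbT// scale0r mulr0.
by rewrite mulrAC in_algE mulr_algr.
Qed.

Theorem splitting_exists (f : A) (B D : 'M[K]_n) : cord 2 f ->
  (forall i j, hess f i j = B i j) -> (forall i j, P i || P j -> B i j = 0) ->
  D *m B = proj_mx K P ->
  exists (T : 'M[K]_n) (g : cps v Y),
    [/\ forall i j, P i || P j -> T i j = 0, T + T^T = B, cord 2 g,
      forall a b, hess g a b = 0 &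
      right_equivalent f (quad T (cps_var v) + cps_emb g)].
Proof.
move=> f2 fB B0 DB.
have [|F [F2 FB fF dF]] := kill_linear_part f2 fB _ DB.
  by move=> i j Pj; rewrite B0// Pj orbT.
have [H [H0 FE]] := quadratic_remainder dF.
pose T : 'M[K]_n := \matrix_(i, j) scoef (H i j) 0.
have T0 i j : P i || P j -> T i j = 0 by move=> Pij; rewrite mxE H0.
have hG a b : hess (subst rho F) a b = 0.
  rewrite hess_subst// big1// => j _; rewrite big1// => l _; rewrite FB rho_expo1.
  case: (j =P a) => [->|]; rewrite ?mul0r ?mulr0//; case Pa: (P a); rewrite ?mul0r ?mulr0//.
  by rewrite B0 ?Pa// mul0r.
have TB : T + T^T = B.
  apply/matrixP => a b; rewrite -FB FE hessD hG add0r hess_sum.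
  rewrite (eq_bigr (fun i => (i == a)%:R * T i b + (i == b)%:R * T i a)).
    rewrite big_split/= !mxE; congr (_ + _).
      rewrite (bigD1 a)//= eqxx mul1r mxE big1 ?addr0// => i /negbTE ->.
      by rewrite mul0r.
    rewrite (bigD1 b)//= eqxx mul1r mxE big1 ?addr0// => i /negbTE ->.
    by rewrite mul0r.
  move=> i _; rewrite hess_sum.
  rewrite (eq_bigr (fun j => (i == a)%:R * ((j == b)%:R * T i j) +
      (i == b)%:R * ((j == a)%:R * T i j))).
    rewrite big_split/= -!mulr_sumr; congr (_ * _ + _ * _).
      by rewrite (bigD1 b)//= eqxx mul1r big1 ?addr0// => j /negbTE ->; rewrite mul0r.
    by rewrite (bigD1 a)//= eqxx mul1r big1 ?addr0// => j /negbTE ->; rewrite mul0r.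
  move=> j _; rewrite hessM ?scoefM0 ?scoef_var0 ?mul0r//.
  by rewrite !scoefM_expo1 !scoef_var0 !mul0r !addr0 !scoef_var_expo1 mxE.
(* Transposing the left inverse gives a right inverse, since B is symmetric; the projection confines
   it to the rows of x, so that the substitution [s] fixes y. *)
have BD : (T + T^T) *m (proj_mx K P *m D^T) = proj_mx K P.
  rewrite mulmxA B_proj// -[RHS]tr_proj_mx -DB trmx_mul TB; congr (_ *m _).
  by rewrite -TB linearD/= trmxK addrC.
set D' := _ *m D^T in BD; pose ia := map_mx (in_alg A).
pose e : 'M[A]_n := H - ia _ _ T.
have e0 i j : scoef (e i j) 0 = 0.
  by rewrite !mxE scoefB scoefZ scoef1 eqxx mulr1 subrr.
have [C [C0 CE]] := solve_matrix_equation (D'^T *m T *m D') e0.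
pose xh : 'cV[A]_n := \col_i (if P i then 0 else cps_var v i).
pose N := ia _ _ D' *m C; pose s i := cps_var v i + (N *m xh) i 0.
have sq : (xh + N *m xh)^T *m ia _ _ T *m (xh + N *m xh) = xh^T *m H *m xh.
  apply: (@complete_square _ _ _ _ _ _ _ (ia _ _ (proj_mx K P))).
  - by rewrite /ia map_trmx -map_mxD -map_mxM BD.
  - apply/matrixP => i j; rewrite mxE (bigD1 j)//= !mxE eqxx big1 ?addr0.
      by case: (P j); rewrite /= ?mulr0n ?mulr1n ?rmorph0 ?scale1r ?mulr1 ?mul0r.
    by move=> l /negbTE lj; rewrite !mxE lj rmorph0 mulr0.
  - by rewrite /ia map_trmx -!map_mxM CE /e addrC subrK.
have NxP i : P i -> (N *m xh) i 0 = 0.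
  move=> Pi; rewrite /N -mulmxA mxE big1// => j _.
  by rewrite [ia _ _ _ _ _]mxE proj_mxl Pi/= mul0r scale0r mul0r.
have s0 i : scoef (s i) 0 = 0.
  rewrite scoefD scoef_var0 add0r mxE scoef_sum big1// => j _; rewrite scoefM0 [xh _ _]mxE.
  by case: ifP; rewrite ?scoef0 ?scoef_var0 mulr0.
have s1 i k : scoef (s i) (expo1 k) = (i == k)%:R.
  rewrite scoefD scoef_var_expo1 mxE scoef_sum big1 ?addr0// => j _.
  rewrite scoefM_expo1 [scoef (xh _ _) 0](_ : _ = 0); last first.
    by rewrite mxE; case: ifP; rewrite ?scoef0 ?scoef_var0.
  rewrite mulr0 add0r [scoef (N _ _) _](_ : _ = 0) ?mul0r//.
  by rewrite mxE scoef_sum big1// => l _; rewrite scoefM0 C0 mulr0.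
pose g := subst (@restr_var _ _ v _ P) F.
have FG : cps_emb g = subst rho F by rewrite /g emb_restr kill_subst.
exists T, g; split=> // [|a b|].
- by apply: cord_subst => // j; apply: restr_var0.
- rewrite /g hess_subst//; last by move=> j; apply: restr_var0.
  rewrite big1// => j _; rewrite big1// => l _; rewrite !restr_var_expo1.
  case: (j =P val a) => [->|]; rewrite ?mul0r ?mulr0//.
  by rewrite FB B0 ?(valP a)// mul0r.
apply: right_equivalent_trans fF _; apply/right_equivalentP; exists s; split=> //.
  exact: jac_inv_id.
have sG : subst s (subst rho F) = subst rho F.
  rewrite (subst_comp _ s0 rho0); apply: subst_eq => i.
  case: (boolP (P i)) => Pi; last by rewrite rhoN// raddf0.
  by rewrite rhoP// subst_var// /s NxP// addr0.
have sT : subst s (quad T (cps_var v)) =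
    \sum_i \sum_j cps_var v i * (cps_var v j * H i j).
  rewrite subst_quad; have -> : quad T (fun i => subst s (cps_var v i)) = quad T s.
    by congr quad; apply/funext => i; rewrite subst_var.
  have sE : \col_i (if P i then 0 else s i) = xh + N *m xh.
    apply/matrixP => i j; rewrite [j]ord1 [RHS]mxE [LHS]mxE [xh i 0]mxE.
    by case: ifP => Pi; [rewrite (NxP _ Pi) addr0|].
  have := quad_mx s T0.
  rewrite sE.
  rewrite sq => ->.
  rewrite mxE exchange_big/=; apply: eq_bigr => j _.
  rewrite mxE mulr_suml; apply: eq_bigr => i _.
  rewrite [xh j 0]mxE [xh^T _ _]mxE [xh _ _]mxE.
  have [Pij|] := boolP (P i || P j); first by rewrite (H0 _ _ Pij) !mulr0 mul0r.
  rewrite negb_or => /andP[/negbTE -> /negbTE ->].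
  by rewrite mulrA [RHS]mulrAC.
by rewrite raddfD/= FG sG sT addrC.
Qed.

End Existence.

(** * Normal forms of Hessian matrices *)

Section Congruence.
Variable K : fieldType.

(* Uniformly in the characteristic, Hessian matrices are the matrices of the
   form U + U^T; in characteristic 2 these are the alternating ones. *)
Definition polar n (H : 'M[K]_n) := exists U, H = U + U^T.

Lemma polar_congr n (H M : 'M[K]_n) : polar H -> polar (M *m H *m M^T).
Proof.
move=> [U ->]; exists (M *m U *m M^T).
by rewrite mulmxDr mulmxDl !trmx_mul trmxK mulmxA.
Qed.

Lemma polar_sym n (H : 'M[K]_n) : polar H -> H^T = H.
Proof. by move=> [U ->]; rewrite linearD/= trmxK addrC. Qed.

Lemma polar_drsubmx p m (H : 'M[K]_(p + m)) : polar H -> polar (drsubmx H).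
Proof. by move=> [U ->]; exists (drsubmx U); apply/matrixP => i j; rewrite !mxE. Qed.

(** Symmetric elimination with the invertible corner leaves the Schur complement, again polar as a
    diagonal block of a matrix congruent to H. *)
Lemma schur_congr p m (H : 'M[K]_(p + m)) : polar H -> ulsubmx H \in unitmx ->
  exists (L : 'M_(p + m)) (S : 'M_m), [/\ L \in unitmx, polar S &
    L *m H *m L^T = block_mx (ulsubmx H) 0 0 S].
Proof.
move=> Hp uE; have Hs := polar_sym Hp.
set E := ulsubmx H in uE *; pose B := ursubmx H; pose F := drsubmx H.
have HE : H = block_mx E B B^T F.
  by rewrite -[LHS]submxK /B trmx_ursub Hs.
have Es : E^T = E by rewrite /E trmx_ulsub Hs.
pose L : 'M[K]_(p + m) := block_mx 1%:M 0 (- (B^T *m invmx E)) 1%:M.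
have LT : L^T = block_mx 1%:M (- (invmx E *m B)) 0 1%:M.
  by rewrite tr_block_mx !trmx1 trmx0 linearN/= trmx_mul trmxK trmx_inv Es.
have LHL : L *m H *m L^T = block_mx E 0 0 (F - B^T *m invmx E *m B).
  rewrite LT HE !mulmx_block !(mul1mx, mulmx1, mul0mx, mulmx0, addr0, add0r).
  rewrite !mulNmx !mulmxN -!mulmxA mulVmx// mulmx1 addNr mul0mx oppr0 add0r.
  by rewrite [E *m _]mulmxA mulmxV// mul1mx addNr addrC.
exists L, (F - B^T *m invmx E *m B); split=> //.
- by rewrite unitmxE det_lblock !det1 mulr1 unitr1.
- by have := polar_drsubmx (polar_congr L Hp); rewrite LHL block_mxKdr.
Qed.

Lemma perm_congr n (s : 'S_n) (H : 'M[K]_n) i j :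
  (perm_mx s *m H *m (perm_mx s)^T) i j = H (s i) (s j).
Proof.
by rewrite tr_perm_mx -row_permE -col_permE !mxE.
Qed.

Lemma block_congr p m (M1 E : 'M[K]_p) (M2 S : 'M[K]_m) :
  block_mx M1 0 0 M2 *m block_mx E 0 0 S *m (block_mx M1 0 0 M2)^T =
  block_mx (M1 *m E *m M1^T) 0 0 (M2 *m S *m M2^T).
Proof.
by rewrite tr_block_mx !trmx0 !mulmx_block !(mul0mx, mulmx0, addr0, add0r).
Qed.

Lemma mulmx_congr n (M L H : 'M[K]_n) :
  M *m L *m H *m (M *m L)^T = M *m (L *m H *m L^T) *m M^T.
Proof. by rewrite trmx_mul !mulmxA. Qed.

Lemma mx_neq0P n (H : 'M[K]_n) : H != 0 -> exists i j, H i j != 0.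
Proof.
move=> H0; have [/existsP[i /existsP[j Hij]]|Hn] := boolP [exists i, exists j, H i j != 0].
  by exists i, j.
case/eqP: H0; apply/matrixP => i j; rewrite mxE; apply/eqP/negPn.
by apply: contra Hn => Hij; apply/existsP; exists i; apply/existsP; exists j.
Qed.

Definition diag_part n k (d : 'I_n -> K) : 'M[K]_n :=
  \matrix_(i, j) if (i == j) && (i < k)%N then d i else 0.

Definition diag_congruent n (H : 'M[K]_n) := exists k M d,
  [/\ (k <= n)%N, M \in unitmx, forall i : 'I_n, (i < k)%N -> d i != 0 &
    M *m H *m M^T = diag_part k d].

Lemma diag_congruent_step n (G : 'M[K]_(1 + n)) i :
  (forall S : 'M_n, polar S -> diag_congruent S) -> polar G -> G i i != 0 ->
  diag_congruent G.
Proof.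
move=> IH Gp Gi; pose N := perm_mx (tperm ord0 i) : 'M[K]_(1 + n).
pose G' : 'M[K]_(1 + n) := N *m G *m N^T.
have G'00 : G' ord0 ord0 = G i i by rewrite /G' perm_congr tpermL.
have l0 (j : 'I_1) : lshift n j = ord0 by rewrite [j]ord1; apply/val_inj.
have [L [S [uL Sp LG]]] : exists (L : 'M_(1 + n)) (S : 'M_n), [/\ L \in unitmx,
    polar S & L *m G' *m L^T = block_mx (ulsubmx G') 0 0 S].
  apply: schur_congr; first exact: polar_congr.
  by rewrite unitmxE det_mx11 mxE mxE unitfE l0 G'00.
have [k [M [d [kn uM d0 ME]]]] := IH S Sp.
pose d' (j : 'I_(1 + n)) := if split j is inr j' then d j' else G' ord0 ord0.
exists k.+1, ((block_mx 1%:M 0 0 M : 'M_(1 + n)) *m L *m N), d'; split=> //.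
- rewrite unitmx_mul unitmx_perm andbT unitmx_mul uL andbT.
  by rewrite unitmxE det_ublock det1 mul1r -unitmxE.
- move=> j; rewrite /d'; case: splitP => [j' _ _|j' jj]; first by rewrite G'00.
  by rewrite jj add1n ltnS; apply: d0.
- rewrite mulmx_congr -/G' mulmx_congr LG block_congr ME mul1mx trmx1 mulmx1.
  apply/matrixP => a b; rewrite [RHS]mxE /d'.
  case: (split_ordP a) => a' ->; case: (split_ordP b) => b' ->.
  + by rewrite block_mxEul mxE mxE !l0 eqxx.
  + by rewrite block_mxEur mxE eq_lrshift.
  + by rewrite block_mxEdl mxE eq_rlshift.
  + by rewrite block_mxEdr mxE eq_rshift /= add1n ltnS.
Qed.

Lemma diag_congr n (H : 'M[K]_n) : 2%:R != 0 :> K -> polar H -> diag_congruent H.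
Proof.
move=> two; elim: n H => [|n IH] H Hp.
  exists 0%N, 1%:M, (fun=> 0); split=> //; first exact: unitmx1.
  by apply/matrixP => -[].
have diag_case (G : 'M[K]_n.+1) i : polar G -> G i i != 0 -> diag_congruent G.
  exact: diag_congruent_step.
have [/existsP[i Hi]|Hd] := boolP [exists i, H i i != 0]; first exact: diag_case Hi.
have {}Hd i : H i i = 0.
  by apply/eqP/negPn; apply: contra Hd => Hi; apply/existsP; exists i.
have [H0|H0] := eqVneq H 0.
  exists 0%N, 1%:M, (fun=> 0); split=> //; first exact: unitmx1.
  by rewrite H0 mulmx0 mul0mx; apply/matrixP => i j; rewrite !mxE andbF.
have [i [j Hij]] := mx_neq0P H0.
have ij : i != j by apply: contraNneq Hij => ->; rewrite Hd.
(* With zero diagonal, adding row and column j to row and column i creates the diagonal entry 2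
   H_ij, which is nonzero here. *)
pose N : 'M[K]_n.+1 := 1%:M + delta_mx i j.
have uN : N \in unitmx.
  suff : N *m (1%:M - delta_mx i j) = 1%:M by case/mulmx1_unit.
  rewrite mulmxDl mul1mx mulmxBr mulmx1 mul_delta_mx_0 1?eq_sym// subr0.
  by rewrite addrNK.
have [|k [M [d [kn uM d0 ME]]]] := @diag_case (N *m H *m N^T) i (polar_congr N Hp).
  have -> : (N *m H *m N^T) i i = H i j *+ 2.
    have NT : N^T = 1%:M + delta_mx j i by rewrite linearD/= trmx1 trmx_delta.
    rewrite NT mulmxDl mul1mx mulmxDr mulmx1 mulmxDl !mxE Hd add0r.
    have e1 (A : 'M[K]_n.+1) a b : (delta_mx i a *m A) i b = A a b.
      rewrite mxE (bigD1 a)//= mxE !eqxx mul1r big1 ?addr0// => l /negbTE la.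
      by rewrite mxE la andbF mul0r.
    have e2 (A : 'M[K]_n.+1) a b : (A *m delta_mx b i) a i = A a b.
      rewrite mxE (bigD1 b)//= mxE !eqxx mulr1 big1 ?addr0// => l /negbTE la.
      by rewrite mxE la mulr0.
    have -> : \sum_j0 delta_mx i j i j0 * H j0 i = H j i by rewrite -[RHS](e1 H) mxE.
    have -> : \sum_j0 H i j0 * delta_mx j i j0 i = H i j by rewrite -[RHS](e2 H) mxE.
    have -> : \sum_j0 (delta_mx i j *m H) i j0 * delta_mx j i j0 i = 0.
      by have := e2 (delta_mx i j *m H) i j; rewrite [LHS]mxE e1 Hd.
    by rewrite addr0 -[in H j i](polar_sym Hp) mxE mulr2n.
  by rewrite -mulr_natr mulf_neq0.
exists k, (M *m N), d; split=> //; first by rewrite unitmx_mul uM.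
by rewrite mulmx_congr.
Qed.

(** A sum of l hyperbolic planes completed by zeros: distinct indices below 2l are paired when their
    halves agree. *)
Definition symp_part n l : 'M[K]_n :=
  \matrix_(i, j) [&& (i < l.*2)%N, (j < l.*2)%N, i./2 == j./2 & i != j]%:R.

Definition symp_congruent n (H : 'M[K]_n) := exists l M,
  [/\ (l.*2 <= n)%N, M \in unitmx & M *m H *m M^T = symp_part n l].

Lemma symp_congruent_step n (G : 'M[K]_(2 + n)) i j :
  (forall S : 'M_n, polar S -> symp_congruent S) -> polar G ->
  (forall a, G a a = 0) -> i != j -> G i j != 0 -> symp_congruent G.
Proof.
move=> IH Gp Gd ij Gij.
pose o0 : 'I_(2 + n) := lshift n 0; pose o1 : 'I_(2 + n) := lshift n 1.
(* [s] sends [o0] to i and [o1] to j: as i != j, the index [t j] differs from [o0], so the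
   transposition applied first fixes [o0]. *)
pose t := tperm o0 i; pose s := (tperm o1 (t j) * t)%g.
have s1 : s o1 = j by rewrite permM tpermL /t tpermK.
have s0 : s o0 = i.
  rewrite permM tpermD ?tpermL//.
  by apply: contra_neq ij => tj; rewrite -(tpermL o0 i) -/t -tj /t tpermK.
pose N := perm_mx s : 'M[K]_(2 + n); pose G' := N *m G *m N^T.
have Gs a b : G a b = G b a by rewrite -[in LHS](polar_sym Gp) mxE.
have ord2 (a : 'I_2) : a = 0 \/ a = 1.
  by case: a => [[|[|//]] ?]; [left|right]; apply/val_inj.
have G'E a b : ulsubmx G' a b = (a != b)%:R * G i j.
  rewrite mxE mxE perm_congr.
  have [->|->] := ord2 a; have [->|->] := ord2 b; rewrite -/o0 -/o1 ?s0 ?s1.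
  - by rewrite Gd eqxx mul0r.
  - by rewrite mul1r.
  - by rewrite mul1r Gs.
  - by rewrite Gd eqxx mul0r.
(* Rescaling the first basis vector turns the pairing c into 1. *)
pose c := G i j; pose m0 (a : 'I_2) : K := if a == 0 then c^-1 else 1.
pose M0 : 'M[K]_2 := diag_mx (\row_a m0 a).
have M0E : M0 *m ulsubmx G' *m M0^T = \matrix_(a, b) (a != b)%:R.
  rewrite tr_diag_mx mul_mx_diag mul_diag_mx; apply/matrixP => a b.
  rewrite mxE [X in X * _]mxE G'E ![(\row_a m0 a) _ _]mxE [RHS]mxE /m0.
  have [->|->] := ord2 a; have [->|->] := ord2 b.
  - by rewrite eqxx mul0r mulr0 mul0r.
  - by rewrite /= !mul1r mulr1 mulVf.
  - by rewrite /= !mul1r mulfV.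
  - by rewrite eqxx mul0r mulr0 mul0r.
have uM0 : M0 \in unitmx.
  rewrite unitmxE det_diag unitfE; apply/prodf_neq0 => a _; rewrite mxE /m0.
  by case: ifP; rewrite ?oner_eq0 ?invr_eq0.
have uE : ulsubmx G' \in unitmx.
  suff : ulsubmx G' *m (c^-2 *: ulsubmx G') = 1%:M by case/mulmx1_unit.
  rewrite -scalemxAr; apply/matrixP => a b; rewrite mxE mxE big_ord_recl big_ord1.
  rewrite !G'E -/c [RHS]mxE; have [->|->] := ord2 a; have [->|->] := ord2 b;
  rewrite /= ?eqxx/= ?mul0r ?mulr0 ?mul1r ?add0r ?addr0 ?mulr0// -expr2 mulVf// expf_neq0//.
have [L [S [uL Sp LG]]] := schur_congr (polar_congr N Gp) uE.
have [l [M [ln uM ME]]] := IH S Sp.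
exists l.+1, (block_mx M0 0 0 M *m L *m N); split.
- by rewrite doubleS -[_.+2]add2n leq_add2l.
- rewrite unitmx_mul unitmx_perm andbT unitmx_mul uL andbT.
  by rewrite unitmxE det_ublock unitrM -!unitmxE uM0.
rewrite mulmx_congr -/G' mulmx_congr LG block_congr ME M0E.
apply/matrixP => a b; rewrite [RHS]mxE.
case: (split_ordP a) => a' ->; case: (split_ordP b) => b' ->.
+ rewrite block_mxEul mxE eq_lshift /= doubleS.
  by have [->|->] := ord2 a'; have [->|->] := ord2 b'.
+ rewrite block_mxEur mxE eq_lrshift /= doubleS.
  by have [->|->] := ord2 a'; rewrite /= ?andbF.
+ rewrite block_mxEdl mxE eq_rlshift /= doubleS.
  by have [->|->] := ord2 b'; rewrite /= ?andbF.
+ by rewrite block_mxEdr mxE eq_rshift /= doubleS.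
Qed.

Lemma symp_congr n (H : 'M[K]_n) : 2%:R = 0 :> K -> polar H -> symp_congruent H.
Proof.
move=> two; elim/ltn_ind: n H => n IH H Hp.
have Hd i : H i i = 0.
  by case: Hp => U ->; rewrite !mxE -mulr2n -mulr_natr two mulr0.
have [H0|H0] := eqVneq H 0.
  exists 0%N, 1%:M; split=> //; first exact: unitmx1.
  by rewrite H0 mulmx0 mul0mx; apply/matrixP => i j; rewrite !mxE.
have [i [j Hij]] := mx_neq0P H0.
have ij : i != j by apply: contraNneq Hij => ->; rewrite Hd.
case: n => [|[|n]] in IH H Hp Hd H0 i j Hij ij *; first by case: (i).
  by move: ij; rewrite [i]ord1 [j]ord1 eqxx.
by apply: (symp_congruent_step _ Hp Hd ij Hij) => S; apply: IH.
Qed.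

Lemma rank_proj_factor n k (D B : 'M[K]_n) : (k <= n)%N ->
  D *m B = pid_mx k -> B *m pid_mx k = B -> \rank B = k.
Proof.
move=> kn DB Bk; apply/eqP; rewrite eqn_leq.
have kE : \rank (pid_mx k : 'M[K]_n) = k by rewrite rank_pid_mx.
by rewrite -{1}Bk -[X in (_ <= X)%N && _]kE mxrankM_maxr -[X in (X <= _)%N]kE -DB mxrankM_maxr.
Qed.

End Congruence.

(** * From quadratic forms to the displayed normal forms *)

Section NormalForm.
Variables (R : realType) (K : fieldType) (v : real_valuation R K).

Lemma hess_coef (I : finType) (f : cps v I) i j :
  hess f i j = scoef f (expo1 i + expo1 j) *+ (i == j).+1.
Proof. by rewrite /hess scoef_deriv0 scoef_deriv ffunE eq_sym. Qed.

Lemma cord3P (I : finType) (f : cps v I) : cord 2 f ->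
  (forall i j, scoef f (expo1 i + expo1 j) = 0) -> cord 3 f.
Proof.
move=> f2 f0 c; rewrite ltnS leq_eqVlt => /orP[/eqP c2|]; last exact: f2.
have /deg_gt0P[b [j bE]] : (0 < deg c)%N by rewrite c2.
have b1 : deg b = 1%N by move: c2; rewrite bE degD deg_expo1 addn1 => -[].
have /deg_gt0P[a [i aE]] : (0 < deg b)%N by rewrite b1.
have a0 : a = 0 by apply: deg_eq0; move: b1; rewrite aE degD deg_expo1 addn1 => -[].
by rewrite bE aE a0 add0r; apply: f0.
Qed.

Lemma cord3_hess (I : finType) (f : cps v I) : cord 3 f -> forall i j, hess f i j = 0.
Proof.
by move=> f3 i j; rewrite hess_coef [scoef _ _]f3 ?mul0rn// degD !deg_expo1.
Qed.

(** U is upper triangular with the coefficients of x_i^2 on its diagonal, which avoids halving the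
    Hessian. *)
Lemma hess_polar n (f : cps v 'I_n) : polar (\matrix_(i, j) hess f i j).
Proof.
exists (\matrix_(i, j) if (i < j)%N then hess f i j else
  if i == j then scoef f (expo1 i + expo1 i) else 0).
apply/matrixP => i j; rewrite !mxE.
case: (ltngtP i j) => [ij|ji|/val_inj ->]; last by rewrite eqxx hess_coef eqxx mulr2n.
  by rewrite (negbTE (_ : j != i)) ?addr0// neq_ltn ij orbT.
rewrite (negbTE (_ : i != j)) ?add0r; last by rewrite neq_ltn ji orbT.
by rewrite !hess_coef addrC eq_sym.
Qed.

Lemma linear_change n (f : cps v 'I_n) (M : 'M[K]_n) : cord 2 f -> M \in unitmx ->
  exists f1, [/\ cord 2 f1, right_equivalent f f1 &
    forall a b, hess f1 a b = (M *m (\matrix_(i, j) hess f i j) *m M^T) a b].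
Proof.
move=> f2 uM; pose s i : cps v 'I_n := \sum_j M j i *: cps_var v j.
have s0 i : scoef (s i) 0 = 0.
  by rewrite scoef_sum big1// => j _; rewrite scoefZ scoef_var0 mulr0.
have s1 i k : scoef (s i) (expo1 k) = M k i.
  rewrite scoef_sum (bigD1 k)//= scoefZ scoef_var_expo1 eqxx mulr1 big1 ?addr0//.
  by move=> j /negbTE jk; rewrite scoefZ scoef_var_expo1 jk mulr0.
exists (subst s f); split=> [||a b]; first exact: cord_subst.
  apply: right_equivalent_sym; apply/right_equivalentP; exists s; split=> //.
  exists (fun i j => invmx M j i) => i k.
  have /matrixP/(_ k i) := mulmxV uM; rewrite [LHS]mxE [RHS]mxE eq_sym => <-.
  by apply: eq_bigr => j _; rewrite s1 mulrC.
rewrite hess_subst// [RHS]mxE exchange_big/=; apply: eq_bigr => l _.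
rewrite [in RHS]mxE mulr_suml; apply: eq_bigr => j _.
by rewrite !s1 !mxE mulrA [hess f j l * _]mulrC.
Qed.

(** The difference of the two matrices is alternating, so its terms at (i, j) and (j, i) cancel. *)
Lemma quad_ext n (T T' : 'M[K]_n) : T + T^T = T' + T'^T ->
  (forall i, T i i = T' i i) -> quad T (cps_var v) = quad T' (cps_var v).
Proof.
move=> TT Td; apply/eqP; rewrite -subr_eq0; apply/eqP.
have -> : quad T (cps_var v) - quad T' (cps_var v) = \sum_i \sum_j
    (T i j - T' i j) *: (cps_var v i * cps_var v j).
  rewrite /quad -sumrB; apply: eq_bigr => i _; rewrite -sumrB.
  by apply: eq_bigr => j _; rewrite scalerBl.
set F := fun i j => (T i j - T' i j) *: (cps_var v i * cps_var v j).
have FN i j : F j i = - F i j.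
  rewrite /F mulrC -scaleNr; congr (_ *: _); apply/eqP; rewrite -subr_eq0 opprK.
  have /matrixP/(_ i j) := TT; rewrite !mxE => E.
  by rewrite addrACA -opprD [T j i + _]addrC E [T' j i + _]addrC subrr.
have Fd i : F i i = 0 by rewrite /F Td subrr scale0r.
have E : \sum_i \sum_j F i j = \sum_(i < n) \sum_(j < n | (i < j)%N) F i j
                             + \sum_(i < n) \sum_(j < n | (j < i)%N) F i j.
  rewrite -big_split/=; apply: eq_bigr => i _.
  rewrite (bigID (fun j : 'I_n => (i < j)%N))/=; congr (_ + _).
  rewrite (bigD1 i) ?ltnn//= Fd add0r; apply: eq_bigl => j.
  by rewrite -leqNgt ltn_neqAle andbC.
rewrite -/(F) E [X in _ + X](exchange_big_dep xpredT)//= -big_split/=.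
rewrite big1// => i _; rewrite -big_split/= big1// => j _.
by rewrite FN addNr.
Qed.

Lemma diag_form_quad n k (a : 'I_n -> K) :
  diag_form v k a = quad (diag_part k a) (cps_var v).
Proof.
rewrite /diag_form /quad big_mkcond; apply: eq_bigr => i _.
rewrite (bigD1 i)//= !mxE eqxx big1 ?addr0 => [|j /negbTE ji]; last first.
  by rewrite !mxE eq_sym ji scale0r.
by case: ifP => _; rewrite ?scale0r.
Qed.

Definition char2_part n l (a : 'I_n -> K) : 'M[K]_n := \matrix_(i, j)
  if i == j then (if (i < l.*2)%N then a i else 0)
  else ([&& ~~ odd i, (i < l.*2)%N & j == i.+1 :> nat])%:R.

Lemma char2_form_quad n l (a : 'I_n -> K) : (l.*2 <= n)%N ->
  char2_form v l a = quad (char2_part l a) (cps_var v).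
Proof.
move=> ln.
have ordSE (i : 'I_n) : ~~ odd i && (i < l.*2)%N -> val (ordS i) = i.+1.
  move=> /andP[io il]; rewrite /= modn_small//; apply: leq_trans ln.
  rewrite ltn_neqAle il andbT; apply: contraNneq io => E.
  by rewrite -[odd _]negbK -oddS E odd_double.
have row i : \sum_j char2_part l a i j *: (cps_var v i * cps_var v j) =
    (if (i < l.*2)%N then a i *: cps_var v i ^+ 2 else 0) +
    (if ~~ odd i && (i < l.*2)%N then cps_var v i * cps_var v (ordS i) else 0).
  rewrite (bigD1 i)//= mxE eqxx; congr (_ + _); first by case: ifP; rewrite ?scale0r.
  case: ifPn => [H|H]; last first.
    rewrite big1// => j /negbTE ji; rewrite mxE eq_sym ji andbA (negbTE H) scale0r//.
  rewrite (bigD1 (ordS i))/=; last by rewrite -val_eqE ordSE// gtn_eqF.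
  rewrite mxE -val_eqE ordSE// ltn_eqF// andbA H (introT eqP (ordSE _ H)) /=.
  rewrite scale1r big1 ?addr0// => j.
  move=> /andP[/negbTE ji jS]; rewrite mxE eq_sym ji andbA H/=.
  have -> : (j == i.+1 :> nat) = false by rewrite -(ordSE _ H) val_eqE (negbTE jS).
  by rewrite scale0r.
rewrite /quad (eq_bigr _ (fun i _ => row i)) big_split/= -big_mkcond/= -[X in _ + X]big_mkcond/=.
rewrite [X in X + _](bigID (fun i : 'I_n => ~~ odd i))/=.
rewrite [X in _ + X + _](_ : _ = \sum_(i < n | ~~ odd i && (i < l.*2)%N)
    a (ordS i) *: cps_var v (ordS i) ^+ 2).
  rewrite (eq_bigl (fun i : 'I_n => ~~ odd i && (i < l.*2)%N)); last by move=> i; rewrite andbC.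
  by rewrite -!big_split/=; apply: eq_bigr => i _; rewrite addrAC.
(* Odd indices are reached as successors of even ones. The last index wraps around to 0; parity and
   2l <= n show that it contributes to neither side. *)
rewrite (reindex_onto (@ordS n) (@ord_pred n))/=; last by move=> i _; rewrite ord_predK.
apply: eq_bigl => i; rewrite ordSK eqxx andbT negbK.
have iE : ~~ odd i -> i.+1 != l.*2.
  by apply: contraNneq => E; rewrite -[odd i]negbK -oddS E odd_double.
have [iN|iN] := ltnP i.+1 n.
  rewrite modn_small//= andbC; case io: (odd i) => //=.
  by rewrite ltn_neqAle iE ?io.
have -> : i.+1 = n by apply/eqP; rewrite eqn_leq iN ltn_ord.
rewrite modnn andbF; apply/esym/negbTE/negP => /andP[io il].
have := iE io; rewrite neq_ltn => /orP[/leq_trans/(_ ln)|].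
  by rewrite ltnNge iN.
by move=> /leq_trans/(_ (ltn_ord i)); rewrite ltnNge il.
Qed.

(** The Hessian of a square carries a factor 2, so in characteristic 2 a residual part containing
    squares still meets the requirements of [splitting_unique]. *)
Lemma hess_char2_residual n k (d : {i : 'I_n | (k <= i)%N} -> K) (h : cps v _) :
  2%:R = 0 :> K -> cord 3 h ->
  cord 2 (char2_residual v d h) /\ forall a b, hess (char2_residual v d h) a b = 0.
Proof.
move=> two h3; split=> [|a b].
  apply: cordD; last exact: cordW h3.
  apply: cord_sum => i _; apply: cordZ; rewrite expr2 -[2%N]/(1 + 1)%N.
  by apply: cordM; apply: cord_var.
rewrite hessD (cord3_hess h3) addr0 hess_sum big1// => i _.
rewrite hessZ expr2 hessM ?scoef_var0// [X in _ + X]mulrC -mulr2n -mulr_natr two.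
by rewrite !mulr0.
Qed.

Lemma scoef_var_sqr (I : finType) (i a b : I) :
  scoef (cps_var v i ^+ 2) (expo1 a + expo1 b) = ((i == a) && (i == b))%:R.
Proof.
rewrite expr2; have [<-|ib] := eqVneq i b.
  by rewrite scoef_varM scoef_var_expo1 andbT.
rewrite andbF; have [<-|ia] := eqVneq i a.
  by rewrite addrC scoef_varM scoef_var_expo1 (negbTE ib).
by rewrite scoef_varM0// expo_addE !ffunE (negbTE ia) (negbTE ib).
Qed.

(** A zero Hessian kills the coefficients of x_i x_j for i != j; the remaining quadratic terms are
    squares, collected in d. *)
Lemma char2_residual_split n k (g : cps v {i : 'I_n | (k <= i)%N}) :
  cord 2 g -> (forall a b, hess g a b = 0) ->
  exists d h, cord 3 h /\ g = char2_residual v d h.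
Proof.
move=> g2 gh; pose d i := scoef g (expo1 i + expo1 i).
exists d, (g - \sum_i d i *: cps_var v i ^+ 2).
split; last by rewrite /char2_residual addrC subrK.
apply: cord3P => [|i j].
  apply: cordB => //; apply: cord_sum => i _; apply: cordZ.
  by rewrite expr2 -[2%N]/(1 + 1)%N; apply: cordM; apply: cord_var.
rewrite scoefB scoef_sum (bigD1 i)//= scoefZ scoef_var_sqr eqxx/= big1 ?addr0; last first.
  by move=> l /negbTE li; rewrite scoefZ scoef_var_sqr li mulr0.
have [<-|ij] := eqVneq i j; first by rewrite mulr1 subrr.
by rewrite mulr0 subr0; have := gh i j; rewrite hess_coef (negbTE ij).
Qed.

End NormalForm.

Section Parts.
Variable K : fieldType.

Lemma proj_mx_pid n k : proj_mx K (fun i : 'I_n => (k <= i)%N) = pid_mx k.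
Proof. by apply/matrixP => i j; rewrite !mxE -ltnNge. Qed.

Lemma diag_partM n k (c d : 'I_n -> K) : (forall i : 'I_n, (i < k)%N -> c i * d i = 1) ->
  diag_part k c *m diag_part k d = proj_mx K (fun i : 'I_n => (k <= i)%N).
Proof.
move=> cd; apply/matrixP => i j; rewrite mxE (bigD1 i)//= big1 ?addr0 => [|m /negbTE mi].
  rewrite !mxE eqxx -ltnNge/=; case: (ltnP i k) => ik; rewrite ?andbF ?andbT ?mul0r//.
  by case: eqP => _; rewrite ?mulr0 ?cd.
by rewrite mxE eq_sym mi mul0r.
Qed.

Lemma symp_partM n l : (l.*2 <= n)%N ->
  symp_part K n l *m symp_part K n l = proj_mx K (fun i : 'I_n => (l.*2 <= i)%N).
Proof.
move=> ln; apply/matrixP => i j; rewrite [LHS]mxE [RHS]mxE -ltnNge.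
have [il|il] := ltnP i l.*2; last first.
  by rewrite andbF big1// => m _; rewrite mxE ltnNge il mul0r.
(* p is the partner of i in its pair, the only index contributing to the sum. *)
pose p := if odd i then i.-1 else i.+1.
have pn : (p < n)%N by rewrite /p; case: ifP => io; lia.
rewrite (bigD1 (Ordinal pn))//= big1 ?addr0 => [|m]; last first.
  rewrite -val_eqE /= => /eqP mp; rewrite mxE -val_eqE /=.
  rewrite [X in (nat_of_bool X)%:R](_ : _ = false) ?mul0r//.
  move: mp; rewrite /p; case: ifP => io; lia.
rewrite !mxE -!val_eqE /= [X in (nat_of_bool X)%:R * _](_ : _ = true) ?mul1r; last first.
  by rewrite /p; case: ifP => io; lia.
by congr (_%:R); rewrite /p; case: ifP => io; lia.
Qed.

Lemma char2_part_polar n l (a : 'I_n -> K) : 2%:R = 0 :> K ->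
  char2_part l a + (char2_part l a)^T = symp_part K n l.
Proof.
move=> two; apply/matrixP => i j; rewrite !mxE [j == i]eq_sym.
have [<-|ij] := eqVneq i j; first by rewrite !andbF -mulr2n -[LHS]mulr_natr two mulr0.
move: ij; rewrite -val_eqE /= => ij; rewrite -natrD; congr (_%:R).
lia.
Qed.

End Parts.

(** * Assembly of the two cases *)

Section Assembly.
Variables (R : realType) (K : fieldType) (v : real_valuation R K).

(** The congruence lemmas produce their own k; the first clause identifies it with the rank of the
    Hessian. *)
Lemma splitting_normal_form n k (f : cps v 'I_n) (B D M : 'M[K]_n) :
  cord 2 f -> (k <= n)%N -> M \in unitmx -> M *m hessian f *m M^T = B ->
  D *m B = proj_mx K (fun i : 'I_n => (k <= i)%N) ->
  (forall i j : 'I_n, (k <= i)%N || (k <= j)%N -> B i j = 0) ->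
  \rank (hessian f) = k /\
  exists (T : 'M[K]_n) (g : cps v {i : 'I_n | (k <= i)%N}),
    [/\ forall i j : 'I_n, (k <= i)%N || (k <= j)%N -> T i j = 0, T + T^T = B,
      cord 2 g, forall a b, hess g a b = 0 &
      right_equivalent f (quad T (cps_var v) + cps_emb g)].
Proof.
move=> f2 kn uM MB DB B0; split.
  have <- : \rank B = \rank (hessian f).
    by rewrite -MB mxrankMfree ?row_free_unit ?unitmx_tr// eqmxMfull// row_full_unit.
  apply: (@rank_proj_factor _ _ _ D); rewrite -?proj_mx_pid//.
  apply/matrixP => i j; rewrite proj_mxr; case: (boolP (k <= j)%N) => kj.
    by rewrite mulr0 B0// kj orbT.
  by rewrite mulr1.
have [f1 [f12 ff1 hf1]] := linear_change f2 uM.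
have hB i j : hess f1 i j = B i j.
  have HE : \matrix_(a, b) hess f a b = hessian f.
    by apply/matrixP => a b; rewrite [RHS]hessianE [LHS]mxE.
  by rewrite hf1 -MB HE.
have [T [g [T0 TB g2 gh fq]]] := splitting_exists f12 hB B0 DB.
by exists T, g; split=> //; apply: right_equivalent_trans ff1 fq.
Qed.

End Assembly.

Theorem theorem2p6 (R : realType) (K : fieldType) (v : real_valuation R K)
    (n : nat) (f : cps v 'I_n) (fm2 : ideal_exp (maxideal v 'I_n) 2 f) :
  (forall k : nat, 2%N \notin [pchar K] -> \rank (hessian f) = k ->
    (exists (a : 'I_n -> K) (g : cps v {i : 'I_n | (k <= i)%N}),
      (forall i : 'I_n, (i < k)%N -> a i != 0) /\
      ideal_exp (maxideal v _) 3 g /\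
      right_equivalent f (diag_form v k a + cps_emb g)) /\
    (forall (a : 'I_n -> K) (g0 g1 : cps v {i : 'I_n | (k <= i)%N}),
      (forall i : 'I_n, (i < k)%N -> a i != 0) ->
      ideal_exp (maxideal v _) 3 g0 -> ideal_exp (maxideal v _) 3 g1 ->
      right_equivalent f (diag_form v k a + cps_emb g0) ->
      right_equivalent f (diag_form v k a + cps_emb g1) ->
      right_equivalent g0 g1)) /\
  (forall l : nat, 2%N \in [pchar K] -> \rank (hessian f) = l.*2 ->
    (exists (a : 'I_n -> K) (d : {i : 'I_n | (l.*2 <= i)%N} -> K)
        (h : cps v {i : 'I_n | (l.*2 <= i)%N}),
      ideal_exp (maxideal v _) 3 h /\
      right_equivalent f (char2_form v l a + cps_emb (char2_residual v d h))) /\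
    (forall (a : 'I_n -> K) (d : {i : 'I_n | (l.*2 <= i)%N} -> K)
        (h0 h1 : cps v {i : 'I_n | (l.*2 <= i)%N}),
      ideal_exp (maxideal v _) 3 h0 -> ideal_exp (maxideal v _) 3 h1 ->
      right_equivalent f (char2_form v l a + cps_emb (char2_residual v d h0)) ->
      right_equivalent f (char2_form v l a + cps_emb (char2_residual v d h1)) ->
      right_equivalent (char2_residual v d h0) (char2_residual v d h1))).
Proof.
have f2 : cord 2 f by apply/ideal_exp_cord.
have Hp : polar (hessian f).
  have -> : hessian f = \matrix_(i, j) hess f i j.
    by apply/matrixP => i j; rewrite [LHS]hessianE [RHS]mxE.
  exact: hess_polar.
split=> [k two rk|l two rl].
  have {}two : 2%:R != 0 :> K by move: two; rewrite inE.
  split=> [|a g0 g1 a0 /ideal_exp_cord g03 /ideal_exp_cord g13 fg0 fg1].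
    have [k' [M [d [kn uM d0 ME]]]] := diag_congr two Hp.
    have [|i j kij|rk' [T [g [T0 TB g2 gh fq]]]] := splitting_normal_form f2 kn uM ME
        (D := diag_part k' (fun i => (d i)^-1)).
    - by apply: diag_partM => i ik; rewrite mulVf ?d0.
    - rewrite mxE; case: eqP => //= ij; case: ifP => // ik.
      by move: kij; rewrite -ij orbb leqNgt ik.
    move: rk' rk => -> kk; subst k'.
    (* The relation T_ii + T_ii = d_i with d_i != 0 makes these coefficients nonzero. *)
    exists (fun i => T i i), g; split=> [i ik|].
      have /matrixP/(_ i i) := TB; rewrite !mxE eqxx ik/= => E.
      by apply: contraNneq (d0 _ ik) => Ti; rewrite -E Ti addr0.
    split.
      (* Outside characteristic 2 a zero Hessian removes the squares as well, so g has order 3. *)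
      apply/ideal_exp_cord/cord3P => // i j; apply/eqP; have /eqP := gh i j.
      rewrite hess_coef; case: (i == j) => //=.
      by rewrite -mulr_natr mulf_eq0 (negbTE two) orbF.
    (* T need not be diagonal, but its polar form is, so its quadratic form is that of its
       diagonal. *)
    rewrite diag_form_quad -(@quad_ext _ _ v n T)// => [|i].
      rewrite TB; apply/matrixP => i j; have /matrixP/(_ i i) := TB.
      rewrite !mxE eqxx [j == i]eq_sym => E.
      case: (i =P j) => [<-|_] /=; last by rewrite addr0.
      by move: E => /=; case: ifP => [_ <-|_ _]; rewrite ?addr0.
    by rewrite mxE eqxx/=; case: ltnP => // ik; rewrite T0 ?ik.
  apply: (@splitting_unique _ _ _ _ _ (diag_part k a) (diag_part k (fun i => (2%:R * a i)^-1))).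
  - move=> i j kij; rewrite mxE; case: eqP => //= ij; case: ifP => // ik.
    by move: kij; rewrite -ij orbb leqNgt ik.
  - have -> : diag_part k a + (diag_part k a)^T = diag_part k (fun i => 2%:R * a i).
      apply/matrixP => i j; rewrite !mxE [j == i]eq_sym.
      case: (i =P j) => [->|_] /=; last by rewrite addr0.
      by case: ifP => _; [rewrite mulr_natl mulr2n|rewrite addr0].
    by apply: diag_partM => i ik; rewrite mulfV// mulf_neq0// a0.
  - exact: cordW g13.
  - exact: cord3_hess.
  - exact: cord3_hess.
  - exact: cordW g03.
  - rewrite -!diag_form_quad; apply: right_equivalent_trans fg1.
    exact: right_equivalent_sym.
have {}two : 2%:R = 0 :> K by move: two; rewrite inE => /andP[_ /eqP].
have ln : (l.*2 <= n)%N by rewrite -rl rank_leq_row.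
split=> [|a d h0 h1 /ideal_exp_cord h03 /ideal_exp_cord h13 fh0 fh1].
  have [l' [M [ln' uM ME]]] := symp_congr two Hp.
  have [|i j lij|rl' [T [g [T0 TB g2 gh fq]]]] := splitting_normal_form f2 ln' uM ME
      (D := symp_part K n l').
  - exact: symp_partM.
  - by rewrite mxE; move: lij => /orP[] H; rewrite !ltnNge H/= ?andbF.
  have ll : l' = l by apply: double_inj; rewrite -rl' rl.
  subst l'; have [d [h [h3 gE]]] := char2_residual_split g2 gh.
  exists (fun i => T i i), d, h; split; first exact/ideal_exp_cord.
  rewrite -gE char2_form_quad// -(@quad_ext _ _ v n T)// => [|i].
    by rewrite TB char2_part_polar.
  by rewrite mxE eqxx; case: ltnP => // il; rewrite T0 ?il.
have [c0 c0h] := hess_char2_residual d two h03.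
have [c1 c1h] := hess_char2_residual d two h13.
apply: (@splitting_unique _ _ _ _ _ (char2_part l a) (symp_part K n l)) => //.
- move=> i j lij; rewrite mxE; case: eqP => [ij|/eqP ij].
    by case: ifP => // il; move: lij; rewrite -ij orbb leqNgt il.
  by case: and3P => // -[io il /eqP jE]; lia.
- by rewrite char2_part_polar// symp_partM.
- rewrite -!char2_form_quad//; apply: right_equivalent_trans fh1.
  exact: right_equivalent_sym.
Qed.
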